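(* Let $G=(V,E)$ be a triangulated sphere. Then $c_3(G) \ge r_3(G) \ge 2^{|V|-4}$.
   Context: A triangulated sphere is the graph (1-skeleton) of a simplicial triangulation of the 2-sphere. On $\mathbb{F}^3$ ($\mathbb{F}=\mathbb{R}$ or $\mathbb{C}$) use $\|x\|^2=\sum x_i^2$. A realisation $p:V\to\mathbb{F}^3$ is generic if its $3|V|$ coordinates are algebraically independent over $\mathbb{Q}$. Realisations $p,q$ are equivalent if $\|p(v)-p(w)\|^2=\|q(v)-q(w)\|^2$ for all edges $vw$, and congruent if $q=Ap+b$ with $b\in\mathbb{F}^3$ and $A^TA=AA^T=I$ ($A$ with entries in $\mathbb{F}$). $G$ is $3$-rigid if some generic framework of $G$ is rigid (every continuous motion preserving edge lengths is a congruence). For a $3$-rigid graph with $|V|\ge 4$: $c_3(G)$ is the number of congruence classes of complex realisations in $\mathbb{C}^3$ equivalent to a generic complex realisation (independent of the choice); $r_3(G)$ is the maximum, over generic real realisations $p:V\to\mathbb{R}^3$, of the number of congruence classes of real realisations in $\mathbb{R}^3$ equivalent to $p$. Triangulated spheres are $3$-rigid. *)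

(* Defs.v *)
From HB Require Import structures.
From mathcomp Require Import all_boot all_algebra.
From mathcomp Require Import mpoly.
From mathcomp Require Import complex.
From mathcomp Require Import Rstruct.

Set Implicit Arguments.
Unset Strict Implicit.
Unset Printing Implicit Defensive.

Import GRing.Theory.
Local Open Scope ring_scope.

(* Triangulated spheres, as (pure 2-dimensional) simplicial complexes  *)
(* given by their set F of triangles on the vertex type T.             *)

Definition sc_edges (T : finType) (F : {set {set T}}) : {set {set T}} :=
  [set e : {set T} | (#|e| == 2)%N && [exists f in F, e \subset f]].

Definition sc_adj (T : finType) (F : {set {set T}}) : rel T :=
  fun u v => (u != v) && [exists f in F, (u \in f) && (v \in f)].

Definition sc_link (T : finType) (F : {set {set T}}) (v : T) : rel T :=
  fun a b => [&& a != v, b != v, a != b & [set v; a; b] \in F].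

(* A triangulated 2-sphere: a finite simplicial complex all of whose
   facets are triangles, covering every vertex, which is a closed
   combinatorial surface (every edge in exactly two triangles, every
   vertex link a single cycle, i.e. connected), connected, and of Euler
   characteristic 2.  By the classification of surfaces these are exactly
   the simplicial triangulations of the 2-sphere. *)
Definition triangulated_sphere (T : finType) (F : {set {set T}}) : Prop :=
  [/\ (forall f, f \in F -> #|f| = 3%N) /\
        (forall v : T, exists2 f, f \in F & v \in f),
      (forall e, e \in sc_edges F -> #|[set f in F | e \subset f]| = 2%N),
      (forall v a b, sc_adj F v a -> sc_adj F v b -> connect (sc_link F v) a b),
      (forall u v : T, connect (sc_adj F) u v)
    & (#|T| + #|F| = #|sc_edges F| + 2)%N].

Definition sqnorm (K : nzRingType) (x : 'cV[K]_3) : K := \sum_(i < 3) x i 0 ^+ 2.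

Definition alg_indep_Q (K : fieldType) (I : finType) (x : I -> K) : Prop :=
  forall P : {mpoly rat[#|I|]}, P != 0 ->
    (map_mpoly (ratr : rat -> K) P).@[fun j => x (enum_val j)] != 0.

Definition generic (K : fieldType) (T : finType) (p : T -> 'cV[K]_3) : Prop :=
  alg_indep_Q (fun vi : T * 'I_3 => p vi.1 vi.2 0).

Definition equivalent (K : fieldType) (T : finType) (F : {set {set T}})
    (p q : T -> 'cV[K]_3) : Prop :=
  forall u v, sc_adj F u v -> sqnorm (p u - p v) = sqnorm (q u - q v).

Definition congruent (K : fieldType) (T : finType) (p q : T -> 'cV[K]_3) : Prop :=
  exists (A : 'M[K]_3) (b : 'cV[K]_3),
    [/\ A^T *m A = 1%:M, A *m A^T = 1%:M & forall v, q v = A *m p v + b].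

Definition classes_ge (K : fieldType) (T : finType) (F : {set {set T}})
    (p : T -> 'cV[K]_3) (k : nat) : Prop :=
  exists qs : 'I_k -> (T -> 'cV[K]_3),
    (forall i, equivalent F p (qs i)) /\
    (forall i j, i != j -> ~ congruent (qs i) (qs j)).

Notation RR := Rdefinitions.R.
Notation CC := (complex Rdefinitions.R).

(* c_3(G) >= k : (any, equivalently every) generic complex realisation has
   at least k congruence classes of equivalent complex realisations *)
Definition c3_ge (T : finType) (F : {set {set T}}) (k : nat) : Prop :=
  forall q : T -> 'cV[CC]_3, generic q -> classes_ge F q k.

(* r_3(G) >= k : some generic real realisation has at least k congruence
   classes of equivalent real realisations (r_3 is a maximum) *)
Definition r3_ge (T : finType) (F : {set {set T}}) (k : nat) : Prop :=
  exists2 p : T -> 'cV[RR]_3, generic p & classes_ge F p k.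

(* Main.v *)
(** A contractible edge of a triangulated sphere G with at least five vertices contracts it to a smaller
    sphere. If q_1, ..., q_N are equivalent, pairwise non-congruent realisations of the contraction with
    independent rigidity rows, move them slightly so that the two endpoints and their common neighbours
    are in general position, and split the merged vertex v of each q_i into v and v + t n, where n is one of
    the two unit normals of the plane of v and its two common neighbours a, b. For small t > 0 the length
    equations of G, rescaled in the direction of n, have a surjective differential at t = 0, so the inverse
    function theorem produces 2N equivalent realisations of G; the two that come from the same q_i are
    told apart by an orientation. Starting from the tetrahedron this gives 2^(|V|-4) realisations, and one of
    them can be moved to a generic position, the others following.

    Contractible edges exist because over F_2 every 3-cycle bounds (Euler characteristic 2): a non-facial
    3-cycle that bounds a least number of faces has a contractible edge on its inside.

    For c_3 >= r_3, the specialisation of a generic real realisation to a generic complex one extends,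
    preserving all polynomial relations, to the coordinates of the equivalent realisations. *)
Require Import Defs.
From HB Require Import structures.
From mathcomp Require Import -(notations) mpoly.
From mathcomp Require Import all_classical all_reals all_analysis.
From mathcomp Require Import all_boot all_order all_algebra.
From mathcomp Require Import complex Rstruct.
From mathcomp Require Import ring lra zify.
Set Implicit Arguments.
Unset Strict Implicit.
Unset Printing Implicit Defensive.
Import Order.TTheory GRing.Theory Num.Theory numFieldNormedType.Exports.

(** * Closed surfaces and boundaries modulo 2 *)

(** Two obstacles shape the argument. Congruence classes are awkward to follow under perturbation,
    so non-congruence is always witnessed by a squared distance between two vertices, which is an
    open condition. Equality of lengths is a closed condition and survives only if the length map is
    open at every member of the family; this is why independence of the rigidity rows is carried
    through the induction: when one realisation moves slightly, the others can be moved to the same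
    new lengths. At scale t = 0 the split puts u on top of v. There the squared length of u v
    vanishes to second order in t, and those of u a and v a have the same differential because n is
    normal to v - a; so the length map itself is not a submersion. Dividing |u-v|^2 by t^2, and
    |u-a|^2 - |v-a|^2 and |u-b|^2 - |v-b|^2 by t, gives polynomials whose differentials at t = 0 see
    the direction of the split through n, v-a and v-b, three independent vectors. The scale is both
    a coordinate and an equation, so that all the new realisations get the same t and hence the same
    lengths. *)

Section Comb.
Variable T : finType.
Implicit Types (F S : {set {set T}}) (f g : {set T}) (x y z : T).

Definition edge_faces F x y := [set f in F | (x \in f) && (y \in f)].

(* Connectedness of the vertex links and of the graph is phrased by closed sets, which pull back along edge
   contractions; the Euler relation is combined with 3|F| = 2|E|. Vertices outside [cover F] are ignored. *)
Record sphere F : Prop := Sphere {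
  sphere_card3 : forall f, f \in F -> #|f| = 3;
  sphere_edge2 : forall x y, sc_adj F x y -> #|edge_faces F x y| = 2;
  sphere_star : forall x S,
    (forall f g y, f \in F -> g \in F -> x \in f -> x \in g -> y != x ->
       y \in f -> y \in g -> f \in S -> g \in S) ->
    forall f g, f \in F -> g \in F -> x \in f -> x \in g -> f \in S -> g \in S;
  sphere_conn : forall X : {set T},
    (forall x y, sc_adj F x y -> x \in X -> y \in X) ->
    forall x y, x \in cover F -> y \in cover F -> x \in X -> y \in X;
  sphere_euler : #|F| + 4 = 2 * #|cover F| }.

Lemma sc_adjC F x y : sc_adj F x y = sc_adj F y x.
Proof.
rewrite /sc_adj eq_sym; congr (_ && _).
by apply: eq_existsb => f; rewrite [(x \in f) && _]andbC.
Qed.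

Lemma sc_adjP F x y :
  reflect (x != y /\ exists f, [/\ f \in F, x \in f & y \in f]) (sc_adj F x y).
Proof.
rewrite /sc_adj; apply: (iffP andP) => [[-> /existsP[f /and3P[? ? ?]]]|[-> [f [? ? ?]]]].
  by split=> //; exists f.
by split=> //; apply/existsP; exists f; apply/and3P.
Qed.

Lemma edge_facesC F x y : edge_faces F x y = edge_faces F y x.
Proof. by apply/setP=> f; rewrite !inE [(x \in f) && _]andbC. Qed.

Lemma set3_of_mem f x y : #|f| = 3 -> x \in f -> y \in f -> x != y ->
  exists z, [/\ z != x, z != y & f = [set x; y; z]].
Proof.
move=> f3 xf yf nxy.
have : #|f :\ x :\ y| = 1.
  have := cardsD1 x f; have := cardsD1 y (f :\ x).
  by rewrite !inE xf yf eq_sym nxy f3 /=; lia.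
move/eqP/cards1P=> [z fz].
have : z \in f :\ x :\ y by rewrite fz inE.
rewrite !inE => /and3P[nzy nzx zf]; exists z; split=> //.
apply/setP=> t; rewrite !inE.
have E : (t \in f :\ x :\ y) = (t == z) by rewrite fz inE.
rewrite -E !inE.
by case: (t =P x) => [->|_] //=; case: (t =P y) => [->|_] //=; rewrite ?orbT.
Qed.

Section Facts.
Variable F : {set {set T}}.
Hypothesis sF : sphere F.

Lemma face_third f x y : f \in F -> x \in f -> y \in f -> x != y ->
  exists z, [/\ z != x, z != y & f = [set x; y; z]].
Proof. by move=> /(sphere_card3 sF); apply: set3_of_mem. Qed.

Lemma mem_cover f x : f \in F -> x \in f -> x \in cover F.
Proof. by move=> fF xf; apply/bigcupP; exists f. Qed.

Lemma adj_in_cover x y : sc_adj F x y -> x \in cover F.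
Proof. by move=> /sc_adjP[_ [f [fF xf _]]]; apply: mem_cover fF xf. Qed.

Lemma edge_faces0 x y : x != y -> ~~ sc_adj F x y -> edge_faces F x y = set0.
Proof.
move=> nxy /sc_adjP nadj; apply/setP=> f; rewrite !inE; apply/negP=> /and3P[fF xf yf].
by apply: nadj; split=> //; exists f.
Qed.

Lemma adj_edge_face x y f : x != y -> f \in edge_faces F x y -> sc_adj F x y.
Proof. by rewrite inE => nxy /and3P[fF xf yf]; apply/sc_adjP; split=> //; exists f. Qed.

(** The coefficient of the edge x y in the boundary of the 2-chain S over F_2. On the diagonal it is
    the parity of the faces of S at x, hence the hypotheses [x != y] below. *)
Definition bd S x y := odd #|edge_faces F x y :&: S|.

Lemma bdC S x y : bd S x y = bd S y x.
Proof. by rewrite /bd edge_facesC. Qed.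

(** An edge lies in exactly two faces; an even number of them in S means none or both. *)
Lemma bd0P S x y f g : x != y -> bd S x y = false ->
  f \in edge_faces F x y -> g \in edge_faces F x y -> f \in S -> g \in S.
Proof.
move=> nxy b0 fe ge fS; have e2 := sphere_edge2 sF (adj_edge_face nxy fe).
have le2 : #|edge_faces F x y :&: S| <= 2 by rewrite -e2; apply/subset_leq_card/subsetIl.
have : #|edge_faces F x y :&: S| == #|edge_faces F x y|.
  have : 0 < #|edge_faces F x y :&: S| by apply/card_gt0P; exists f; rewrite inE fe.
  by rewrite e2; move: le2 b0; rewrite /bd; case: #|_| => [|[|[|]]].
rewrite (subset_leqif_cards (subsetIl _ _)).2 => /eqP eS.
by move: ge; rewrite -eS inE => /andP[].
Qed.

Lemma bd0I S x y :
  (forall f g, f \in edge_faces F x y -> g \in edge_faces F x y -> f \in S -> g \in S) ->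
  x != y -> bd S x y = false.
Proof.
move=> H nxy; rewrite /bd; have [->|[f]] := set_0Vmem (edge_faces F x y :&: S).
  by rewrite cards0.
rewrite inE => /andP[fe fS]; suff -> : edge_faces F x y :&: S = edge_faces F x y.
  by rewrite (sphere_edge2 sF (adj_edge_face nxy fe)).
by apply/setIidPl/subsetP => g ge; apply: (H f).
Qed.

Lemma odd_sum (I : finType) (P : pred I) (h : I -> nat) :
  odd (\sum_(i | P i) h i) = odd #|[set i | P i & odd (h i)]|.
Proof.
rewrite cardsE -sum1_card (big_mkcond P) [in RHS]big_mkcond /=.
rewrite (big_morph odd oddD (erefl _)) [RHS](big_morph odd oddD (erefl _)).
apply: eq_bigr => i _; rewrite [i \in _]unfold_in /=; case: (P i) => //=.
by case: (odd (h i)).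
Qed.

(** Each face of S at x has two further vertices, so it is counted at exactly two edges through
    x. *)
Lemma bd_even S x : ~~ odd #|[set y | y != x & bd S x y]|.
Proof.
rewrite -(odd_sum (fun y => y != x) (fun y => #|edge_faces F x y :&: S|)).
have -> : \sum_(y | y != x) #|edge_faces F x y :&: S| =
          \sum_(f in F | (x \in f) && (f \in S)) 2.
  transitivity (\sum_(y | y != x) \sum_(f in F | (x \in f) && (f \in S)) (y \in f : nat)).
    apply: eq_bigr => y _; rewrite -sum1_card big_mkcond [RHS]big_mkcond /=.
    apply: eq_bigr => f _; rewrite !inE.
    by case: (f \in F) (x \in f) (y \in f) (f \in S) => [] [] [] [].
  rewrite exchange_big /=; apply: eq_bigr => f /and3P[fF xf _].
  rewrite -big_mkcondr /= sum1_card.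
  have <- : #|f :\ x| = 2 by have := cardsD1 x f; rewrite xf (sphere_card3 sF fF) => -[].
  by apply: eq_card => y; rewrite !inE.
by rewrite sum_nat_const oddM andbF.
Qed.

Lemma bd_setC S x y : x != y -> bd (F :\: S) x y = bd S x y.
Proof.
move=> nxy; rewrite /bd; have [adj|/edge_faces0 ->//] := boolP (sc_adj F x y); last by rewrite !set0I.
have := sphere_edge2 sF adj; rewrite -(cardsID S) => h.
have -> : edge_faces F x y :&: (F :\: S) = edge_faces F x y :\: S.
  by apply/setP=> f; rewrite !inE; case: (f \in F) (x \in f) (y \in f) (f \in S) => [] [] [] [].
by move: h => /(congr1 odd); rewrite oddD; case: (odd _); case: (odd _).
Qed.

Lemma bd_setD (P O : {set {set T}}) x y : P \subset O -> bd (O :\: P) x y = bd O x y (+) bd P x y.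
Proof.
move=> sPO; rewrite /bd; set e := edge_faces F x y.
rewrite -(cardsID P (e :&: O)) oddD.
have -> : e :&: O :&: P = e :&: P by rewrite -setIA (setIidPr sPO).
have -> : e :&: O :\: P = e :&: (O :\: P) by rewrite setIDA.
by rewrite addbC addbA addbb.
Qed.

(** The second homology over F_2 is spanned by the sum of all faces. A closed S that contains one
    face at a vertex contains its whole star, the link being connected, and then spreads from vertex
    to vertex along edges. *)
Lemma closed_all S : S \subset F -> (forall x y, x != y -> bd S x y = false) ->
  S = set0 \/ S = F.
Proof.
move=> sSF b0; have [->|[f fS]] := set_0Vmem S; [by left|right].
apply/eqP; rewrite eqEsubset sSF; apply/subsetP => g gF.
pose X := [set x | [forall h in F, (x \in h) ==> (h \in S)]].
have XP x : (exists2 h, h \in S & x \in h) -> x \in X.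
  move=> [h hS xh]; rewrite inE; apply/forall_inP => k kF; apply/implyP => xk.
  apply: (sphere_star sF (x := x) (S := S)) (subsetP sSF h hS) kF xh xk hS.
  move=> f1 f2 y f1F f2F xf1 xf2 nyx yf1 yf2.
  by apply: (bd0P (x := x) (y := y)); rewrite 1?eq_sym ?b0 // 1?eq_sym // inE ?f1F ?f2F ?xf1 ?xf2.
have mem h : h \in F -> exists x, x \in h.
  by move=> hF; apply/set0Pn; rewrite -card_gt0 (sphere_card3 sF).
have [x xf] := mem f (subsetP sSF f fS); have [y yg] := mem g gF.
have : y \in X.
  apply: (sphere_conn sF (X := X)) (mem_cover (subsetP sSF f fS) xf) (mem_cover gF yg) _.
    move=> s t /sc_adjP[_ [h [hF sh th]]]; rewrite inE => /forall_inP/(_ h hF).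
    by rewrite sh => hS; apply: XP; exists h.
  by apply: XP; exists f.
by rewrite inE => /forall_inP/(_ g gF); rewrite yg.
Qed.

End Facts.
End Comb.

(** * The chain complex over F_2 and its first homology *)

Section Homology.
Variable T : finType.
Implicit Types (F S : {set {set T}}) (f g e C : {set T}) (x y z : T).

Lemma card_pair_draws f x : #|f| = 3 -> x \in f ->
  #|[set e : {set T} | [&& e \subset f, #|e| == 2 & x \in e]]| = 2.
Proof.
move=> f3 xf; have := cards_draws f 2; rewrite f3 -(cardsID [set e : {set T} | x \in e]).
have -> : [set A : {set T} | A \subset f & #|A| == 2] :\: [set e : {set T} | x \in e]
        = [set A : {set T} | A \subset f :\ x & #|A| == 2].
  by apply/setP=> e; rewrite !inE subsetD1; case: (e \subset f) (x \in e) => [] [].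
rewrite cards_draws.
have -> : #|f :\ x| = 2 by have := cardsD1 x f; rewrite xf f3 => -[].
have -> : [set A : {set T} | A \subset f & #|A| == 2] :&: [set e : {set T} | x \in e] =
  [set e : {set T} | [&& e \subset f, #|e| == 2 & x \in e]].
  by apply/setP=> e; rewrite !inE andbA.
by rewrite binn addn1 => -[].
Qed.

Lemma sc_edges_adj F x y : x != y -> ([set x; y] \in sc_edges F) = sc_adj F x y.
Proof.
move=> nxy; rewrite inE cards2 nxy /=; apply/existsP/sc_adjP => [[f /andP[fF]]|[_ [f [fF xf yf]]]].
  by rewrite subUset !sub1set => /andP[xf yf]; split=> //; exists f.
by exists f; rewrite fF subUset !sub1set xf.
Qed.

Lemma sc_edgesP F e : e \in sc_edges F -> exists x y, [/\ x != y, sc_adj F x y & e = [set x; y]].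
Proof.
move=> eE; have := eE; rewrite inE => /andP[/cards2P[x [y [nxy de]]] _].
by exists x, y; split=> //; rewrite -sc_edges_adj // -de.
Qed.

Lemma edge_facesE F x y : edge_faces F x y = [set f in F | [set x; y] \subset f].
Proof. by apply/setP=> f; rewrite !inE subUset !sub1set. Qed.

Lemma card_sc_edges F : (forall f, f \in F -> #|f| = 3) ->
  (forall e, e \in sc_edges F -> #|[set f in F | e \subset f]| = 2) ->
  2 * #|sc_edges F| = 3 * #|F|.
Proof.
move=> F3 E2; rewrite mulnC -sum_nat_const.
transitivity (\sum_(e in sc_edges F) \sum_(f in F) (e \subset f : nat)).
  by apply: eq_bigr => e /E2 <-; rewrite -sum1_card -big_mkcondr /=; apply: eq_bigl => f; rewrite inE.
rewrite exchange_big /= mulnC -sum_nat_const; apply: eq_bigr => f fF.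
rewrite -big_mkcondr /= sum1_card -[3]/'C(3, 2) -(F3 f fF) -cards_draws; apply: eq_card => e.
rewrite !inE unfold_in /= !inE.
case: (e \subset f) / idP => [ef|]; rewrite ?andbF ?andbT //=.
by case: (_ == _) => //=; apply/existsP; exists f; rewrite fF.
Qed.

Local Open Scope ring_scope.

Lemma natrF2 n : (n%:R : 'F_2) = (odd n)%:R.
Proof. by rewrite -[in LHS](odd_double_half n) natrD -muln2 natrM [2%:R]char_Fp_0 // mulr0 addr0. Qed.

Lemma F2_cases (a : 'F_2) : a = (a != 0)%:R.
Proof. by case: a => [[|[|]]] //= i; apply/val_inj. Qed.

Variable F : {set {set T}}.
Hypothesis sF : sphere F.
Let E := sc_edges F.

Lemma card_edges : (2 * #|E| = 3 * #|F|)%N.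
Proof.
apply: card_sc_edges; first exact: sphere_card3.
by move=> e /sc_edgesP[x [y [nxy adj ->]]]; rewrite -edge_facesE (sphere_edge2 sF).
Qed.

(** The boundary maps from faces to edges ([M2]) and from edges to vertices ([M1]), acting on row
    vectors. The columns of [M1] outside [cover F] vanish. *)
Let M2 : 'M['F_2]_(#|F|, #|E|) :=
  \matrix_(i < #|F|, j < #|E|) ((enum_val j : {set T}) \subset (enum_val i : {set T}))%:R.
Let M1 : 'M['F_2]_(#|E|, #|T|) :=
  \matrix_(i < #|E|, j < #|T|) ((enum_val j : T) \in (enum_val i : {set T}))%:R.

(** Each vertex of a triangle lies on two of its three sides. C need not be a face: the lemma gives
    [M2 *m M1 = 0] and also that a non-facial 3-cycle is a cycle. *)
Lemma pairs_boundary C : #|C| = 3%N -> (forall e, e \subset C -> #|e| = 2%N -> e \in E) ->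
  (\row_(j < #|E|) ((enum_val j : {set T}) \subset C)%:R : 'rV['F_2]_#|E|) *m M1 = 0.
Proof.
move=> C3 CE; apply/rowP => k; rewrite !mxE.
under eq_bigr => j _ do rewrite !mxE -natrM mulnb.
rewrite -(big_enum_val (fun e : {set T} => ((e \subset C) && (enum_val k \in e))%:R)) /=.
rewrite -natr_sum -big_mkcondr /= sum1_card natrF2.
have [kC|kC] := boolP (enum_val k \in C).
  rewrite (eq_card (B := mem [set e : {set T} | [&& e \subset C, #|e| == 2%N & enum_val k \in e]])).
    by rewrite card_pair_draws.
  move=> e; rewrite !inE unfold_in /=; case eC: (e \subset C); rewrite ?andbF //=.
  case ek: (_ \in e); rewrite ?andbF ?andbT //.
  apply/idP/idP; first by rewrite inE => /andP[].
  by move/eqP; apply: CE.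
rewrite eq_card0 // => e; rewrite unfold_in /=; apply/negP => /and3P[_ /subsetP eC /eC].
by rewrite (negPf kC).
Qed.

Lemma mul_boundary (u : 'rV['F_2]_#|F|) (j : 'I_#|E|) x y : enum_val j = [set x; y] ->
  (u *m M2) 0 j = (bd F [set enum_val i | i in [set i | u 0 i != 0]] x y)%:R.
Proof.
move=> ej; rewrite mxE.
under eq_bigr => i _ do rewrite [M2 _ _]mxE ej (F2_cases (u 0 i)) -natrM mulnb.
rewrite -natr_sum natrF2 -big_mkcond /= sum1_card /bd edge_facesE.
congr (odd _)%:R; rewrite -(card_imset _ (@enum_val_inj _ (mem F))) /=.
apply: eq_card => f; rewrite !inE; apply/imsetP/andP.
  case=> i; rewrite unfold_in /= => /andP[ui se] ->. split; first by rewrite se andbT; exact: enum_valP.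
  by apply/imsetP; exists i; rewrite ?inE.
case=> /andP[_ sf] /imsetP[k]; rewrite inE => ui df; exists k => //.
by rewrite unfold_in /= ui -df.
Qed.

(** By [closed_all] the kernel contains at most the zero vector and the all-one vector. *)
Lemma rank_M2 : (#|F| <= \rank M2 + 1)%N.
Proof.
suff : (kermx M2 <= (const_mx 1 : 'rV['F_2]_#|F|))%MS.
  move/mxrankS; rewrite mxrank_ker => h; have := rank_leq_row (const_mx 1 : 'rV['F_2]_#|F|).
  by lia.
apply/row_subP => i; set u := row i _.
have u0 : u *m M2 = 0 by apply/sub_kermxP; rewrite row_sub.
pose S := [set enum_val i | i in [set i | u 0 i != 0]].
have uS k : (enum_val k \in S) = (u 0 k != 0).
  apply/imsetP/idP => [[l]|uk]; last by exists k; rewrite ?inE.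
  by rewrite inE => ul /enum_val_inj ->.
have SF : S \subset F by apply/subsetP => f /imsetP[k _ ->]; apply: enum_valP.
case: (closed_all sF SF).
- move=> x y nxy; have [adj|nadj] := boolP (sc_adj F x y); last first.
    by rewrite /bd edge_faces0 // set0I cards0.
  have eE : [set x; y] \in E by rewrite sc_edges_adj.
  have := mul_boundary u (enum_rankK_in eE eE).
  by rewrite u0 mxE -/S; case: bd => // /eqP; rewrite eq_sym oner_eq0.
- move=> S0; suff -> : u = 0 by rewrite sub0mx.
  by apply/rowP => k; rewrite [RHS]mxE; apply/eqP/negbNE; rewrite -uS S0 inE.
- move=> S1; suff -> : u = const_mx 1 by [].
  by apply/rowP => k; rewrite [RHS]mxE (F2_cases (u 0 k)) -uS S1 enum_valP.
Qed.

(** The graph is connected, so the edge boundaries together with a single vertex span all vertices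
    of [cover F]. *)
Lemma rank_M1 : (#|cover F| <= \rank M1 + 1)%N.
Proof.
have [->|[x0 x0V]] := set_0Vmem (cover F); first by rewrite cards0.
pose d x : 'rV['F_2]_#|T| := delta_mx 0 (enum_rank x).
pose D : 'M['F_2]_(#|cover F|, #|T|) := \matrix_i d (enum_val i).
have rD : \rank D = #|cover F|.
  apply/eqP/row_freeP; exists D^T; apply/matrixP => i j.
  rewrite !mxE (bigD1 (enum_rank (enum_val i))) //= !mxE !eqxx mul1r big1 ?addr0.
    by rewrite (inj_eq enum_rank_inj) (inj_eq enum_val_inj).
  by move=> k nk; rewrite !mxE eqxx /= (negPf nk) mul0r.
rewrite -rD; have -> : (\rank M1 + 1 = \rank M1 + \rank (d x0))%N by rewrite mxrank_delta.
apply: leq_trans (mxrank_adds_leqif M1 (d x0)).1; apply: mxrankS.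
apply/row_subP => i; rewrite rowK.
have := sphere_conn sF (X := [set y | (d y <= M1 + d x0)%MS]) _ x0V (enum_valP i).
rewrite !inE; apply; last exact: addsmxSr.
move=> x y adj; rewrite !inE => dx.
have nxy : x != y by case/andP: adj.
have eE : [set x; y] \in E by rewrite sc_edges_adj.
have -> : d y = row (enum_rank_in eE [set x; y]) M1 - d x.
  apply/rowP => k; rewrite !mxE eqxx /= enum_rankK_in // !inE.
  rewrite -(inj_eq enum_rank_inj (enum_val k) x) -(inj_eq enum_rank_inj (enum_val k) y) enum_valK.
  have [->|_] := eqVneq k (enum_rank x); last by rewrite subr0.
  by rewrite (inj_eq enum_rank_inj) (negPf nxy) subrr.
by rewrite addmx_sub // ?eqmx_opp // (submx_trans (row_sub _ _)) // addsmxSl.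
Qed.

(** The first homology vanishes by counting: the image of [M2] has dimension at least |F| - 1, the
    kernel of [M1] at most |E| - |V| + 1, and these bounds agree by the Euler relation and 2|E| =
    3|F|. *)
Lemma three_cycle_bounds C : #|C| = 3%N ->
  (forall x y, x \in C -> y \in C -> x != y -> sc_adj F x y) ->
  exists2 S : {set {set T}}, S \subset F &
    forall x y, x != y -> bd F S x y = (x \in C) && (y \in C).
Proof.
move=> C3 CF; pose z : 'rV['F_2]_#|E| := \row_(j < #|E|) ((enum_val j : {set T}) \subset C)%:R.
have zM : z *m M1 = 0.
  apply: pairs_boundary => // e eC /eqP/cards2P[x [y [nxy de]]].
  by rewrite de /E sc_edges_adj // CF // (subsetP eC) // de !inE eqxx ?orbT.
have MM : M2 *m M1 = 0.
  apply/row_matrixP => i; rewrite row_mul row0.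
  have -> : row i M2 = \row_(j < #|E|) ((enum_val j : {set T}) \subset (enum_val i : {set T}))%:R.
    by apply/rowP => j; rewrite !mxE.
  apply: pairs_boundary; first by rewrite (sphere_card3 sF) // enum_valP.
  move=> e ei e2; rewrite inE e2 eqxx; apply/existsP; exists (enum_val i).
  by rewrite enum_valP.
have sM : (M2 <= kermx M1)%MS by apply/sub_kermxP.
have : (kermx M1 <= M2)%MS.
  have := mxrank_leqif_sup sM => -[le <-]; rewrite eqn_leq le /= mxrank_ker.
  have arith (f e v r1 r2 : nat) : (f <= r2 + 1 -> v <= r1 + 1 -> 2 * e = 3 * f ->
    f + 4 = 2 * v -> e - r1 <= r2)%N by lia.
  exact: arith rank_M2 rank_M1 card_edges (sphere_euler sF).
have /sub_kermxP/submx_trans h := zM => /h/submxP[u zu].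
exists [set enum_val i | i in [set i | u 0 i != 0]].
  by apply/subsetP => f /imsetP[k _ ->]; apply: enum_valP.
move=> x y nxy; have [adj|nadj] := boolP (sc_adj F x y); last first.
  rewrite /bd edge_faces0 // set0I cards0; apply/esym/negP => /andP[xC yC].
  by rewrite CF in nadj.
have eE : [set x; y] \in E by rewrite sc_edges_adj.
have := mul_boundary u (enum_rankK_in eE eE).
rewrite -zu mxE enum_rankK_in // subUset !sub1set.
by case: (_ && _); case: bd => // /eqP; rewrite ?oner_eq0 // eq_sym oner_eq0.
Qed.

End Homology.

(** * Contractible edges *)

Section Contractible.
Variable T : finType.
Implicit Types (S : {set {set T}}) (f g : {set T}) (x y z : T).

(** The last field is the link condition; a further common neighbour of u and v would span a
    non-facial 3-cycle with them, along which the contraction pinches the surface. *)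
Record contractible (F : {set {set T}}) (u v a b : T) : Prop := Contractible {
  contr_uv : u != v; contr_ab : a != b;
  contr_au : a != u; contr_av : a != v; contr_bu : b != u; contr_bv : b != v;
  contr_a : [set u; v; a] \in F; contr_b : [set u; v; b] \in F;
  contr_only : forall x, sc_adj F u x -> sc_adj F v x -> x = a \/ x = b }.

Variable F : {set {set T}}.
Hypothesis sF : sphere F.

Lemma edge_apexes x y : sc_adj F x y -> exists a b,
  [/\ a != b, [/\ a != x, a != y, b != x & b != y]
    & edge_faces F x y = [set [set x; y; a]; [set x; y; b]]].
Proof.
move=> adj; have nxy : x != y by case/andP: adj.
have /eqP/cards2P[f [g [nfg de]]] := sphere_edge2 sF adj.
have : f \in edge_faces F x y by rewrite de !inE eqxx.
have : g \in edge_faces F x y by rewrite de !inE eqxx orbT.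
rewrite !inE => /and3P[gF xg yg] /and3P[fF xf yf].
have [a [nax nay df]] := face_third sF fF xf yf nxy.
have [b [nbx nby dg]] := face_third sF gF xg yg nxy.
exists a, b; split=> //; last by rewrite de df dg.
by apply: contraNneq nfg => eab; rewrite df dg eab.
Qed.

Lemma set3_mem x y z : (x \in [set x; y; z]) * (y \in [set x; y; z]) * (z \in [set x; y; z]).
Proof. by rewrite !inE !eqxx !orbT. Qed.

Lemma face_adj f x y : f \in F -> x \in f -> y \in f -> x != y -> sc_adj F x y.
Proof. by move=> fF xf yf nxy; apply/sc_adjP; split=> //; exists f. Qed.

Lemma contractible_card4 u v a b : contractible F u v a b ->
  [set u; v; a; b] \subset cover F /\ #|[set u; v; a; b]| = 4.
Proof.
case=> nuv nab nau nav nbu nbv aF bF _; split.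
  have inF := mem_cover aF; have inF' := mem_cover bF.
  by rewrite !subUset !sub1set (inF u) ?(inF v) ?(inF a) ?(inF' b) // !set3_mem.
rewrite -!setUA !cardsU1 !inE !negb_or cards1.
by rewrite nuv nab [u == a]eq_sym nau [u == b]eq_sym nbu [v == a]eq_sym nav [v == b]eq_sym nbv.
Qed.

Lemma contractible_of_no_cycle u v : sc_adj F u v ->
  (forall x, sc_adj F u x -> sc_adj F v x -> [set u; v; x] \in F) ->
  exists a b, contractible F u v a b.
Proof.
move=> adj nC; have nuv : u != v by case/andP: adj.
have [a [b [nab [nau nav nbu nbv] de]]] := edge_apexes adj.
have inF c : [set u; v; c] \in edge_faces F u v -> [set u; v; c] \in F.
  by rewrite inE => /andP[].
exists a, b; split=> //; try by apply: inF; rewrite de !inE eqxx ?orbT.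
move=> x ux vx.
have nxu : x != u by rewrite eq_sym; case/andP: ux.
have nxv : x != v by rewrite eq_sym; case/andP: vx.
have : [set u; v; x] \in edge_faces F u v by rewrite inE nC // !set3_mem.
have xm c : [set u; v; x] = [set u; v; c] -> x = c.
  move=> e; have : x \in [set u; v; c] by rewrite -e set3_mem.
  by rewrite !inE (negPf nxu) (negPf nxv) => /eqP.
by rewrite de !inE => /orP[] /eqP/xm; [left|right].
Qed.

Lemma bd_in S x y f : x != y -> bd F S x y = false -> f \in edge_faces F x y -> f \in S ->
  edge_faces F x y \subset S.
Proof. by move=> nxy b0 fe fS; apply/subsetP => g ge; apply: (bd0P sF nxy b0 fe ge fS). Qed.

Lemma star_in S x f : (forall y, y != x -> bd F S x y = false) -> f \in F -> x \in f -> f \in S ->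
  forall y, y != x -> edge_faces F x y \subset S.
Proof.
move=> b0 fF xf fS y nyx; apply/subsetP => g; rewrite inE => /and3P[gF xg yg].
apply: (sphere_star sF (x := x)) fF gF xf xg fS => f1 g1 z f1F g1F xf1 xg1 nzx zf1 zg1.
by apply: (bd0P sF (x := x) (y := z)); rewrite ?b0 // 1?eq_sym // inE ?f1F ?g1F ?xf1 ?xg1.
Qed.

Lemma adj_faces_neq0 x y : sc_adj F x y -> exists f, f \in edge_faces F x y.
Proof. by move=> /sc_adjP[_ [f [fF xf yf]]]; exists f; rewrite inE fF xf. Qed.

(** S is a chosen side of the non-facial 3-cycle; the other side [F :\: S] has the same boundary. *)
Definition cycle3 S x y z := [/\ sc_adj F x y, sc_adj F x z, sc_adj F y z &
  [set x; y; z] \notin F] /\ S \subset F /\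
  forall s t, s != t -> bd F S s t = (s \in [set x; y; z]) && (t \in [set x; y; z]).

Lemma card3_set x y z : x != y -> x != z -> y != z -> #|[set x; y; z]| = 3.
Proof. by move=> nxy nxz nyz; rewrite -setUA cardsU1 cards2 !inE negb_or nxy nxz nyz. Qed.

Lemma cycle3_exists x y z : sc_adj F x y -> sc_adj F x z -> sc_adj F y z ->
  [set x; y; z] \notin F -> exists S, cycle3 S x y z.
Proof.
move=> xy xz yz nF; have [nxy nxz nyz] : [/\ x != y, x != z & y != z].
  by split; [case/andP: xy|case/andP: xz|case/andP: yz].
have [|S SF bS] := three_cycle_bounds sF (card3_set nxy nxz nyz); last by exists S.
move=> s t; rewrite !inE => /orP[/orP[]|] /eqP -> /orP[/orP[]|] /eqP -> //;
  by rewrite ?eqxx // sc_adjC.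
Qed.

(* Boundaries are even at each vertex. *)
Lemma bd_sub_cycle3 P x y z : x != y -> x != z -> y != z ->
  (forall s t, s != t -> bd F P s t -> (s \in [set x; y; z]) && (t \in [set x; y; z])) ->
  (forall s t, s != t -> bd F P s t = false) \/
  (forall s t, s != t -> bd F P s t = (s \in [set x; y; z]) && (t \in [set x; y; z])).
Proof.
move=> nxy nxz nyz sub.
have two p q r : p != q -> p != r -> q != r -> [set p; q; r] = [set x; y; z] ->
    bd F P p q = bd F P p r.
  move=> npq npr nqr e; have := bd_even sF P p.
  have -> : [set t | t != p & bd F P p t] =
     (if bd F P p q then [set q] else set0) :|: (if bd F P p r then [set r] else set0).
    apply/setP => t; rewrite !inE; apply/andP/orP.
      move=> [ntp bt]; have := sub p t; rewrite eq_sym ntp => /(_ isT bt) /andP[_].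
      rewrite -e !inE (negPf ntp) /= => /orP[] /eqP et; [left|right];
      by rewrite -et bt inE.
    case; case bq: (bd _ _ _ _); rewrite !inE // => /eqP ->; split=> //; by rewrite eq_sym.
  case: (bd F P p q); case: (bd F P p r) => //; rewrite ?setU0 ?set0U ?cards1 //.
have exy := two x y z nxy nxz nyz (erefl _).
have eyx : bd F P y x = bd F P y z.
  by apply: two; rewrite // 1?eq_sym // [in LHS](setUC [set y]).
have [b1|b0] := boolP (bd F P x y); [right|left] => s t nst.
- apply/idP/idP; first exact: sub.
  move: nst; rewrite !inE => nst.
  by case/andP => /orP[/orP[]|] /eqP es /orP[/orP[]|] /eqP et; subst; rewrite ?eqxx // in nst *;
   rewrite ?b1 // -1?exy // -1?eyx // 1?bdC ?b1 // -?exy -?eyx 1?bdC ?b1 // -?exy // -?eyx // bdC.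
- apply/negP => bst; have := sub s t nst bst; move: nst bst b0; rewrite !inE => nst bst b0.
  case/andP => /orP[/orP[]|] /eqP es /orP[/orP[]|] /eqP et; subst; rewrite ?eqxx // in nst.
  all: move: bst; rewrite -?exy -?eyx ?(negPf b0) // bdC -?exy -?eyx ?(negPf b0) //.
  all: by rewrite bdC (negPf b0).
Qed.

End Contractible.

(** * Shrinking a non-facial 3-cycle *)

Section Minimal.
Variable T : finType.
Implicit Types (S : {set {set T}}) (f g : {set T}) (x y z : T).
Variable F : {set {set T}}.
Hypothesis sF : sphere F.

Lemma cycle3_nonempty S v a c : cycle3 F S v a c -> exists2 f, f \in S & (v \in f) && (a \in f).
Proof.
move=> [[va _ _ _] [SF bS]]; have nva : v != a by case/andP: va.
have := bS v a nva; rewrite !set3_mem /bd.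
have [->|[f]] := set_0Vmem (edge_faces F v a :&: S); first by rewrite cards0.
by rewrite !inE => /andP[/and3P[_ vf af] fS] _; exists f; rewrite ?vf.
Qed.

(** Inside the complement O of S the cycle v b d could only run along v d, and this is excluded; so
    O lies on one side of v b d and the other side lies in S. The inclusion is strict since v b is
    in the boundary of the new side but not in that of S. *)
Lemma cycle3_smaller S v a c b d : cycle3 F S v a c -> b \notin [set v; a; c] ->
  (forall y, y != b -> edge_faces F b y \subset S) ->
  sc_adj F v b -> sc_adj F v d -> sc_adj F b d -> [set v; b; d] \notin F ->
  exists S', cycle3 F S' v b d /\ #|S'| < #|S|.
Proof.
move=> cS bC bS vb vd bd' nF; have [[va vc ac nF'] [SF bdS]] := cS.
have [nva nvc nac] : [/\ v != a, v != c & a != c].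
  by split; [case/andP: va|case/andP: vc|case/andP: ac].
have [nvb nvd nbd] : [/\ v != b, v != d & b != d].
  by split; [case/andP: vb|case/andP: vd|case/andP: bd'].
have [f0 f0S _] := cycle3_nonempty cS.
have f0F : f0 \in F := subsetP SF f0 f0S.
have proper S' : cycle3 F S' v b d -> S' \subset S -> #|S'| < #|S|.
  move=> [_ [_ bS']] s; apply: proper_card; rewrite properE s /=.
  apply/negP => s2; have e : S' = S by apply/eqP; rewrite eqEsubset s.
  have := bS' v b nvb; rewrite !set3_mem e bdS // !set3_mem /=.
  by rewrite (negPf bC).
have [S' cS'] := cycle3_exists sF vb vd bd' nF.
have [_ [S'F bdS']] := cS'.
pose O := F :\: S; pose P := O :&: S'.
(* The boundary of P is contained in the 3-cycle v a c, so P is empty or equal to O. *)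
have PF : P \subset F by apply/subsetP => f; rewrite !inE => /andP[/andP[]].
have sub s t : s != t -> bd F P s t -> (s \in [set v; a; c]) && (t \in [set v; a; c]).
  move=> nst bP; rewrite -bdS //; apply/negbNE/negP => /negbTE bS0.
  have adj : sc_adj F s t.
    by apply/negbNE/negP => n; move: bP; rewrite /bd edge_faces0 // set0I cards0.
  have [f fe] := adj_faces_neq0 adj.
  have [fS|fS] := boolP (f \in S).
    have s1 := bd_in sF nst bS0 fe fS.
    move: bP; rewrite /bd (_ : _ :&: P = set0) ?cards0 //.
    apply/setP => g; rewrite [g \in set0]inE; apply/negP => /setIP[ge].
    by rewrite !inE (subsetP s1 g ge).
  have dis g : g \in edge_faces F s t -> g \notin S.
    by move=> ge; apply: contra fS; apply: (bd0P sF nst bS0 ge fe).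
  have bP' : bd F S' s t.
    move: bP; rewrite /bd (_ : _ :&: P = edge_faces F s t :&: S') //.
    apply/setP => g; rewrite in_setI [RHS]in_setI.
    case ge: (g \in edge_faces F s t) => //=; rewrite in_setI in_setD (dis g ge).
    by move: ge; rewrite inE => /and3P[-> _ _].
  move: bP'; rewrite bdS' // => /andP[sC tC].
  have nb x y : x != y -> edge_faces F x y = edge_faces F s t -> x != b.
    move=> nxy e; apply: contraNneq fS => xb; subst x.
    by apply: (subsetP (bS y _)); rewrite 1?eq_sym // e.
  have sb : s != b by apply: (nb s t).
  have tb : t != b by apply: (nb t s); rewrite 1?eq_sym // edge_facesC.
  (* As b is excluded, s t is the edge v d. If d were off the cycle v a c, its whole star would lie
     in S together with a face on b d, against the choice of f. *)
  have dC : d \in [set v; a; c].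
    apply/negbNE/negP => dC.
    have [h hbd] := adj_faces_neq0 bd'.
    have /(subsetP (bS d _)) hS : h \in edge_faces F b d by [].
    have hS' : h \in S by apply: hS; rewrite eq_sym.
    move: hbd; rewrite inE => /and3P[hF _ dh].
    have ds : edge_faces F d v \subset S.
      apply: (star_in sF (f := h)) => // y nyd.
      by rewrite bdS 1?eq_sym // (negPf dC).
    move: fS; rewrite (subsetP ds) //.
    move: sC tC nst fe; rewrite !inE (negPf sb) (negPf tb) !orbF => /orP[] /eqP -> /orP[] /eqP ->;
      rewrite ?eqxx // => _ /and3P[-> -> ->] //.
  move: bS0; rewrite bdS //; move: sC tC; rewrite !in_setU !in_set1 (negPf sb) (negPf tb) !orbF.
  move: dC; rewrite !in_setU !in_set1 => dC.
  by case/orP => /eqP -> /orP[] /eqP ->; rewrite ?eqxx ?dC.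
have [b0|b1] := bd_sub_cycle3 sF nva nvc nac sub.
- have [P0|PT] := closed_all sF PF b0; last first.
    by have := f0F; rewrite -PT !inE f0S.
  exists S'; split=> //; apply: proper => //; apply/subsetP => f fS'.
  apply/negbNE/negP => fS; have : f \in P by rewrite !inE fS fS' (subsetP S'F).
  by rewrite P0 inE.
(* Here P has the same boundary as O, so [O :\: P] is closed, hence empty, and it is the other side
   [F :\: S'] that lies in S. *)
- have sPO : P \subset O by apply: subsetIl.
  have OF : O :\: P \subset F.
    by apply/subsetP => f; rewrite !inE => /andP[_ /andP[]].
  have b0 s t : s != t -> bd F (O :\: P) s t = false.
    by move=> nst; rewrite bd_setD // b1 // (bd_setC sF) // bdS // addbb.
  have [P0|PT] := closed_all sF OF b0; last first.
    by have := f0F; rewrite -PT !inE f0S andbF.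
  have cS'' : cycle3 F (F :\: S') v b d.
    split; first by []. split; first exact: subsetDl.
    by move=> s t nst; rewrite (bd_setC sF) // bdS'.
  exists (F :\: S'); split=> //; apply: proper => //; apply/subsetP => f; rewrite inE => /andP[fS' fF].
  apply/negbNE/negP => fS; have : f \in O :\: P by rewrite !inE fF fS (negPf fS').
  by rewrite P0 inE.
Qed.

Lemma contractible_or_cycle3 u v : sc_adj F u v ->
  (exists a b, contractible F u v a b) \/
  (exists x, [/\ sc_adj F u x, sc_adj F v x & [set u; v; x] \notin F]).
Proof.
move=> adj; have [/forallP H|] := boolP [forall x, sc_adj F u x ==> sc_adj F v x ==> ([set u; v; x] \in F)].
  left; apply: (contractible_of_no_cycle sF adj) => x ux vx.
  by have := H x; rewrite ux vx.
rewrite negb_forall => /existsP[x]; rewrite !negb_imply => /and3P[ux vx nF].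
by right; exists x.
Qed.

(** The face of S on v a has its third vertex b off the cycle, because v a c is not a face; the star
    of b is then inside S. Either v b is contractible or it lies on a non-facial 3-cycle with a
    smaller side. *)
Lemma contractible_of_cycle3 n S v a c : #|S| <= n -> cycle3 F S v a c ->
  exists u v a b, contractible F u v a b.
Proof.
elim: n S v a c => [|n IH] S v a c leS cS.
  by have [f fS _] := cycle3_nonempty cS; move: leS; rewrite leqn0 cards_eq0 => /eqP S0; rewrite S0 inE in fS.
have [f fS /andP[vf af]] := cycle3_nonempty cS.
have [[va vc ac nF] [SF bdS]] := cS.
have fF := subsetP SF f fS.
have nva : v != a by case/andP: va.
have [b [nbv nba df]] := face_third sF fF vf af nva.
have nbc : b != c by apply: contraNneq nF => <-; rewrite -df.
have bC : b \notin [set v; a; c] by rewrite !inE (negPf nbv) (negPf nba).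
have bf : b \in f by rewrite df !inE eqxx orbT.
have bS y : y != b -> edge_faces F b y \subset S.
  by apply: (star_in sF (f := f)) => // z nzb; rewrite bdS 1?eq_sym // (negPf bC).
have vb : sc_adj F v b by apply: (face_adj fF); rewrite // eq_sym.
have [[a' [b' C]]|[d [vd bd' nF']]] := contractible_or_cycle3 vb; first by exists v, b, a', b'.
have [S' [cS' lt]] := cycle3_smaller cS bC bS vb vd bd' nF'.
by apply: IH cS'; rewrite -ltnS; apply: leq_trans lt leS.
Qed.

Lemma contractible_exists : exists u v a b, contractible F u v a b.
Proof.
have [x xV] : exists x, x \in cover F.
  by apply/set0Pn; rewrite -card_gt0; have := sphere_euler sF; lia.
have /bigcupP[f0 f0F xf0] := xV.
have [y] : exists y, y \in f0 :\ x.
  by apply/set0Pn; rewrite -card_gt0; have := cardsD1 x f0; rewrite xf0 (sphere_card3 sF) // add1n => -[<-].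
rewrite !inE => /andP[nyx yf0].
have xy : sc_adj F x y by apply: (face_adj f0F); rewrite // eq_sym.
have [[a [b C]]|[d [xd yd nF]]] := contractible_or_cycle3 xy; first by exists x, y, a, b.
by have [S cS] := cycle3_exists sF xy xd yd nF; apply: contractible_of_cycle3 cS.
Qed.

Lemma sphere_card_ge4 : 4 <= #|cover F|.
Proof.
have [u [v [a [b C]]]] := contractible_exists.
have [sub c4] := contractible_card4 C; rewrite -c4; exact: subset_leq_card sub.
Qed.

End Minimal.

(** * Edge contraction *)

Section Contraction.
Variable T : finType.
Implicit Types (S : {set {set T}}) (f g : {set T}) (x y z : T).
Variables (F : {set {set T}}) (u v a b : T).
Hypothesis sF : sphere F.
Hypothesis C : contractible F u v a b.
Hypothesis big : 4 < #|cover F|.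

Definition merge x := if x == u then v else x.
Definition degenerate f := (u \in f) && (v \in f).
(** The vertex type T is kept and u merely drops out of [cover], so that contractions can be
    iterated without changing the type. *)
Definition contract := [set merge @: (f : {set T}) | f in F & ~~ degenerate f].

Let nuv := contr_uv C.
Let nab := contr_ab C.
Let nau := contr_au C.
Let nav := contr_av C.
Let nbu := contr_bu C.
Let nbv := contr_bv C.
Let aF := contr_a C.
Let bF := contr_b C.

Lemma contr_adj : sc_adj F u v.
Proof. by apply: (face_adj aF); rewrite ?set3_mem. Qed.

Lemma mergeE x : x != u -> merge x = x.
Proof. by rewrite /merge => /negPf ->. Qed.

Lemma merge_u : merge u = v. Proof. by rewrite /merge eqxx. Qed.

Lemma merge_nu x : merge x != u.
Proof. by rewrite /merge; have [_|//] := eqVneq x u; rewrite eq_sym. Qed.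

Lemma mem_merge f x : x != u -> (x \in merge @: f) = (x \in f) || ((x == v) && (u \in f)).
Proof.
move=> nxu; apply/imsetP/idP.
  case=> y yf ->; rewrite /merge; case: eqP => [<-|_]; last by rewrite yf.
  by rewrite yf eqxx orbT.
case/orP => [xf|/andP[/eqP -> uf]]; first by exists x; rewrite ?mergeE.
by exists u; rewrite ?merge_u.
Qed.

Lemma u_merge f : u \notin merge @: f.
Proof. by apply/imsetP => -[y _ /eqP]; rewrite eq_sym (negPf (merge_nu y)). Qed.

Lemma bd_set1 f x y : f \in F -> bd F [set f] x y = (x \in f) && (y \in f).
Proof.
move=> fF; rewrite /bd; have [xy|xy] := boolP ((x \in f) && (y \in f)).
  by rewrite (setIidPr _) ?cards1 // sub1set inE fF.
rewrite (_ : _ :&: _ = set0) ?cards0 //; apply/setP => g; rewrite !inE.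
by case: eqP => [->|_]; rewrite ?andbF // (negPf xy) andbF.
Qed.

Lemma bd_setU1 f S x y : f \notin S -> bd F (f |: S) x y = bd F [set f] x y (+) bd F S x y.
Proof.
move=> fS; have := bd_setD F x y (subsetUl [set f] S).
rewrite (_ : _ :\: [set f] = S); first by move=> ->; case: (bd F _ x y) (bd F _ x y) => [] [].
by rewrite setDUl setDv set0U; apply/setDidPl; rewrite disjoint_sym disjoints1.
Qed.

Lemma faces_uv : edge_faces F u v = [set [set u; v; a]; [set u; v; b]].
Proof.
apply/esym/eqP; rewrite eqEcard (sphere_edge2 sF contr_adj) cards2.
rewrite subUset !sub1set !inE aF bF !eqxx !orbT /=.
rewrite (_ : [set u; v; a] != [set u; v; b]) //.
apply: contraNneq nab => e; have : a \in [set u; v; b] by rewrite -e set3_mem.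
by rewrite !inE (negPf nau) (negPf nav).
Qed.

Lemma degenerateP f : f \in F -> degenerate f -> f = [set u; v; a] \/ f = [set u; v; b].
Proof.
move=> fF /andP[uf vf]; have : f \in edge_faces F u v by rewrite inE fF uf.
by rewrite faces_uv !inE => /orP[] /eqP; [left|right].
Qed.

Lemma common_neighbour x : sc_adj F u x -> sc_adj F v x -> [set u; v; x] \in F.
Proof. by move=> ux vx; case: (contr_only C ux vx) => ->. Qed.

Lemma degenerate_third f x : f \in F -> degenerate f -> x \in f -> x != u -> x != v ->
  f = [set u; v; x].
Proof.
move=> fF df xf nxu nxv; have [e|e] := degenerateP fF df; move: xf;
by rewrite e !inE (negPf nxu) (negPf nxv) => /eqP ->.
Qed.

Lemma nondegenerate_card f : f \in F -> ~~ degenerate f -> #|merge @: f| = 3.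
Proof.
move=> fF nd; rewrite -(sphere_card3 sF fF); apply: card_in_imset => x y xf yf.
rewrite /merge; have [ex|_] := eqVneq x u; have [ey|_] := eqVneq y u => // e.
- by rewrite ex ey.
- by move: nd; rewrite /degenerate -ex xf e yf.
- by move: nd; rewrite /degenerate -ey yf -e xf.
Qed.

(* Otherwise the four faces u v a, u v b, u x y, v x y would form a closed tetrahedron. *)
Lemma merge_inj_faces : {in [set f in F | ~~ degenerate f] &, injective (fun f : {set T} => merge @: f)}.
Proof.
have key f g : f \in F -> g \in F -> u \in f -> v \in g -> ~~ degenerate f -> ~~ degenerate g ->
    merge @: f = merge @: g -> False.
  move=> fF gF uf vg ndf ndg e.
  have vf : v \notin f by move: ndf; rewrite /degenerate uf.
  have ug : u \notin g by move: ndg; rewrite /degenerate vg andbT.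
  have fg x : x != u -> x != v -> (x \in f) = (x \in g).
    move=> nxu nxv; have := mem_merge f nxu; have := mem_merge g nxu.
    by rewrite e (negPf nxv) !orbF => -> ->.
  have two x : x \in f -> x != u -> x = a \/ x = b.
    move=> xf nxu; have nxv : x != v by apply: contraNneq vf => <-.
    apply: (contr_only C); first by apply: (face_adj fF); rewrite // eq_sym.
    by apply: (face_adj gF); rewrite ?vg -?fg // eq_sym.
  have fE : f = [set u; a; b].
    apply/eqP; rewrite eqEcard (sphere_card3 sF fF).
    rewrite (card3_set) 1?eq_sym // 1?eq_sym // andbT.
    apply/subsetP => x xf; rewrite !inE; case: (eqVneq x u) => //= nxu.
    by case: (two x xf nxu) => ->; rewrite eqxx ?orbT.
  have gE : g = [set v; a; b].
    apply/eqP; rewrite eqEcard (sphere_card3 sF gF).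
    rewrite (card3_set) 1?eq_sym // 1?eq_sym // andbT.
    apply/subsetP => x xg; rewrite !inE; case: (eqVneq x v) => //= nxv.
    have nxu : x != u by apply: contraNneq ug => <-.
    by case: (two x _ nxu); rewrite ?fg // => ->; rewrite eqxx ?orbT.
  have ne := (negPf nuv, negPf nab, negPf nau, negPf nav, negPf nbu, negPf nbv).
  have {}ne := (ne, eq_sym v u, eq_sym b a, eq_sym u a, eq_sym v a, eq_sym u b, eq_sym v b).
  pose S := [set u; v; a] |: ([set u; v; b] |: (f |: [set g])).
  have SF : S \subset F by rewrite !subUset !sub1set aF bF fF gF.
  have neq (h k : {set T}) x : x \in h -> x \notin k -> h != k.
    by move=> xh xk; apply: contraNneq xk => <-.
  have d1 : f \notin [set g] by rewrite inE (neq _ _ u).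
  have d2 : [set u; v; b] \notin f |: [set g].
    by rewrite in_setU !in_set1 negb_or (neq _ _ v) ?(neq _ _ u) // set3_mem.
  have d3 : [set u; v; a] \notin [set u; v; b] |: (f |: [set g]).
    rewrite !in_setU !in_set1 !negb_or (neq _ f v _ vf) ?(neq _ g u _ ug) ?set3_mem // !andbT.
    by apply: (neq _ _ a); rewrite ?set3_mem // !inE !negb_or nau nav nab.
  have bS x y : x != y -> bd F S x y = false.
    move=> nxy; rewrite (bd_setU1 _ _ d3) (bd_setU1 _ _ d2) (bd_setU1 _ _ d1) !bd_set1 //.
    rewrite fE gE; move: nxy; rewrite !inE.
    have [->|_] := eqVneq x u; last have [->|_] := eqVneq x v;
      last have [->|_] := eqVneq x a; last have [->|_] := eqVneq x b => //;
    rewrite eq_sym => /negPf nyx; rewrite ?eqxx ?nyx ?ne //=;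
    (have [ey|_] := eqVneq y u; first by rewrite ?ey ?eqxx ?ne // in nyx * );
    (have [ey|_] := eqVneq y v; first by rewrite ?ey ?eqxx ?ne // in nyx * );
    (have [ey|_] := eqVneq y a; first by rewrite ?ey ?eqxx ?ne // in nyx * );
    (have [ey|_] := eqVneq y b; first by rewrite ?ey ?eqxx ?ne // in nyx * ); try by rewrite ?nyx.
  have [S0|ST] := closed_all sF SF bS; first by move: (in_set0 f); rewrite -S0 in_setU1 in_setU1 in_setU1 eqxx !orbT.
  (* Four faces force at most four vertices by the Euler relation, against [big]. *)
  have : #|F| <= 4.
    rewrite -ST /S !cardsU1 cards1; by do 3 case: (_ \notin _).
  by move: big (sphere_euler sF); clear; lia.
move=> f g; rewrite !inE => /andP[fF ndf] /andP[gF ndg] e.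
have vin (h : {set T}) : (v \in merge @: h) = (u \in h) || (v \in h).
  by rewrite mem_merge 1?eq_sym // eqxx /= orbC.
have := vin f; rewrite /= e vin.
have [uf|uf] := boolP (u \in f); have [ug|ug] := boolP (u \in g).
- move=> _; apply/setP => x; have [->|nxu] := eqVneq x u; first by rewrite uf ug.
  have [->|nxv] := eqVneq x v.
    by move: ndf ndg; rewrite /degenerate uf ug /= => /negPf -> /negPf ->.
  have := mem_merge f nxu; have := mem_merge g nxu.
  by rewrite e (negPf nxv) !orbF => -> ->.
- by move=> /= vg; case: (key f g).
- by move=> /= vf; case: (key g f).
- move=> _; apply/setP => x; have [->|nxu] := eqVneq x u; first by rewrite (negPf uf) (negPf ug).
  have := mem_merge f nxu; have := mem_merge g nxu.
  by rewrite e (negPf uf) (negPf ug) !andbF !orbF => -> ->.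
Qed.

Lemma contractP f' : reflect (exists f, [/\ f \in F, ~~ degenerate f & f' = merge @: f]) (f' \in contract).
Proof.
apply: (iffP imsetP) => [[f]|[f [fF nd ->]]]; first by rewrite inE => /andP[fF nd] ->; exists f.
by exists f; rewrite // inE fF.
Qed.

Lemma merge_neq x y : merge x != merge y -> x != y.
Proof. by apply: contraNneq => ->. Qed.

(** The two degenerate faces share only u and v. An edge whose ends are not merged therefore has at
    most one of them, and its other face survives. *)
Lemma nondegenerate_face x y : sc_adj F x y -> merge x != merge y ->
  exists f, [/\ f \in F, x \in f, y \in f & ~~ degenerate f].
Proof.
move=> adj nm; have /eqP/cards2P[f [g [nfg de]]] := sphere_edge2 sF adj.
have : f \in edge_faces F x y by rewrite de !inE eqxx.
have : g \in edge_faces F x y by rewrite de !inE eqxx orbT.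
rewrite !inE => /and3P[gF xg yg] /and3P[fF xf yf].
have [df|?] := boolP (degenerate f); last by exists f.
have [dg|?] := boolP (degenerate g); last by exists g.
have same w : w \in f -> w \in g -> w != u -> w != v -> f = g.
  by move=> wf wg nwu nwv; rewrite (degenerate_third fF df wf) // (degenerate_third gF dg wg).
case/eqP: nfg; move: nm; rewrite /merge.
have [exu|nxu] := eqVneq x u; have [eyu|nyu] := eqVneq y u; rewrite ?eqxx // => n.
- by apply: (same y); rewrite // eq_sym.
- by apply: (same x).
- have [exv|nxv] := eqVneq x v; last by apply: (same x).
  by apply: (same y); rewrite // eq_sym -exv.
Qed.

Lemma adj_contract_merge x y : sc_adj F x y -> merge x != merge y ->
  sc_adj contract (merge x) (merge y).
Proof.
move=> adj nm; have [f [fF xf yf nd]] := nondegenerate_face adj nm.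
apply/sc_adjP; split=> //; exists (merge @: f); split; try exact: imset_f.
by apply/contractP; exists f.
Qed.

Lemma adj_contractE x y : sc_adj contract x y ->
  exists x0 y0, [/\ sc_adj F x0 y0, merge x0 = x & merge y0 = y].
Proof.
move=> /sc_adjP[nxy [f' [/contractP[f [fF nd ->]] /imsetP[x0 x0f ex] /imsetP[y0 y0f ey]]]].
exists x0, y0; split=> //; apply: (face_adj fF) => //; apply: merge_neq.
by rewrite -ex -ey.
Qed.

Lemma card_nondegenerate_edge w y : w = u \/ w = v -> y != u -> y != v ->
  #|[set f in F | ~~ degenerate f && ((w \in f) && (y \in f))]| + ([set u; v; y] \in F)
  = #|edge_faces F w y|.
Proof.
move=> wuv nyu nyv; rewrite -[RHS](cardsID [set f : {set T} | degenerate f]) [RHS]addnC.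
congr addn; last first.
  have [uvyF|uvyF] := boolP ([set u; v; y] \in F).
    rewrite (_ : _ :&: _ = [set [set u; v; y]]) ?cards1 //; apply/setP => f; rewrite !inE.
    apply/andP/eqP => [[/and3P[fF _ yf] df]|->]; first exact: degenerate_third.
    by rewrite uvyF /degenerate !set3_mem; case: wuv => ->; rewrite !set3_mem.
  rewrite (_ : _ :&: _ = set0) ?cards0 //; apply/setP => f; rewrite !inE.
  apply/andP => -[/and3P[fF _ yf] df]; move: uvyF.
  by rewrite -(degenerate_third fF df yf) // fF.
by apply: eq_card => f; rewrite !inE; case: (f \in F); rewrite ?andbF.
Qed.

(** If u v y is a face, each of u y and v y loses this face and keeps one. Otherwise, by the link
    condition, only one of u y and v y is an edge, and it keeps both faces. *)
Lemma contract_edge2_v y : sc_adj contract v y -> #|edge_faces contract v y| = 2.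
Proof.
move=> adj; have nvy : v != y by case/andP: adj.
have nyu : y != u.
  by case/sc_adjP: adj => _ [f' [/contractP[f [_ _ ->]] _]]; apply: contraTneq => ->; rewrite u_merge.
have nyv : y != v by rewrite eq_sym.
have nvu : v != u by rewrite eq_sym.
pose Z w := [set f in F | ~~ degenerate f && ((w \in f) && (y \in f))].
have -> : edge_faces contract v y = (fun f : {set T} => merge @: f) @: (Z u :|: Z v).
  apply/setP => f'; rewrite inE; apply/andP/imsetP.
    case=> /contractP[f [fF nd ->]]; rewrite !mem_merge // eqxx (negPf nyv) /= orbF => H.
    by exists f => //; rewrite !inE fF nd /= -andb_orl orbC.
  case=> f; rewrite !inE => fZ ->; rewrite !mem_merge // eqxx (negPf nyv) /= orbF.
  have : (f \in F) && ~~ degenerate f && ((v \in f) || (u \in f)) && (y \in f).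
    by case/orP: fZ => /and3P[-> -> /andP[-> ->]]; rewrite ?orbT.
  by case/andP=> /andP[/andP[fF nd] ->] ->; split=> //; apply/contractP; exists f.
rewrite card_in_imset; last first.
  move=> f g fZ gZ; apply: merge_inj_faces; first by case/setUP: fZ; rewrite !inE => /and3P[-> ->].
  by case/setUP: gZ; rewrite !inE => /and3P[-> ->].
have := cardsUI (Z u) (Z v); rewrite (_ : Z u :&: Z v = set0); last first.
  apply/setP => f; rewrite !inE; apply/andP => -[/and3P[_ nd /andP[uf _]] /and3P[_ _ /andP[vf _]]].
  by rewrite /degenerate uf vf in nd.
have := card_nondegenerate_edge (or_introl (erefl u)) nyu nyv.
have := card_nondegenerate_edge (or_intror (erefl v)) nyu nyv.
rewrite cards0 addn0 -!/(Z _) => ev eu ->.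
have [uvyF|uvyF] := boolP ([set u; v; y] \in F).
  move: ev eu; rewrite uvyF !(sphere_edge2 sF); first by rewrite !addn1 => -[->] [->].
    by apply: (face_adj uvyF); rewrite ?set3_mem // eq_sym.
  by apply: (face_adj uvyF); rewrite ?set3_mem // eq_sym.
rewrite (negPf uvyF) !addn0 in ev eu; rewrite ev eu.
have nboth : ~~ (sc_adj F u y && sc_adj F v y).
  by apply: contra uvyF => /andP[uy vy]; apply: common_neighbour.
have [x0 [y0 [adj0 ex ey]]] := adj_contractE adj.
have ey0 : y0 = y.
  by move: ey; rewrite /merge; have [_ e|//] := eqVneq y0 u; rewrite e eqxx in nvy.
have : sc_adj F u y || sc_adj F v y.
  move: ex adj0; rewrite ey0 /merge; have [->|_ ->] := eqVneq x0 u; first by move=> _ ->.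
  by move=> ->; rewrite orbT.
have nuy : u != y by rewrite eq_sym.
move: nboth; case uy: (sc_adj F u y); case vy: (sc_adj F v y) => //= _ _.
  by rewrite (sphere_edge2 sF uy) edge_faces0 ?vy // cards0.
by rewrite (sphere_edge2 sF vy) edge_faces0 ?uy // cards0.
Qed.

Lemma contract_edge2 x y : sc_adj contract x y -> #|edge_faces contract x y| = 2.
Proof.
have [->|nxv] := eqVneq x v; first exact: contract_edge2_v.
have [->|nyv] := eqVneq y v.
  by rewrite sc_adjC edge_facesC; apply: contract_edge2_v.
move=> adj; have [x0 [y0 [adj0 ex ey]]] := adj_contractE adj.
have back z0 z : z != v -> merge z0 = z -> z0 = z /\ z != u.
  move=> nzv; rewrite /merge; have [_ e|n e] := eqVneq z0 u; first by rewrite e eqxx in nzv.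
  by rewrite -e.
have [e1 nxu] := back _ _ nxv ex; have [e2 nyu] := back _ _ nyv ey.
move: adj0; rewrite e1 e2 => adj0; rewrite -(sphere_edge2 sF adj0).
have nxy : x != y by case/andP: adj.
have nd f : f \in F -> x \in f -> y \in f -> ~~ degenerate f.
  move=> fF xf yf; apply/negP => df; move: yf; rewrite (degenerate_third fF df xf) // !inE.
  by rewrite (negPf nyu) (negPf nyv) eq_sym (negPf nxy).
have -> : edge_faces contract x y = (fun f : {set T} => merge @: f) @: edge_faces F x y.
  apply/setP => f'; rewrite inE; apply/andP/imsetP.
    case=> /contractP[f [fF ndf ->]]; rewrite !mem_merge // (negPf nxv) (negPf nyv) /= !orbF => H.
    by exists f; rewrite // inE fF.
  case=> f; rewrite inE => /and3P[fF xf yf] ->.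
  rewrite !mem_merge // (negPf nxv) (negPf nyv) /= !orbF xf yf; split=> //.
  by apply/contractP; exists f; split=> //; apply: nd.
apply: card_in_imset => f g; rewrite !inE => /and3P[fF xf yf] /and3P[gF xg yg].
by apply: merge_inj_faces; rewrite !inE ?fF ?gF /= nd.
Qed.

Lemma cover_contract : cover contract = cover F :\ u.
Proof.
apply/setP => x; rewrite !inE; apply/idP/andP.
  move=> /bigcupP[f' /contractP[f [fF nd ->]] /imsetP[x0 x0f ->]].
  rewrite merge_nu; split=> //; rewrite /merge; have [_|_] := eqVneq x0 u; last exact: mem_cover fF x0f.
  by apply: (mem_cover aF); rewrite set3_mem.
case=> nxu xF.
have [y [xy nm]] : exists y, sc_adj F x y /\ merge x != merge y.
  have [->|nxv] := eqVneq x v.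
    by exists a; rewrite (face_adj aF) ?set3_mem 1?eq_sym // !mergeE // eq_sym.
  have /bigcupP[f fF xf] := xF.
  have [y yf] : exists y, y \in f :\ x.
    by apply/set0Pn; rewrite -card_gt0; have := cardsD1 x f; rewrite xf (sphere_card3 sF) // add1n => -[<-].
  move: yf; rewrite !inE => /andP[nyx yf]; exists y; split.
    by apply: (face_adj fF); rewrite // eq_sym.
  by rewrite mergeE // /merge; have [//|_] := eqVneq y u; rewrite eq_sym.
have := adj_contract_merge xy nm; rewrite mergeE //.
by case/sc_adjP => _ [f' [f'F xf' _]]; apply: mem_cover f'F xf'.
Qed.

Lemma card_cover_contract : #|cover F| = #|cover contract|.+1.
Proof. by rewrite cover_contract (cardsD1 u (cover F)) (mem_cover aF) ?set3_mem. Qed.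

Lemma card_contract : #|F| = #|contract| + 2.
Proof.
rewrite card_in_imset; last exact: merge_inj_faces.
rewrite -(sphere_edge2 sF contr_adj) -(cardsID [set f : {set T} | degenerate f] F) addnC; congr addn.
  by apply: eq_card => f; rewrite !inE andbC.
by apply: eq_card => f; rewrite !inE.
Qed.

(** S' is pulled back to a set S of faces of F, closed around the vertices over x, and connectedness
    of the stars in F is applied. For x = v the star is glued from those of u and v. *)
Lemma contract_star x S' :
  (forall f g y, f \in contract -> g \in contract -> x \in f -> x \in g -> y != x ->
     y \in f -> y \in g -> f \in S' -> g \in S') ->
  forall f g, f \in contract -> g \in contract -> x \in f -> x \in g -> f \in S' -> g \in S'.
Proof.
move=> cl f' g' /contractP[f [fF ndf ->]] /contractP[g [gF ndg ->]] xf xg.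
have nxu : x != u by apply: contraTneq xf => ->; rewrite u_merge.
have {}cl (h k : {set T}) y : h \in F -> ~~ degenerate h -> k \in F -> ~~ degenerate k ->
    x \in merge @: h -> x \in merge @: k -> y \in merge @: h -> y \in merge @: k -> y != x ->
    merge @: h \in S' -> merge @: k \in S'.
  move=> hF ndh kF ndk xh xk yh yk nyx; apply: (cl _ _ y) => //.
  - by apply/contractP; exists h.
  - by apply/contractP; exists k.
pose witness (h k : {set T}) z := [&& k \in F, ~~ degenerate k, (u \in k) || (v \in k),
   z != u, z != v, z \in h, z \in k & merge @: k \in S'].
(* A degenerate face u v z has no image; it is put into S when a surviving face on u z or v z has
   its image in S'. *)
pose S := [set h : {set T} | if degenerate h then [exists k, exists z, witness h k z]
                   else merge @: h \in S'].
have nvu : v != u by rewrite eq_sym.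
have Snd h : ~~ degenerate h -> (h \in S) = (merge @: h \in S') by rewrite inE => /negPf ->.
have Sd h : degenerate h -> (h \in S) = [exists k, exists z, witness h k z] by rewrite inE => ->.
have v_merge (h : {set T}) : (u \in h) || (v \in h) -> v \in merge @: h.
  by move=> H; rewrite mem_merge // eqxx orbC.
have mem (h : {set T}) y : y != u -> y \in h -> y \in merge @: h.
  by move=> nyu yh; rewrite mem_merge // yh.
have to_deg h k z : h \in F -> ~~ degenerate h -> k \in F -> degenerate k ->
    (u \in h) || (v \in h) -> z \in h -> z \in k -> z != u -> z != v -> h \in S -> k \in S.
  move=> hF ndh kF dk uvh zh zk nzu nzv; rewrite (Snd _ ndh) (Sd _ dk) => hS.
  apply/existsP; exists h; apply/existsP; exists z.
  by rewrite /witness hF ndh uvh nzu nzv zk zh hS.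
have [exv|nxv] := eqVneq x v.
- have from_deg h k z : h \in F -> degenerate h -> k \in F -> ~~ degenerate k ->
      (u \in k) || (v \in k) -> z \in h -> z \in k -> z != u -> z != v -> h \in S -> k \in S.
    move=> hF dh kF ndk uvk zh zk nzu nzv; rewrite (Snd _ ndk) (Sd _ dh).
    case/existsP => l /existsP[t /and5P[lF ndl uvl ntu /and4P[ntv th tl lS]]].
    have ezt : t = z.
      move: th; rewrite (degenerate_third hF dh zh) // !inE (negPf ntu) (negPf ntv) => /eqP //.
    by subst t; apply: (cl l k z) lS; rewrite ?exv ?v_merge ?mem.
  have closed w h k y : w = u \/ w = v -> h \in F -> k \in F -> w \in h -> w \in k ->
      y != u -> y != v -> y \in h -> y \in k -> h \in S -> k \in S.
    move=> wuv hF kF wh wk nyu nyv yh yk.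
    have uvh : (u \in h) || (v \in h) by case: wuv wh => -> ->; rewrite ?orbT.
    have uvk : (u \in k) || (v \in k) by case: wuv wk => -> ->; rewrite ?orbT.
    have [dh|ndh] := boolP (degenerate h); have [dk|ndk] := boolP (degenerate k).
    + by rewrite (degenerate_third hF dh yh) // (degenerate_third kF dk yk).
    + exact: from_deg yk nyu nyv.
    + exact: to_deg yh yk nyu nyv.
    + by rewrite !Snd //; apply: (cl _ _ y); rewrite ?exv ?v_merge ?mem.
  (* At u every edge except possibly u v is closed for S; evenness of the boundary at u settles u v. *)
  have b0 : bd F S u v = false.
    have := bd_even sF S u; apply: contraNF => buv.
    rewrite (_ : [set y | _ & _] = [set v]) ?cards1 //; apply/setP => y; rewrite !inE.
    apply/andP/eqP => [[nyu]|->]; last by rewrite buv.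
    have [//|nyv] := eqVneq y v; rewrite (bd0I sF) // 1?eq_sym // => h k.
    rewrite ![_ \in edge_faces _ _ _]inE => /and3P[hF uh yh] /and3P[kF uk yk].
    exact: (closed u h k y (or_introl (erefl _))).
  have star w h k : w = u \/ w = v -> h \in F -> k \in F -> w \in h -> w \in k -> h \in S -> k \in S.
    move=> wuv; apply: (sphere_star sF) => {}h {}k y hF kF wh wk nyw yh yk.
    have [dy|] := boolP ((y != u) && (y != v)); first by case/andP: dy => ? ?; apply: (closed w h k y).
    move=> dy; suff dhk : (u \in h) && (v \in h) && ((u \in k) && (v \in k)).
      case/andP: dhk => /andP[uh vh] /andP[uk vk].
      by apply: (bd0P sF nuv b0); rewrite inE ?hF ?kF ?uh ?uk.
    case: wuv => ew; subst w; move: dy nyw; rewrite negb_and !negbK => /orP[] /eqP ey; subst y;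
      by rewrite ?eqxx // wh wk yh yk.
  move=> fS'; rewrite -Snd //.
  have fS : f \in S by rewrite Snd.
  have uvf : (u \in f) || (v \in f) by move: xf; rewrite exv mem_merge // eqxx orbC.
  have uvg : (u \in g) || (v \in g) by move: xg; rewrite exv mem_merge // eqxx orbC.
  (* The stars of u and v share the face u v a, through which membership passes from one to the
     other. *)
  have aS : [set u; v; a] \in S.
    by case/orP: uvf => H; [apply: (star u f); auto|apply: (star v f); auto]; rewrite ?set3_mem.
  by case/orP: uvg => H; [apply: (star u [set u; v; a]); auto|apply: (star v [set u; v; a]); auto];
    rewrite ?set3_mem.
- have xin (h : {set T}) : x \in merge @: h -> x \in h.
    by rewrite mem_merge // (negPf nxv) orbF.
  move: (xin _ xf) (xin _ xg) => {}xf {}xg fS'; rewrite -Snd //.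
  have fS : f \in S by rewrite Snd.
  apply: (sphere_star sF (x := x)) fF gF xf xg fS => h k y hF kF xh xk nyx yh yk.
  have [dh|ndh] := boolP (degenerate h); have [dk|ndk] := boolP (degenerate k).
  + by rewrite (degenerate_third hF dh xh) // (degenerate_third kF dk xk).
  + have yuv : y = u \/ y = v.
      move: yh; rewrite (degenerate_third hF dh xh) // !inE (negPf nyx) orbF.
      by case/orP => /eqP; [left|right].
    have vk : v \in merge @: k by apply: v_merge; case: yuv yk => -> ->; rewrite ?orbT.
    rewrite (Snd _ ndk) (Sd _ dh).
    case/existsP => l /existsP[t /and5P[lF ndl uvl ntu /and4P[ntv th tl lS]]].
    have ext : t = x.
      by move: th; rewrite (degenerate_third hF dh xh) // !inE (negPf ntu) (negPf ntv) => /eqP.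
    subst t; have nvx : v != x by rewrite eq_sym.
    exact: (cl l k v lF ndl kF ndk (mem _ _ nxu tl) (mem _ _ nxu xk) (v_merge _ uvl) vk nvx lS).
  + apply: (to_deg _ _ x) => //.
    move: yk; rewrite (degenerate_third kF dk xk) // !inE (negPf nyx) orbF.
    by case/orP => /eqP e; move: yh; rewrite e => ->; rewrite ?orbT.
  + rewrite !Snd //; have [eyu|nyu] := eqVneq y u; last by apply: (cl _ _ y); rewrite ?mem.
    subst y; have nvx : v != x by rewrite eq_sym.
    by apply: (cl h k v hF ndh kF ndk (mem _ _ nxu xh) (mem _ _ nxu xk) _ _ nvx);
      apply: v_merge; rewrite ?yh ?yk.
Qed.

Lemma contract_conn (X : {set T}) :
  (forall x y, sc_adj contract x y -> x \in X -> y \in X) ->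
  forall x y, x \in cover contract -> y \in cover contract -> x \in X -> y \in X.
Proof.
move=> cl x y; rewrite cover_contract !inE => /andP[nxu xF] /andP[nyu yF] xX.
have := sphere_conn sF (X := merge @^-1: X) _ xF yF; rewrite !inE !mergeE //; apply=> // s t st.
rewrite !inE; have [->//|n] := eqVneq (merge s) (merge t).
exact: cl (adj_contract_merge st n).
Qed.

Lemma contract_sphere : sphere contract.
Proof.
split.
- by move=> f' /contractP[f [fF nd ->]]; apply: nondegenerate_card.
- exact: contract_edge2.
- exact: contract_star.
- exact: contract_conn.
- have arith (n m n' m' : nat) : n + 4 = 2 * m -> n = n' + 2 -> m = m'.+1 -> n' + 4 = 2 * m' by lia.
  exact: arith (sphere_euler sF) card_contract card_cover_contract.
Qed.

End Contraction.

(** * From [triangulated_sphere] to [sphere] *)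

Lemma connect_stable (T : finType) (e : rel T) (X : {set T}) x y :
  (forall s t, e s t -> s \in X -> t \in X) -> connect e x y -> x \in X -> y \in X.
Proof.
move=> cl /connectP[p pth ->]; elim: p x pth => //= z p IH x /andP[xz pth] xX.
exact: IH pth (cl _ _ xz xX).
Qed.

Lemma triangulated_sphere_cover (T : finType) (F : {set {set T}}) : triangulated_sphere F -> cover F = setT.
Proof.
by move=> [[_ cov] _ _ _ _]; apply/setP => x; rewrite inE; apply/bigcupP; apply: cov.
Qed.

Lemma triangulated_sphere_sphere (T : finType) (F : {set {set T}}) : triangulated_sphere F -> sphere F.
Proof.
move=> tF; have := tF => -[[F3 cov] E2 link conn euler]; split=> //.
- by move=> x y adj; rewrite edge_facesE E2 // sc_edges_adj //; case/andP: adj.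
- move=> x S cl f g fF gF xf xg fS.
  have other h : h \in F -> x \in h -> exists2 y, y != x & y \in h.
    move=> hF xh; have : 0 < #|h :\ x| by have := cardsD1 x h; rewrite xh F3 // add1n => -[<-].
    by case/card_gt0P => y; rewrite !inE => /andP[nyx yh]; exists y.
  have [a nax af] := other f fF xf; have [b nbx bg] := other g gF xg.
  have adjx y h : h \in F -> x \in h -> y != x -> y \in h -> sc_adj F x y.
    by move=> hF xh nyx yh; apply/sc_adjP; split; [rewrite eq_sym|exists h].
  (* An edge s t of the link of x is a face x s t, so membership in X, that is, all faces on x y
     being in S, passes from s to t. *)
  pose X := [set y | [forall h in F, (x \in h) ==> (y \in h) ==> (h \in S)]].
  have XP y h : y \in X -> h \in F -> x \in h -> y \in h -> h \in S.
    by rewrite inE => /forall_inP H hF xh yh; have := H h hF; rewrite xh yh.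
  have XI y h : y != x -> h \in S -> h \in F -> x \in h -> y \in h -> y \in X.
    move=> nyx hS hF xh yh; rewrite inE; apply/forall_inP => k kF.
    by apply/implyP => xk; apply/implyP => yk; exact: (cl h k y).
  suff bX : b \in X by apply: XP bX gF xg bg.
  apply: connect_stable (link x a b (adjx a f fF xf nax af) (adjx b g gF xg nbx bg)) (XI a f nax fS fF xf af).
  move=> s t /and4P[nsx ntx nst stF] sX.
  have xm : x \in [set x; s; t] by rewrite !inE eqxx.
  have sm : s \in [set x; s; t] by rewrite !inE eqxx orbT.
  have tm : t \in [set x; s; t] by rewrite !inE eqxx orbT.
  exact: XI t _ ntx (XP s _ sX stF xm sm) stF xm tm.
- by move=> X cl x y _ _; apply: connect_stable (conn x y).
- rewrite (triangulated_sphere_cover tF) cardsT.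
  have arith (n f e : nat) : n + f = e + 2 -> 2 * e = 3 * f -> f + 4 = 2 * n by lia.
  exact: arith euler (card_sc_edges F3 E2).
Qed.

(** * Local openness of polynomial maps *)

Section Polynomial_maps.
Local Open Scope ring_scope.
Variables (R : realType) (I : finType).
Implicit Types (z h : I -> R) (f g : (I -> R) -> R) (df dg : (I -> R) -> (I -> R) -> R).

(** A polynomial function with its formal differential, first at a point and then along a direction;
    analytic facts follow by induction on the construction of the polynomial. *)
Inductive polyd : ((I -> R) -> R) -> ((I -> R) -> (I -> R) -> R) -> Prop :=
| polyd_const c : polyd (fun=> c) (fun _ _ => 0)
| polyd_coord i : polyd (fun z => z i) (fun _ h => h i)
| polyd_add f g df dg : polyd f df -> polyd g dg ->
    polyd (fun z => f z + g z) (fun z h => df z h + dg z h)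
| polyd_mul f g df dg : polyd f df -> polyd g dg ->
    polyd (fun z => f z * g z) (fun z h => df z h * g z + f z * dg z h).

Lemma polyd_eq f f' df df' : f =1 f' -> df =2 df' -> polyd f df -> polyd f' df'.
Proof.
move=> ef ed; have -> : f' = f by apply/funext => z.
by have -> : df' = df by apply/funext => z; apply/funext => h.
Qed.

Lemma polyd_opp f df : polyd f df -> polyd (fun z => - f z) (fun z h => - df z h).
Proof.
move=> pf; apply: polyd_eq (polyd_mul (polyd_const (-1)) pf) => [z|z h]; rewrite ?mul0r ?add0r ?mulN1r //.
Qed.

Lemma polyd_sub f g df dg : polyd f df -> polyd g dg ->
  polyd (fun z => f z - g z) (fun z h => df z h - dg z h).
Proof. by move=> pf pg; apply: (polyd_add pf (polyd_opp pg)). Qed.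

Lemma polyd_sqr f df : polyd f df -> polyd (fun z => f z ^+ 2) (fun z h => 2 * (f z * df z h)).
Proof. by move=> pf; apply: polyd_eq (polyd_mul pf pf) => [z|z h]; ring. Qed.

Definition poly_fun f := exists df, polyd f df.

Lemma poly_fun_const c : poly_fun (fun=> c).
Proof. by eexists; apply: polyd_const. Qed.

Lemma poly_fun_add f g : poly_fun f -> poly_fun g -> poly_fun (fun z => f z + g z).
Proof. by move=> [df pf] [dg pg]; eexists; apply: polyd_add pf pg. Qed.

Lemma poly_fun_sub f g : poly_fun f -> poly_fun g -> poly_fun (fun z => f z - g z).
Proof. by move=> [df pf] [dg pg]; eexists; apply: polyd_sub pf pg. Qed.

Lemma poly_fun_mul f g : poly_fun f -> poly_fun g -> poly_fun (fun z => f z * g z).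
Proof. by move=> [df pf] [dg pg]; eexists; apply: polyd_mul pf pg. Qed.

Lemma poly_fun_coord i : poly_fun (fun z => z i).
Proof. by eexists; apply: polyd_coord. Qed.

Lemma poly_fun_eq f g : f =1 g -> poly_fun f -> poly_fun g.
Proof. by move=> e [df pf]; exists df; apply: polyd_eq pf. Qed.

Lemma poly_fun_sum (J : Type) (s : seq J) (f : J -> (I -> R) -> R) :
  (forall j, poly_fun (f j)) -> poly_fun (fun z => \sum_(j <- s) f j z).
Proof.
move=> pf; elim: s => [|j s IH].
  by apply: poly_fun_eq (poly_fun_const 0) => z; rewrite big_nil.
by apply: poly_fun_eq (poly_fun_add (pf j) IH) => z; rewrite big_cons.
Qed.

Lemma poly_fun_prod (J : Type) (s : seq J) (f : J -> (I -> R) -> R) :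
  (forall j, poly_fun (f j)) -> poly_fun (fun z => \prod_(j <- s) f j z).
Proof.
move=> pf; elim: s => [|j s IH].
  by apply: poly_fun_eq (poly_fun_const 1) => z; rewrite big_nil.
by apply: poly_fun_eq (poly_fun_mul (pf j) IH) => z; rewrite big_cons.
Qed.

Lemma poly_fun_det n (M : (I -> R) -> 'M[R]_n) :
  (forall i j, poly_fun (fun z => M z i j)) -> poly_fun (fun z => \det (M z)).
Proof.
move=> pM; rewrite /determinant; apply: poly_fun_sum => s.
by apply: poly_fun_mul; [apply: poly_fun_const|apply: poly_fun_prod].
Qed.

Lemma polyd_linear f df z : polyd f df ->
  forall c h h', df z (fun i => c * h i + h' i) = c * df z h + df z h'.
Proof.
elim=> {f df} [c0|i|f g df dg _ If _ Ig|f g df dg _ If _ Ig] c h h'; first by rewrite mulr0 addr0.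
- by [].
- by rewrite If Ig; ring.
- by rewrite If Ig; ring.
Qed.

Lemma polyd_fun_derivative f df z h : polyd f df -> poly_fun (fun z => df z h).
Proof.
elim=> {f df} [c|i|f g df dg _ If _ Ig|f g df dg pf If pg Ig].
- exact: poly_fun_const.
- exact: poly_fun_const.
- exact: poly_fun_add.
- apply: poly_fun_add; apply: poly_fun_mul => //; [by exists dg|by exists df].
Qed.

Lemma polyd_bounded f df z : polyd f df ->
  exists2 A, 0 <= A & forall h rho, 0 <= rho -> (forall i, `|h i| <= rho) -> `|df z h| <= A * rho.
Proof.
elim=> {f df} [c|i|f g df dg _ [A A0 HA] _ [B B0 HB]|f g df dg _ [A A0 HA] _ [B B0 HB]].
- by exists 0 => // h rho r0 _; rewrite normr0 mul0r.
- by exists 1 => // h rho r0 H; rewrite mul1r.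
- exists (A + B); first exact: addr_ge0.
  move=> h rho r0 H; rewrite mulrDl; apply: le_trans (ler_normD _ _) _.
  by apply: lerD; [apply: HA|apply: HB].
- exists (A * `|g z| + `|f z| * B); first by rewrite addr_ge0 // mulr_ge0.
  move=> h rho r0 H; rewrite mulrDl; apply: le_trans (ler_normD _ _) _; rewrite !normrM.
  apply: lerD; first by rewrite mulrAC ler_wpM2r // HA.
  by rewrite -mulrA ler_wpM2l // HB.
Qed.

Definition near_pt (z0 : I -> R) (d : R) z := forall i, `|z i - z0 i| < d.

Lemma near_pt_le z0 d d' z : d <= d' -> near_pt z0 d z -> near_pt z0 d' z.
Proof. by move=> le H i; apply: lt_le_trans (H i) le. Qed.

Lemma near_pt_refl z0 d : 0 < d -> near_pt z0 d z0.
Proof. by move=> d0 i; rewrite subrr normr0. Qed.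

Lemma minl_le (a b : R) : Num.min a b <= a. Proof. by rewrite ge_min lexx. Qed.
Lemma minr_le (a b : R) : Num.min a b <= b. Proof. by rewrite ge_min lexx orbT. Qed.

(** Strict differentiability in the sup norm: both points move, which is what turns the Newton map
    of the open mapping argument into a contraction. *)
Definition strictly_differentiable z0 f df := forall eta, 0 < eta -> exists2 d, 0 < d &
  forall z z', near_pt z0 d z -> near_pt z0 d z' -> forall rho, 0 <= rho ->
    (forall i, `|z i - z' i| <= rho) ->
    `|f z - f z' - df z0 (fun i => z i - z' i)| <= eta * rho.

Lemma strictly_differentiable_continuous z0 f df (A : R) : 0 <= A ->
  (forall h rho, 0 <= rho -> (forall i, `|h i| <= rho) -> `|df z0 h| <= A * rho) ->
  strictly_differentiable z0 f df ->
  forall e, 0 < e -> exists2 d, 0 < d & forall z, near_pt z0 d z -> `|f z - f z0| < e.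
Proof.
move=> A0 HA sd e e0; have [d d0 H] := sd 1 ltr01.
have A1 : 0 < A + 1 by rewrite ltr_wpDl.
have e1 : 0 < e / (A + 1) / 2 by rewrite !divr_gt0.
exists (Num.min d (e / (A + 1) / 2)); first by rewrite lt_min d0.
move=> z zn; set rho := e / (A + 1) / 2.
have zr i : `|z i - z0 i| <= rho by apply/ltW/(lt_le_trans (zn i)); apply: minr_le.
have := H z z0 (near_pt_le (minl_le _ _) zn) (near_pt_refl _ d0) rho (ltW e1) zr.
have := HA _ rho (ltW e1) zr.
set D := df z0 _ => h1; rewrite mul1r => h2.
have -> : f z - f z0 = (f z - f z0 - D) + D by ring.
apply: le_lt_trans (ler_normD _ _) _; apply: le_lt_trans (lerD h2 h1) _.
have -> : rho + A * rho = (A + 1) * rho by ring.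
rewrite /rho mulrA mulrCA divff ?gt_eqF // mulr1; lra.
Qed.

Lemma polyd_strictly_differentiable z0 f df : polyd f df -> strictly_differentiable z0 f df.
Proof.
elim=> {f df} [c|i|f g df dg _ If _ Ig|f g df dg pf If pg Ig] eta eta0.
- by exists 1 => // z z' _ _ rho r0 _; rewrite !subrr normr0 mulr_ge0 // ltW.
- by exists 1 => // z z' _ _ rho r0 _; rewrite subrr normr0 mulr_ge0 // ltW.
- have eta2 : 0 < eta / 2 by rewrite divr_gt0.
  have [d1 d10 H1] := If _ eta2; have [d2 d20 H2] := Ig _ eta2.
  exists (Num.min d1 d2); first by rewrite lt_min d10.
  move=> z z' zn zn' rho r0 zr.
  have := H1 z z' (near_pt_le (minl_le _ _) zn) (near_pt_le (minl_le _ _) zn') rho r0 zr.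
  have := H2 z z' (near_pt_le (minr_le _ _) zn) (near_pt_le (minr_le _ _) zn') rho r0 zr.
  set D1 := df _ _; set D2 := dg _ _ => h2 h1.
  have -> : f z + g z - (f z' + g z') - (D1 + D2) = (f z - f z' - D1) + (g z - g z' - D2) by ring.
  by apply: le_trans (ler_normD _ _) _; apply: le_trans (lerD h1 h2) _; rewrite -mulrDl -splitr.
- have [A A0 HA] := polyd_bounded z0 pf; have [B B0 HB] := polyd_bounded z0 pg.
  (* M bounds both factors near z0 and the norms of both differentials. With e = eta / (4 M), each
     of the four error terms of the product is at most a quarter of eta times rho. *)
  pose M := `|f z0| + `|g z0| + A + B + 1.
  have M1 : 1 <= M by rewrite /M lerDr !addr_ge0.
  have M0 : 0 < M by apply: lt_le_trans M1.
  pose e := eta / (4 * M); have e0 : 0 < e by rewrite divr_gt0 // mulr_gt0.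
  have eM : e * M = eta / 4 by rewrite /e; field; rewrite gt_eqF.
  have [d1 d10 H1] := If _ e0; have [d2 d20 H2] := Ig _ e0.
  have m0 : 0 < Num.min e 1 by rewrite lt_min e0 ltr01.
  have [d3 d30 H3] := strictly_differentiable_continuous A0 HA If m0.
  have [d4 d40 H4] := strictly_differentiable_continuous B0 HB Ig m0.
  exists (Num.min (Num.min d1 d2) (Num.min d3 d4)); first by rewrite !lt_min d10 d20 d30 d40.
  move=> z z' zn zn' rho r0 zr.
  have le1 := le_trans (minl_le (Num.min d1 d2) (Num.min d3 d4)) (minl_le _ _).
  have le2 := le_trans (minl_le (Num.min d1 d2) (Num.min d3 d4)) (minr_le _ _).
  have le3 := le_trans (minr_le (Num.min d1 d2) (Num.min d3 d4)) (minl_le _ _).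
  have le4 := le_trans (minr_le (Num.min d1 d2) (Num.min d3 d4)) (minr_le _ _).
  have := H1 z z' (near_pt_le le1 zn) (near_pt_le le1 zn') rho r0 zr.
  have := H2 z z' (near_pt_le le2 zn) (near_pt_le le2 zn') rho r0 zr.
  have := HA _ rho r0 zr; have := HB _ rho r0 zr.
  set D1 := df _ _; set D2 := dg _ _ => b2 b1 h2 h1.
  have := H3 z' (near_pt_le le3 zn'); have := H4 z (near_pt_le le4 zn).
  rewrite !lt_min => /andP[g1 g2] /andP[f1 f2].
  have gM : `|g z| <= M.
    have -> : g z = (g z - g z0) + g z0 by ring.
    apply: le_trans (ler_normD _ _) _; rewrite /M; have := normr_ge0 (f z0); lra.
  have fM : `|f z'| <= M.
    have -> : f z' = (f z' - f z0) + f z0 by ring.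
    apply: le_trans (ler_normD _ _) _; rewrite /M; have := normr_ge0 (g z0); lra.
  have AM : A <= M by rewrite /M; have := normr_ge0 (g z0); have := normr_ge0 (f z0); lra.
  have BM : B <= M by rewrite /M; have := normr_ge0 (g z0); have := normr_ge0 (f z0); lra.
  have -> : f z * g z - f z' * g z' - (D1 * g z0 + f z0 * D2) =
    (f z - f z' - D1) * g z + D1 * (g z - g z0) + (f z' * (g z - g z' - D2) + (f z' - f z0) * D2) by ring.
  have step (a b p q : R) : `|a| <= p -> `|b| <= q -> 0 <= p -> `|a * b| <= p * q.
    by move=> ap bq p0; rewrite normrM ler_pM.
  have er0 : 0 <= e * rho by rewrite mulr_ge0 // ltW.
  have t1 := step _ _ _ _ h1 gM er0.
  have t2 := step _ _ _ _ b1 (ltW g1) (mulr_ge0 A0 r0).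
  have t3 := step _ _ _ _ fM h2 (ltW M0).
  have t4 := step _ _ _ _ (ltW f1) b2 (ltW e0).
  apply: le_trans (ler_normD _ _) _; apply: le_trans (lerD (ler_normD _ _) (ler_normD _ _)) _.
  apply: le_trans (lerD (lerD t1 t2) (lerD t3 t4)) _.
  have u2 : A * rho * e <= e * M * rho by rewrite mulrC mulrA ler_wpM2r // ler_wpM2l // ltW.
  have u4 : e * (B * rho) <= e * M * rho by rewrite mulrA ler_wpM2r // ler_wpM2l // ltW.
  have u1 : e * rho * M = e * M * rho by ring.
  have u3 : M * (e * rho) = e * M * rho by ring.
  rewrite eM in u1 u2 u3 u4; rewrite u1 u3; lra.
Qed.

Lemma poly_fun_continuous f z0 e : poly_fun f -> 0 < e ->
  exists2 d, 0 < d & forall z, near_pt z0 d z -> `|f z - f z0| < e.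
Proof.
move=> [df pf] e0; have [A A0 HA] := polyd_bounded z0 pf.
exact: strictly_differentiable_continuous A0 HA (polyd_strictly_differentiable z0 pf) e e0.
Qed.

End Polynomial_maps.

HB.instance Definition _ (R : realType) (m n : nat) := Complete.on 'M[R]_(m, n).

(** * A quantitative inverse function theorem *)

Section Open_map.
Local Open Scope ring_scope.
Variables (R : realType) (I J : finType).
Implicit Types (z h : I -> R).

Lemma finite_min (K : finType) (P : K -> R -> Prop) :
  (forall k d d', d' <= d -> P k d -> P k d') -> (forall k, exists2 d, 0 < d & P k d) ->
  exists2 d, 0 < d & forall k, P k d.
Proof.
move=> mono ex; have /choice[d Hd] : forall k, exists d, 0 < d /\ P k d.
  by move=> k; have [d d0 Pd] := ex k; exists d.
(* The starting value 1 gives a positive radius even when K is empty. *)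
exists (\big[Num.min/1]_k d k).
  by elim/big_rec: _ => // k x _ x0; rewrite lt_min x0 (Hd k).1.
by move=> k; apply: mono (Hd k).2; rewrite (bigD1 k) //= minl_le.
Qed.

Lemma row_entry_le n (k : 'rV[R]_n) l : `|k 0 l| <= `|k|.
Proof. by rewrite [leRHS]/Num.Def.normr /= mx_normrE; apply/bigmax_geP; right => /=; exists (0, l). Qed.

Lemma row_norm_le n (k : 'rV[R]_n) c : 0 <= c -> (forall l, `|k 0 l| <= c) -> `|k| <= c.
Proof.
move=> c0 H; rewrite [leLHS]/Num.Def.normr /= mx_normrE; apply: bigmax_le => // -[a l] _ /=.
by rewrite ord1.
Qed.

Lemma polyd_linear0 f df z : polyd f df -> df z (fun _ : I => 0 : R) = 0.
Proof.
move=> pf; have := polyd_linear z pf (-1) (fun=> 0) (fun=> 0).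
rewrite (_ : (fun i : I => -1 * 0 + 0 : R) = fun=> 0); first by rewrite mulN1r addNr.
by apply/funext => i; rewrite mulr0 addr0.
Qed.

Lemma polyd_linear_sum (K : Type) (s : seq K) (c : K -> R) (hs : K -> I -> R) f df z : polyd f df ->
  df z (fun i => \sum_(k <- s) c k * hs k i) = \sum_(k <- s) c k * df z (hs k).
Proof.
move=> pf; elim: s => [|k s IH].
  rewrite big_nil (_ : (fun i => _) = fun=> 0) ?(polyd_linear0 z pf) //.
  by apply/funext => i; rewrite big_nil.
rewrite big_cons -IH -(polyd_linear z pf); congr (df z _).
by apply/funext => i; rewrite big_cons.
Qed.

(** On the affine slice through z0 spanned by preimages [hs] of the unit vectors, the differential
    is the identity. Solutions of f = y on it are the fixed points of k + y - f (psi k), found by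
    Banach's theorem on a small ball. *)
Lemma polynomial_open_map (f : J -> (I -> R) -> R) (df : J -> (I -> R) -> (I -> R) -> R) z0 :
  (forall j, polyd (f j) (df j)) ->
  (forall j, exists h, forall k, df k z0 h = (k == j)%:R) ->
  forall r, 0 < r -> exists2 d, 0 < d & forall y : J -> R,
    (forall j, `|y j - f j z0| < d) -> exists z, near_pt z0 r z /\ forall j, f j z = y j.
Proof.
move=> pf /choice[hs Hhs] r r0.
pose n := #|J|; pose psi (k : 'rV[R]_n) i := z0 i + \sum_j k 0 (enum_rank j) * hs j i.
pose C := \sum_j \sum_i `|hs j i|.
have C0 : 0 <= C by rewrite sumr_ge0 // => j _; apply: sumr_ge0.
have psiB k k' i : psi k i - psi k' i = \sum_j (k - k') 0 (enum_rank j) * hs j i.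
  rewrite /psi addrAC opprD addrA subrr add0r addrC -sumrB.
  by apply: eq_bigr => j _; rewrite !mxE; ring.
have psi_le k k' i : `|psi k i - psi k' i| <= C * `|k - k'|.
  rewrite psiB; apply: le_trans (ler_norm_sum _ _ _) _; rewrite /C mulr_suml.
  apply: ler_sum => j _; rewrite normrM mulrC; apply: ler_pM => //; last exact: row_entry_le.
  by rewrite (bigD1 i) //= lerDl sumr_ge0.
have psi0 i : psi 0 i = z0 i by rewrite /psi big1 ?addr0 // => j _; rewrite mxE mul0r.
have dfpsi k k' j : df j z0 (fun i => psi k i - psi k' i) = (k - k') 0 (enum_rank j).
  rewrite (_ : (fun i => _) = fun i => \sum_(j <- enum J) (k - k') 0 (enum_rank j) * hs j i); last first.
    by apply/funext => i; rewrite psiB big_enum.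
  rewrite (polyd_linear_sum _ _ _ _ (pf j)) big_enum /= (bigD1 j) //= Hhs eqxx mulr1 big1 ?addr0 // => l nl.
  by rewrite Hhs eq_sym (negPf nl) mulr0.
(* C is a Lipschitz constant of psi, so this eta makes the contraction factor at most 1/2; C + 1
   avoids dividing by zero. *)
have eta0 : 0 < (2 * (C + 1))^-1 by rewrite invr_gt0 mulr_gt0 // ltr_wpDl.
have etaC : (2 * (C + 1))^-1 * C <= 2^-1.
  rewrite invfM -mulrA ler_piMr // ler_pdivrMl ?ltr_wpDl // mulr1; lra.
have [d d0 Hd] : exists2 d, 0 < d & forall j z z', near_pt z0 d z -> near_pt z0 d z' ->
    forall rho, 0 <= rho -> (forall i, `|z i - z' i| <= rho) ->
    `|f j z - f j z' - df j z0 (fun i => z i - z' i)| <= (2 * (C + 1))^-1 * rho.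
  apply: finite_min => [j e e' le H z z' zn zn'|j].
    by apply: H; [apply: near_pt_le zn|apply: near_pt_le zn'].
  by have [e e0 He] := polyd_strictly_differentiable z0 (pf j) eta0; exists e.
pose m := Num.min d r; have m0 : 0 < m by rewrite lt_min d0.
pose kap := m / (2 * (C + 1)); have kap0 : 0 < kap by rewrite divr_gt0 // -invr_gt0.
have Ckap : C * kap < m.
  by rewrite /kap mulrC -mulrA (le_lt_trans (ler_wpM2l (ltW m0) etaC)) //; lra.
have psi_near (k : 'rV[R]_n) : `|k| <= kap -> near_pt z0 m (psi k).
  move=> kk i; rewrite -[z0 i]psi0; apply: le_lt_trans (psi_le _ _ _) _; rewrite subr0.
  by apply: le_lt_trans Ckap; rewrite ler_wpM2l.
(* For y this close, Phi moves 0 by at most kap / 2; with factor 1/2 it maps the ball of radius kap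
   into itself. *)
exists (kap / 2); first by rewrite divr_gt0.
move=> y Hy; pose Phi (k : 'rV[R]_n) : 'rV[R]_n := \row_l (k 0 l + y (enum_val l) - f (enum_val l) (psi k)).
have ctr k k' : `|k| <= kap -> `|k'| <= kap -> `|Phi k - Phi k'| <= 2^-1 * `|k - k'|.
  move=> kk kk'; apply: row_norm_le => [|l]; first by rewrite mulr_ge0.
  have := Hd (enum_val l) (psi k) (psi k') (near_pt_le (minl_le _ _) (psi_near _ kk))
    (near_pt_le (minl_le _ _) (psi_near _ kk')) (C * `|k - k'|) (mulr_ge0 C0 (normr_ge0 _)) (psi_le _ _).
  rewrite dfpsi enum_valK !mxE => H.
  have -> : k 0 l + y (enum_val l) - f (enum_val l) (psi k) - (k' 0 l + y (enum_val l) - f (enum_val l) (psi k'))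
    = - (f (enum_val l) (psi k) - f (enum_val l) (psi k') - (k 0 l - k' 0 l)) by ring.
  rewrite normrN; apply: le_trans H _; rewrite mulrA; exact: ler_wpM2r.
have Phi0 : `|Phi 0| <= 2^-1 * kap.
  apply: row_norm_le => [|l]; first by rewrite mulr_ge0 // ltW.
  rewrite !mxE add0r; have -> : psi 0 = z0 by apply/funext.
  by rewrite mulrC; apply/ltW/Hy.
pose U : set 'rV[R]_n := closed_ball_ Num.Def.normr (0 : 'rV[R]_n) kap.
have UP k : U k <-> `|k| <= kap by rewrite /U /closed_ball_ /= sub0r normrN.
have PhiU : set_fun U U Phi.
  move=> k /UP kk; apply/UP; rewrite -[Phi k](subrK (Phi 0)).
  have k0 : `|(0 : 'rV[R]_n)| <= kap by rewrite normr0 ltW.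
  apply: le_trans (ler_normD _ _) _; apply: le_trans (lerD (ctr _ _ kk k0) Phi0) _.
  by rewrite subr0 -mulrDr; lra.
have ctrf : is_contraction (mkfun_fun PhiU).
  exists (2^-1)%:nng; split=> /=; first by lra.
  by move=> [k k'] /= [/UP kk /UP kk']; apply: ctr.
have U0 : (U !=set0)%classic by exists 0; apply/UP; rewrite normr0 ltW.
have [k /UP kk kE] := banach_fixed_point ctrf (closed_closed_ball_ (x := 0) (e := kap)) U0.
exists (psi k); split; first exact: near_pt_le (minr_le _ _) (psi_near _ kk).
move=> j; have := congr1 (fun M : 'rV[R]_n => M 0 (enum_rank j)) kE.
by rewrite /= /mkfun /Phi mxE enum_rankK => H; lra.
Qed.

(* The matrix of the differentials along a right inverse at z0 is the identity at z0,
   so its determinant does not vanish nearby. *)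
Lemma surjective_differential_open (f : J -> (I -> R) -> R) (df : J -> (I -> R) -> (I -> R) -> R) z0 :
  (forall j, polyd (f j) (df j)) ->
  (forall y : J -> R, exists h, forall k, df k z0 h = y k) ->
  exists2 d, 0 < d & forall z, near_pt z0 d z -> forall y : J -> R, exists h, forall k, df k z h = y k.
Proof.
move=> pf surj; have /choice[hs Hhs] : forall j, exists h, forall k, df k z0 h = (k == j)%:R.
  by move=> j; apply: (surj (fun k => (k == j)%:R)).
pose M z : 'M[R]_#|J| := \matrix_(a, b) df (enum_val a) z (hs (enum_val b)).
have pM : poly_fun (fun z => \det (M z)).
  apply: poly_fun_det => a b; apply: (poly_fun_eq (f := fun z => df (enum_val a) z (hs (enum_val b)))).
    by move=> z; rewrite mxE.
  exact: (@polyd_fun_derivative R I _ _ (fun=> 0)).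
have M1 : \det (M z0) = 1.
  rewrite (_ : M z0 = 1%:M) ?det1 //; apply/matrixP => a b; rewrite !mxE Hhs.
  by rewrite (inj_eq enum_val_inj).
have [d d0 Hd] := poly_fun_continuous z0 pM ltr01.
exists d => // z /Hd; rewrite M1 => dz y.
have uM : M z \in unitmx.
  rewrite unitmxE unitfE; apply: contraTneq dz => ->.
  by rewrite sub0r normrN normr1 ltxx.
pose x : 'cV[R]_#|J| := invmx (M z) *m \col_a y (enum_val a).
have Mx : M z *m x = \col_a y (enum_val a) by rewrite mulmxA mulmxV // mul1mx.
exists (fun i => \sum_(b <- enum 'I_#|J|) x b 0 * hs (enum_val b) i) => k.
have := congr1 (fun c : 'cV[R]_#|J| => c (enum_rank k) 0) Mx; rewrite !mxE enum_rankK => <-.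
rewrite (polyd_linear_sum _ _ _ _ (pf k)) big_enum; apply: eq_bigr => b _.
by rewrite ?mxE ?enum_rankK mulrC.
Qed.

End Open_map.

(** * Frameworks and vertex splitting *)

Section Line.
Local Open Scope ring_scope.
Variables (R : realType) (I : finType).
Implicit Types (z : I -> R) (f : (I -> R) -> R).

Lemma poly_fun_line f z y : poly_fun f -> exists p : {poly R}, forall t, f (fun i => z i + t * y i) = p.[t].
Proof.
case=> df; elim=> {f df} [c|i|f g df dg _ [p Hp] _ [q Hq]|f g df dg _ [p Hp] _ [q Hq]].
- by exists c%:P => t; rewrite hornerC.
- by exists ((z i)%:P + (y i) *: 'X) => t; rewrite !hornerE mulrC.
- by exists (p + q) => t; rewrite hornerD Hp Hq.
- by exists (p * q) => t; rewrite hornerM Hp Hq.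
Qed.

Lemma poly_nonroot_small (p : {poly R}) r : p != 0 -> 0 < r -> exists t, [/\ 0 < t, t < r & p.[t] != 0].
Proof.
(* These are [size p] distinct points of the interval from 0 to r, more than p can have as roots. *)
move=> p0 r0; pose s := [seq r / (n%:R + 2) | n <- iota 0 (size p)].
have su : uniq s.
  rewrite map_inj_uniq ?iota_uniq // => m n /(mulfI (lt0r_neq0 r0)) /invr_inj /addIr /eqP.
  by rewrite eqr_nat => /eqP.
have [/(max_poly_roots p0)/(_ su)|] := boolP (all (root p) s); first by rewrite size_map size_iota ltnn.
case/allPn => t /mapP[n _ ->] nt; exists (r / (n%:R + 2)).
have n2 : 0 < n%:R + 2 :> R by rewrite ltr_wpDl.
split=> //; first by rewrite divr_gt0.
by rewrite ltr_pdivrMr // ltr_pMr //; have := ler0n R n; lra.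
Qed.

(** On the line from z to z1, f is a univariate polynomial that is nonzero at t = 1, so it has
    nonroots at arbitrarily small t > 0. *)
Lemma poly_fun_dense f z1 : poly_fun f -> f z1 != 0 ->
  forall z r, 0 < r -> exists2 z', near_pt z r z' & f z' != 0.
Proof.
move=> pf f1 z r r0; have [p Hp] := poly_fun_line z (fun i => z1 i - z i) pf.
have p0 : p != 0.
  apply: contraNneq f1 => p0; have := Hp 1; rewrite p0 horner0 => <-; apply/eqP; congr f.
  by apply/funext => i; ring.
pose A := \sum_i `|z1 i - z i|.
have A0 : 0 <= A by apply: sumr_ge0.
have A1 : 0 < A + 1 by rewrite ltr_wpDl.
have [t [t0 tr pt]] := poly_nonroot_small p0 (divr_gt0 r0 A1).
exists (fun i => z i + t * (z1 i - z i)); last by rewrite Hp.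
move=> i; rewrite addrC addKr normrM gtr0_norm //.
apply: le_lt_trans (_ : t * (A + 1) < r); last by rewrite -ltr_pdivlMr.
apply: ler_wpM2l; first exact: ltW.
by rewrite /A (bigD1 i) //= -addrA lerDl addr_ge0 // sumr_ge0.
Qed.

Lemma poly_fun_separate f g z z' : poly_fun f -> poly_fun g -> f z != g z' ->
  exists2 d, 0 < d & forall y y', near_pt z d y -> near_pt z' d y' -> f y != g y'.
Proof.
move=> pf pg ne; have e0 : 0 < `|f z - g z'| / 2 by rewrite divr_gt0 // normr_gt0 subr_eq0.
have [d d0 Hd] := poly_fun_continuous z pf e0.
have [d' d'0 Hd'] := poly_fun_continuous z' pg e0.
exists (Num.min d d'); first by rewrite lt_min d0.
move=> y y' /(near_pt_le (minl_le _ _))/Hd h /(near_pt_le (minr_le _ _))/Hd' h'.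
apply/eqP => e; have := ler_distD (f y) (f z) (g z').
by move: h; rewrite (distrC (f z) (f y)) e => h; lra.
Qed.
End Line.

Definition o0 : 'I_3 := ord0.
Definition o1 : 'I_3 := lift ord0 ord0.
Definition o2 : 'I_3 := lift ord0 (lift ord0 ord0).

Section Symmetric_index.
Local Open Scope ring_scope.
Variables (R : realType) (T : finType) (e : rel T).
Hypothesis esym : symmetric e.
Hypothesis eirr : forall x y, e x y -> x != y.

(** Every edge is listed once, oriented by [enum_rank]: listed in both directions it would give two
    equal equations and the differential could not be surjective. *)
Definition oedge := {p : T * T | e p.1 p.2 && (enum_rank p.1 < enum_rank p.2)%N}.

Lemma oedge_of x y : e x y -> exists j : oedge, val j = (x, y) \/ val j = (y, x).
Proof.
move=> exy; have := eirr exy; rewrite -(inj_eq enum_rank_inj) -val_eqE /= neq_ltn => /orP[lt|lt].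
  have H : e (x, y).1 (x, y).2 && (enum_rank (x, y).1 < enum_rank (x, y).2)%N by rewrite /= exy.
  by exists (Sub (x, y) H); left; rewrite SubK.
have H : e (y, x).1 (y, x).2 && (enum_rank (y, x).1 < enum_rank (y, x).2)%N by rewrite /= esym exy.
by exists (Sub (y, x) H); right; rewrite SubK.
Qed.

Variables (X : Type) (D : T -> T -> X -> R).
Hypothesis Dsym : forall x y h, D x y h = D y x h.

(** The space X of directions is abstract because it is also used with the directions of prescribed
    scale component. *)
Lemma sym_surj_oedge :
  (forall y : T -> T -> R, (forall s t, y s t = y t s) -> exists h, forall s t, e s t -> D s t h = y s t) ->
  forall y : oedge -> R, exists h, forall j, D (val j).1 (val j).2 h = y j.
Proof.
move=> H y; pose y1 s t := if insub (s, t) is Some j then y j else 0.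
have [s t|h Hh] := H (fun s t => y1 s t + y1 t s); first by rewrite addrC.
exists h => j; have /andP[ej lt] := valP j; rewrite Hh //.
have -> : y1 (val j).1 (val j).2 = y j by rewrite /y1 -surjective_pairing valK.
rewrite /y1 insubN ?addr0 //= negb_and orbC -leqNgt ltnW //.
Qed.

Lemma sym_surj_of_oedge :
  (forall y : oedge -> R, exists h, forall j, D (val j).1 (val j).2 h = y j) ->
  forall y : T -> T -> R, (forall s t, y s t = y t s) -> exists h, forall s t, e s t -> D s t h = y s t.
Proof.
move=> H y ysym; have [h Hh] := H (fun j => y (val j).1 (val j).2).
exists h => s t /oedge_of[j [ej|ej]]; have := Hh j; rewrite ej //=.
by rewrite Dsym ysym.
Qed.
End Symmetric_index.

Section Frameworks.
Local Open Scope ring_scope.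
Variables (R : realType) (T : finType).
Implicit Types (z h : T * 'I_3 -> R) (e : rel T) (x y s t : T).

Definition dist2 z x y := (z (x, o0) - z (y, o0)) ^+ 2 + (z (x, o1) - z (y, o1)) ^+ 2 + (z (x, o2) - z (y, o2)) ^+ 2.

Definition inner z h x y := (z (x, o0) - z (y, o0)) * (h (x, o0) - h (y, o0)) +
  (z (x, o1) - z (y, o1)) * (h (x, o1) - h (y, o1)) + (z (x, o2) - z (y, o2)) * (h (x, o2) - h (y, o2)).

Lemma dist2C z x y : dist2 z x y = dist2 z y x. Proof. by rewrite /dist2; ring. Qed.
Lemma innerC z h x y : inner z h x y = inner z h y x. Proof. by rewrite /inner; ring. Qed.

Lemma polyd_dist2 x y : polyd (fun z => dist2 z x y) (fun z h => 2 * inner z h x y).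
Proof.
have pc i : polyd (fun z : T * 'I_3 -> R => (z (x, i) - z (y, i)) ^+ 2)
   (fun z h => 2 * ((z (x, i) - z (y, i)) * (h (x, i) - h (y, i)))).
  exact: polyd_sqr (polyd_sub (polyd_coord _ _) (polyd_coord _ _)).
by apply: polyd_eq (polyd_add (polyd_add (pc o0) (pc o1)) (pc o2)) => [//|z h]; rewrite /inner; ring.
Qed.

(* Linear independence of the rows of the rigidity matrix, as surjectivity of the differential of the
   squared lengths. *)
Definition indep e z := forall y : T -> T -> R, (forall s t, y s t = y t s) ->
  exists h, forall s t, e s t -> inner z h s t = y s t.

(** A family of equivalent realisations indexed by K. The distances that tell its members apart are
    taken within W, the set of vertices of the complex; positions of the other elements of T carry
    no information. *)
Definition good e (W : {set T}) (K : finType) (q : K -> T * 'I_3 -> R) := [/\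
  forall k l s t, e s t -> dist2 (q k) s t = dist2 (q l) s t,
  forall k l, k != l -> exists s t, [/\ s \in W, t \in W & dist2 (q k) s t != dist2 (q l) s t]
  & forall k, indep e (q k)].

Variable e : rel T.
Hypothesis esym : symmetric e.
Hypothesis eirr : forall x y, e x y -> x != y.

Lemma indep_oedge z : indep e z -> forall y : oedge e -> R, exists h, forall j, 2 * inner z h (val j).1 (val j).2 = y j.
Proof.
move=> ind y; have [h Hh] := sym_surj_oedge ind (fun j => y j / 2).
by exists h => j; rewrite Hh mulrC divfK // pnatr_eq0.
Qed.

Lemma indep_open z : indep e z -> exists2 d, 0 < d & forall z', near_pt z d z' -> indep e z'.
Proof.
move=> ind.
have [d d0 Hd] := surjective_differential_open (fun j : oedge e => polyd_dist2 (val j).1 (val j).2) (indep_oedge ind).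
exists d => // z' /Hd surj; apply: sym_surj_of_oedge => //.
  by move=> x y h; apply: innerC.
move=> y; have [h Hh] := surj (fun j => 2 * y j); exists h => j.
have := Hh j; apply: mulfI; by rewrite pnatr_eq0.
Qed.

Variables (W : {set T}) (K : finType).

Lemma good_open (q : K -> T * 'I_3 -> R) : good e W q -> exists2 d, 0 < d & forall q', (forall k, near_pt (q k) d (q' k)) ->
  (forall k l s t, e s t -> dist2 (q' k) s t = dist2 (q' l) s t) -> good e W q'.
Proof.
move=> [len dis ind].
have [d d0 Hd] : exists2 d, 0 < d & forall k z', near_pt (q k) d z' -> indep e z'.
  apply: finite_min => [k d d' le H z' zn|k]; first exact: H (near_pt_le le zn).
  exact: indep_open (ind k).
have [d' d'0 Hd'] : exists2 d, 0 < d & forall kl : K * K, kl.1 != kl.2 ->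
    exists s t, [/\ s \in W, t \in W & forall z z', near_pt (q kl.1) d z -> near_pt (q kl.2) d z' -> dist2 z s t != dist2 z' s t].
  apply: finite_min => [[k l] d1 d2 le H nkl|[k l]].
    have [s [t [sW tW Hst]]] := H nkl; exists s, t; split=> // y y' yn yn'.
    by apply: Hst; [apply: near_pt_le yn|apply: near_pt_le yn'].
  have [->|nkl] := eqVneq k l; first by exists 1 => //=; rewrite eqxx.
  have [s [t [sW tW Hst]]] := dis k l nkl.
  have pd : poly_fun (fun z => dist2 z s t) by eexists; apply: polyd_dist2.
  have [d1 d10 H1] := poly_fun_separate pd pd Hst.
  by exists d1 => // _; exists s, t.
exists (Num.min d d'); first by rewrite lt_min d0.
move=> q' qn len'; split=> // [k l nkl|k]; last by apply: Hd; apply: near_pt_le (qn k); apply: minl_le.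
have [s [t [sW tW Hst]]] := Hd' (k, l) nkl; exists s, t; split=> //.
by apply: Hst; apply: near_pt_le (qn _); apply: minr_le.
Qed.

(** All members have the same lengths and open length maps, so the lengths of p, being close to
    those of [q k0], are attained near every other member as well. *)
Lemma good_move (q : K -> T * 'I_3 -> R) : good e W q -> forall r k0, 0 < r -> exists2 d, 0 < d &
  forall p, near_pt (q k0) d p -> exists q', [/\ good e W q', q' k0 = p & forall k, near_pt (q k) r (q' k)].
Proof.
move=> gq r k0 r0; have [d1 d10 Hd1] := good_open gq; have [len dis ind] := gq.
pose f (j : oedge e) (z : T * 'I_3 -> R) := dist2 z (val j).1 (val j).2.
pose r1 := Num.min r d1; have r10 : 0 < r1 by rewrite lt_min r0.
have [d2 d20 Hd2] : exists2 d, 0 < d & forall k (y : oedge e -> R), (forall j, `|y j - f j (q k)| < d) ->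
    exists z, near_pt (q k) r1 z /\ forall j, f j z = y j.
  apply: finite_min => [k d d' le H y Hy|k].
    by apply: H => j; apply: lt_le_trans (Hy j) le.
  apply: (polynomial_open_map (fun j => polyd_dist2 (val j).1 (val j).2)) => // j.
  exact: (indep_oedge (ind k) (fun l => (l == j)%:R)).
have [d3 d30 Hd3] : exists2 d, 0 < d & forall j p, near_pt (q k0) d p -> `|f j p - f j (q k0)| < d2.
  apply: finite_min => [j d d' le H p pn|j]; first exact: H (near_pt_le le pn).
  by apply: poly_fun_continuous d20; eexists; apply: polyd_dist2.
exists (Num.min r1 d3); first by rewrite lt_min r10.
move=> p pn.
have /choice[q1 Hq1] : forall k, exists z, near_pt (q k) r1 z /\ forall j, f j z = f j p.
  move=> k; apply: Hd2 => j.
  have -> : f j (q k) = f j (q k0) by apply: len; case/andP: (valP j).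
  exact: Hd3 (near_pt_le (minr_le _ _) pn).
pose q' k := if k == k0 then p else q1 k.
have q'n k : near_pt (q k) r1 (q' k).
  rewrite /q'; have [->|_] := eqVneq k k0; first exact: near_pt_le (minl_le _ _) pn.
  exact: (Hq1 k).1.
have q'f k j : f j (q' k) = f j p.
  by rewrite /q'; case: eqVneq => [_|_] //; apply: (Hq1 k).2.
exists q'; split; last by move=> k; apply: near_pt_le (q'n k); apply: minl_le.
  apply: Hd1 => [k|k l s t]; first by apply: near_pt_le (q'n k); apply: minr_le.
  case/(oedge_of esym eirr) => j [ej|ej]; have := q'f k j; rewrite -(q'f l j) /f ej //=.
  by rewrite ![dist2 _ t s]dist2C.
by rewrite /q' eqxx.
Qed.

(** The members are treated one at a time, each by a move small enough to keep f nonzero at those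
    already treated. *)
Lemma good_nondegenerate (q : K -> T * 'I_3 -> R) f z1 : good e W q -> poly_fun f -> f z1 != 0 ->
  exists q' : K -> T * 'I_3 -> R, good e W q' /\ forall k, f (q' k) != 0.
Proof.
move=> gq pf f1.
suff [q' [gq' Hq']] : exists q' : K -> T * 'I_3 -> R, good e W q' /\ forall k, k \in enum K -> f (q' k) != 0.
  by exists q'; split=> // k; apply: Hq'; rewrite mem_enum.
elim: (enum K) => [|k0 s [q1 [gq1 Hq1]]]; first by exists q.
have [d d0 Hd] : exists2 d, 0 < d & forall k, k \in s -> forall z, near_pt (q1 k) d z -> f z != 0.
  apply: finite_min => [k d d' le H ks z zn|k]; first exact: H ks _ (near_pt_le le zn).
  have [ks|_] := boolP (k \in s); last by exists 1.
  have [d d0 Hd] := poly_fun_separate (z' := z1) pf (poly_fun_const _ 0) (Hq1 k ks).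
  by exists d => // _ z zn; apply: (Hd z _ zn (near_pt_refl _ d0)).
have [d' d'0 Hd'] := good_move gq1 k0 d0.
have [p pn fp] := poly_fun_dense pf f1 (q1 k0) d'0.
have [q2 [gq2 q2p q2n]] := Hd' p pn; exists q2; split=> // k.
by rewrite inE => /orP[/eqP ->|ks]; [rewrite q2p|apply: Hd ks _ (q2n k)].
Qed.

End Frameworks.

(** * Determinants, normals and orientations in dimension 3 *)

Section Vec3.
Local Open Scope ring_scope.
Variable R : realType.
Implicit Types p q r : 'I_3 -> R.

Definition vec3 (x y z : R) : 'I_3 -> R := fun i => if val i is 0%N then x else if val i is 1%N then y else z.

Definition dot3 p q := p o0 * q o0 + p o1 * q o1 + p o2 * q o2.

Definition det3 p q r := p o0 * (q o1 * r o2 - q o2 * r o1) + p o1 * (q o2 * r o0 - q o0 * r o2) +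
  p o2 * (q o0 * r o1 - q o1 * r o0).

Lemma vec3E x y z : (vec3 x y z o0 = x) * (vec3 x y z o1 = y) * (vec3 x y z o2 = z).
Proof. by []. Qed.

(** Cramer's rule for the system with rows p, q, r. *)
Lemma solve3 p q r c0 c1 c2 : det3 p q r != 0 ->
  exists x, [/\ dot3 p x = c0, dot3 q x = c1 & dot3 r x = c2].
Proof.
rewrite /det3 => D0; set D := (X in X != 0) in D0.
exists (vec3 ((c0 * (q o1 * r o2 - q o2 * r o1) + c1 * (r o1 * p o2 - r o2 * p o1) + c2 * (p o1 * q o2 - p o2 * q o1)) / D)
  ((c0 * (q o2 * r o0 - q o0 * r o2) + c1 * (r o2 * p o0 - r o0 * p o2) + c2 * (p o2 * q o0 - p o0 * q o2)) / D)
  ((c0 * (q o0 * r o1 - q o1 * r o0) + c1 * (r o0 * p o1 - r o1 * p o0) + c2 * (p o0 * q o1 - p o1 * q o0)) / D)).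
by rewrite /dot3 !vec3E /D; split; field; exact: D0.
Qed.

(** The normalised cross product of p and q. It is nonzero because its dot product with r is
    [det3 p q r]. *)
Lemma unit_normal p q r : det3 p q r != 0 ->
  exists n, [/\ dot3 n p = 0, dot3 n q = 0, dot3 n n = 1 & det3 n p q != 0].
Proof.
move=> D0.
pose c := vec3 (p o1 * q o2 - p o2 * q o1) (p o2 * q o0 - p o0 * q o2) (p o0 * q o1 - p o1 * q o0).
have cr : det3 p q r = dot3 c r by rewrite /det3 /dot3 /c !vec3E; ring.
have L0 : 0 < dot3 c c.
  rewrite lt_neqAle eq_sym; apply/andP; split; last by rewrite /dot3 -!expr2 !addr_ge0 // sqr_ge0.
  apply: contraNneq D0; rewrite /dot3 -!expr2 => /eqP.
  rewrite paddr_eq0 ?addr_ge0 ?sqr_ge0 // paddr_eq0 ?sqr_ge0 // !sqrf_eq0.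
  by case/andP => /andP[/eqP c0 /eqP c1] /eqP c2; rewrite cr /dot3 c0 c1 c2 !mul0r !addr0.
pose s := Num.sqrt (dot3 c c).
have s0 : s != 0 by rewrite gt_eqF // sqrtr_gt0.
have ss : s * s = dot3 c c by rewrite -expr2 sqr_sqrtr // ltW.
exists (fun i => c i / s); split.
- by rewrite /dot3 /c !vec3E; field.
- by rewrite /dot3 /c !vec3E; field.
- rewrite (_ : dot3 _ _ = dot3 c c / (s * s)); first by rewrite ss divff // gt_eqF.
  by rewrite /dot3; field.
- rewrite (_ : det3 _ _ _ = dot3 c c / s); first by rewrite mulf_neq0 ?invr_eq0 // gt_eqF.
  by rewrite /det3 /dot3 /c !vec3E; field.
Qed.

(** The product of two determinants is the determinant of the matrix of dot products; hence such
    products depend only on distances. *)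
Lemma det3_gram p1 p2 p3 q1 q2 q3 : det3 p1 p2 p3 * det3 q1 q2 q3 =
  dot3 p1 q1 * (dot3 p2 q2 * dot3 p3 q3 - dot3 p2 q3 * dot3 p3 q2)
  - dot3 p1 q2 * (dot3 p2 q1 * dot3 p3 q3 - dot3 p2 q3 * dot3 p3 q1)
  + dot3 p1 q3 * (dot3 p2 q1 * dot3 p3 q2 - dot3 p2 q2 * dot3 p3 q1).
Proof. by rewrite /det3 /dot3; ring. Qed.

End Vec3.

Section Orientation.
Local Open Scope ring_scope.
Variables (R : realType) (T : finType).
Implicit Types (z h : T * 'I_3 -> R) (x y s t : T).

Definition diff z x y : 'I_3 -> R := fun i => z (x, i) - z (y, i).

Lemma dot3_diff z x y s t : dot3 (diff z x y) (diff z s t) =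
  (dist2 z x t + dist2 z y s - dist2 z x s - dist2 z y t) / 2.
Proof. by rewrite /dot3 /diff /dist2; field. Qed.

(** Its sign tells whether u and w lie on the same side of the plane v a b. A single determinant
    changes sign under reflections; the product of two is a congruence invariant. *)
Definition orient z u v a b w :=
  det3 (diff z u v) (diff z v a) (diff z v b) * det3 (diff z v a) (diff z v b) (diff z v w).

Lemma orient_dist2 z z' (W : {set T}) u v a b w :
  [/\ u \in W, v \in W, a \in W, b \in W & w \in W] ->
  (forall s t, s \in W -> t \in W -> dist2 z s t = dist2 z' s t) ->
  orient z u v a b w = orient z' u v a b w.
Proof.
move=> [uW vW aW bW wW] H; rewrite /orient !det3_gram !dot3_diff.
by rewrite ?(H u) ?(H v) ?(H a) ?(H b) // ?(H w).
Qed.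

End Orientation.

(** * Splitting a vertex *)

Section Split.
Local Open Scope ring_scope.
Variables (R : realType) (T : finType).
(** Here e and W belong to the sphere, e' and W' to its contraction of u into v; a and b are the
    common neighbours, and w is a further vertex against which the side of u is measured. *)
Variables (e e' : rel T) (W W' : {set T}) (u v a b w : T).
Hypotheses (esym : symmetric e) (eirr : forall x y, e x y -> x != y).
Hypotheses (e'sym : symmetric e') (e'irr : forall x y, e' x y -> x != y).
Hypothesis e_e' : forall x y, e x y -> x != u -> y != u -> e' x y.
Hypothesis e_u : forall x, e u x -> [\/ x = v, x = a, x = b | [/\ x != v, x != a, x != b, e' v x & ~~ e v x]].
Hypotheses (e_va : e v a) (e_vb : e v b).
Hypotheses (uW : u \in W) (uW' : u \notin W') (W'W : W' \subset W).
Hypotheses (vW' : v \in W') (aW' : a \in W') (bW' : b \in W') (wW' : w \in W').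
Hypotheses (nab : a != b) (nwv : w != v) (nwa : w != a) (nwb : w != b).

Local Notation pt := (option (T * 'I_3) -> R).
Implicit Types (z h : pt) (q : T * 'I_3 -> R) (n : 'I_3 -> R) (x y s t : T) (i : 'I_3).

Let inW x : x \in W' -> x \in W. Proof. exact: fintype.subsetP. Qed.
Let nvu : v != u. Proof. by apply: contraNneq uW' => <-. Qed.
Let nau : a != u. Proof. by apply: contraNneq uW' => <-. Qed.
Let nbu : b != u. Proof. by apply: contraNneq uW' => <-. Qed.
Let nwu : w != u. Proof. by apply: contraNneq uW' => <-. Qed.
Let nva : v != a. Proof. exact: eirr. Qed.
Let nvb : v != b. Proof. exact: eirr. Qed.

(* The coordinate [None] is the scale of the split and the coordinates at u hold its direction:
   u is placed at v + scale * direction. *)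
Definition split_pt z : T * 'I_3 -> R := fun p =>
  if p.1 == u then z (Some (v, p.2)) + z None * z (Some (u, p.2)) else z (Some p).

Definition dsplit_pt z h : T * 'I_3 -> R := fun p =>
  if p.1 == u then h (Some (v, p.2)) + (h None * z (Some (u, p.2)) + z None * h (Some (u, p.2)))
  else h (Some p).

Lemma polyd_split_pt p : polyd (fun z => split_pt z p) (fun z h => dsplit_pt z h p).
Proof.
case: p => x i; rewrite /split_pt /dsplit_pt /=; case: (x == u); last exact: polyd_coord.
exact: polyd_add (polyd_coord _ _) (polyd_mul (polyd_coord _ _) (polyd_coord _ _)).
Qed.

Lemma polyd_split_dist2 s t : polyd (fun z => dist2 (split_pt z) s t)
  (fun z h => 2 * inner (split_pt z) (dsplit_pt z h) s t).
Proof.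
have pc i := polyd_sqr (polyd_sub (polyd_split_pt (s, i)) (polyd_split_pt (t, i))).
by apply: polyd_eq (polyd_add (polyd_add (pc o0) (pc o1)) (pc o2)) => [//|z h]; rewrite /inner; ring.
Qed.

Definition sq_dir z := z (Some (u, o0)) ^+ 2 + z (Some (u, o1)) ^+ 2 + z (Some (u, o2)) ^+ 2.
Definition dsq_dir z h := 2 * (z (Some (u, o0)) * h (Some (u, o0)) +
  z (Some (u, o1)) * h (Some (u, o1)) + z (Some (u, o2)) * h (Some (u, o2))).

Lemma polyd_sq_dir : polyd sq_dir dsq_dir.
Proof.
have pc i := polyd_sqr (polyd_coord R (Some (u, i))).
by apply: polyd_eq (polyd_add (polyd_add (pc o0) (pc o1)) (pc o2)) => [//|z h]; rewrite /dsq_dir; ring.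
Qed.

(* (|u - x|^2 - |v - x|^2) / scale *)
Definition apex z x := 2 * (z (Some (u, o0)) * (z (Some (v, o0)) - z (Some (x, o0))) +
  z (Some (u, o1)) * (z (Some (v, o1)) - z (Some (x, o1))) +
  z (Some (u, o2)) * (z (Some (v, o2)) - z (Some (x, o2)))) + z None * sq_dir z.

Definition dapex z h x := 2 * (h (Some (u, o0)) * (z (Some (v, o0)) - z (Some (x, o0))) +
  h (Some (u, o1)) * (z (Some (v, o1)) - z (Some (x, o1))) +
  h (Some (u, o2)) * (z (Some (v, o2)) - z (Some (x, o2)))) +
  2 * (z (Some (u, o0)) * (h (Some (v, o0)) - h (Some (x, o0))) +
  z (Some (u, o1)) * (h (Some (v, o1)) - h (Some (x, o1))) +
  z (Some (u, o2)) * (h (Some (v, o2)) - h (Some (x, o2)))) +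
  (h None * sq_dir z + z None * dsq_dir z h).

Lemma polyd_apex x : polyd (fun z => apex z x) (fun z h => dapex z h x).
Proof.
have pc i := polyd_mul (polyd_coord R (Some (u, i))) (polyd_sub (polyd_coord R (Some (v, i))) (polyd_coord R (Some (x, i)))).
apply: polyd_eq (polyd_add (polyd_mul (polyd_const _ 2) (polyd_add (polyd_add (pc o0) (pc o1)) (pc o2)))
  (polyd_mul (polyd_coord R None) polyd_sq_dir)) => [//|z h]; rewrite /dapex; ring.
Qed.

(** The rescaled length equations. Those of u v, u a, u b are replaced by quantities that remain
    independent at scale 0 and that determine the three lengths, given the scale and the lengths of
    v a and v b. *)
Definition eqn s t z :=
  if (s == u) || (t == u) then
    let x := if s == u then t else s in
    if x == v then sq_dir z else if (x == a) || (x == b) then apex z x else dist2 (split_pt z) u x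
  else dist2 (split_pt z) s t.

Definition deqn s t z h :=
  if (s == u) || (t == u) then
    let x := if s == u then t else s in
    if x == v then dsq_dir z h else if (x == a) || (x == b) then dapex z h x
    else 2 * inner (split_pt z) (dsplit_pt z h) u x
  else 2 * inner (split_pt z) (dsplit_pt z h) s t.

Lemma polyd_eqn s t : polyd (eqn s t) (deqn s t).
Proof.
rewrite /eqn /deqn; case: (_ || _); last exact: polyd_split_dist2.
case: (_ == v); first exact: polyd_sq_dir.
by case: (_ || _); [apply: polyd_apex|apply: polyd_split_dist2].
Qed.

Lemma eqnC s t z : eqn s t z = eqn t s z.
Proof.
rewrite /eqn orbC; have [->|nsu] := eqVneq s u; have [->|ntu] := eqVneq t u => //=.
by rewrite dist2C.
Qed.

Lemma deqnC s t z h : deqn s t z h = deqn t s z h.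
Proof.
rewrite /deqn orbC; have [->|nsu] := eqVneq s u; have [->|ntu] := eqVneq t u => //=.
by rewrite innerC.
Qed.

Lemma edge_cases (P : T -> T -> Prop) : (forall s t, P s t -> P t s) ->
  (forall s t, e s t -> s != u -> t != u -> P s t) -> P u v -> P u a -> P u b ->
  (forall x, e u x -> x != v -> x != a -> x != b -> e' v x -> ~~ e v x -> P u x) ->
  forall s t, e s t -> P s t.
Proof.
move=> Psym P0 Pv Pa Pb Px.
have Pu x : e u x -> P u x.
  by move=> eux; case: (e_u eux) => [->|->|->|[? ? ? ? ?]] //; apply: Px.
move=> s t est; have [esu|nsu] := eqVneq s u; first by rewrite esu; apply: Pu; rewrite -esu.
have [etu|ntu] := eqVneq t u; last exact: P0.
by apply: Psym; rewrite etu; apply: Pu; rewrite esym -etu.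
Qed.

Lemma eqn_uv z : eqn u v z = sq_dir z. Proof. by rewrite /eqn !eqxx. Qed.
Lemma eqn_ua z : eqn u a z = apex z a.
Proof. by rewrite /eqn !eqxx /= [a == v]eq_sym (negPf nva). Qed.
Lemma eqn_ub z : eqn u b z = apex z b.
Proof. by rewrite /eqn !eqxx /= [b == v]eq_sym (negPf nvb) orbT. Qed.
Lemma eqn_ux z x : x != v -> x != a -> x != b -> eqn u x z = dist2 (split_pt z) u x.
Proof. by move=> /negPf n1 /negPf n2 /negPf n3; rewrite /eqn eqxx /= n1 n2 n3. Qed.
Lemma eqn_st z s t : s != u -> t != u -> eqn s t z = dist2 (split_pt z) s t.
Proof. by move=> /negPf n1 /negPf n2; rewrite /eqn n1 n2. Qed.
Lemma deqn_uv z h : deqn u v z h = dsq_dir z h. Proof. by rewrite /deqn !eqxx. Qed.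
Lemma deqn_ua z h : deqn u a z h = dapex z h a.
Proof. by rewrite /deqn !eqxx /= [a == v]eq_sym (negPf nva). Qed.
Lemma deqn_ub z h : deqn u b z h = dapex z h b.
Proof. by rewrite /deqn !eqxx /= [b == v]eq_sym (negPf nvb) orbT. Qed.
Lemma deqn_ux z h x : x != v -> x != a -> x != b -> deqn u x z h = 2 * inner (split_pt z) (dsplit_pt z h) u x.
Proof. by move=> /negPf n1 /negPf n2 /negPf n3; rewrite /deqn eqxx /= n1 n2 n3. Qed.
Lemma deqn_st z h s t : s != u -> t != u -> deqn s t z h = 2 * inner (split_pt z) (dsplit_pt z h) s t.
Proof. by move=> /negPf n1 /negPf n2; rewrite /deqn n1 n2. Qed.

Lemma split_dist2_uv z : dist2 (split_pt z) u v = z None ^+ 2 * sq_dir z.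
Proof. by rewrite /dist2 /split_pt /= eqxx (negPf nvu) /sq_dir; ring. Qed.

Lemma split_dist2_apex z x : x != u -> dist2 (split_pt z) u x = dist2 (split_pt z) v x + z None * apex z x.
Proof. by move=> /negPf nx; rewrite /dist2 /split_pt /= eqxx (negPf nvu) nx /apex /sq_dir; ring. Qed.

Lemma split_len z z' : z None = z' None -> (forall s t, e s t -> eqn s t z = eqn s t z') ->
  forall s t, e s t -> dist2 (split_pt z) s t = dist2 (split_pt z') s t.
Proof.
move=> eN Heq; have evx x : e v x -> x != u -> dist2 (split_pt z) v x = dist2 (split_pt z') v x.
  by move=> evx nxu; have := Heq _ _ evx; rewrite !eqn_st.
move=> s t est; have := Heq s t est; move: s t est.
apply: edge_cases => [s t|s t est nsu ntu||||x eux nxv nxa nxb _ _].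
- by rewrite ![eqn t s _]eqnC ![dist2 _ t s]dist2C.
- by rewrite !eqn_st.
- by rewrite !eqn_uv !split_dist2_uv eN => ->.
- by rewrite !eqn_ua !split_dist2_apex // eN (evx a) // => ->.
- by rewrite !eqn_ub !split_dist2_apex // eN (evx b) // => ->.
- by rewrite !eqn_ux.
Qed.

Lemma split_inner_uv z h : h None = 0 -> inner (split_pt z) (dsplit_pt z h) u v = z None ^+ 2 * dsq_dir z h / 2.
Proof.
by move=> h0; rewrite /inner /split_pt /dsplit_pt /= eqxx (negPf nvu) /dsq_dir h0; field.
Qed.

Lemma split_inner_apex z h x : h None = 0 -> x != u ->
  inner (split_pt z) (dsplit_pt z h) u x = inner (split_pt z) (dsplit_pt z h) v x + z None * dapex z h x / 2.
Proof.
by move=> h0 /negPf nx; rewrite /inner /split_pt /dsplit_pt /= eqxx (negPf nvu) nx /dapex /dsq_dir h0; field.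
Qed.

(** With the scale nonzero and held fixed ([h None = 0]), rescaled equations and squared lengths
    differ by an invertible triangular change; [tgt] is the right-hand side after this change. *)
Lemma split_indep z : z None != 0 ->
  (forall y : T -> T -> R, (forall s t, y s t = y t s) ->
     exists h, h None = 0 /\ forall s t, e s t -> deqn s t z h = y s t) ->
  indep e (split_pt z).
Proof.
move=> z0 H y ysym.
pose tgt s t : R := if (s == u) || (t == u) then
    let x := if s == u then t else s in
    if x == v then 2 * y u v / z None ^+ 2 else if (x == a) || (x == b) then 2 * (y u x - y v x) / z None
    else 2 * y u x
  else 2 * y s t.
have [|h [h0 Hh]] := H tgt.
  move=> s t; rewrite /tgt orbC; have [->|nsu] := eqVneq s u; have [->|ntu] := eqVneq t u => //=.
  by rewrite ysym.
have two : 2 != 0 :> R by rewrite pnatr_eq0.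
have evx x : e v x -> x != u -> inner (split_pt z) (dsplit_pt z h) v x = y v x.
  move=> evx nxu; have := Hh _ _ evx; rewrite deqn_st // /tgt (negPf nvu) (negPf nxu) /=.
  exact: mulfI.
exists (dsplit_pt z h) => s t est; have := Hh s t est; move: s t est.
apply: edge_cases => [s t|s t est nsu ntu||||x eux nxv nxa nxb _ _].
- rewrite ![deqn t s _ _]deqnC ![inner _ _ t s]innerC (ysym t s) (_ : tgt t s = tgt s t) //.
  rewrite /tgt orbC; have [->|nsu] := eqVneq s u; have [->|ntu] := eqVneq t u => //=.
  by rewrite ysym.
- by rewrite deqn_st // /tgt (negPf nsu) (negPf ntu) /=; apply: mulfI.
- by rewrite deqn_uv split_inner_uv // /tgt !eqxx /= => ->; field.
- rewrite deqn_ua split_inner_apex // /tgt !eqxx /= [a == v]eq_sym (negPf nva) => ->.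
  by rewrite evx //; field.
- rewrite deqn_ub split_inner_apex // /tgt !eqxx /= [b == v]eq_sym (negPf nvb) orbT => ->.
  by rewrite evx //; field.
- by rewrite deqn_ux // /tgt eqxx /= (negPf nxv) (negPf nxa) (negPf nxb) /=; apply: mulfI.
Qed.

Definition base q n : pt := fun p => if p is Some (x, i) then (if x == u then n i else q (x, i)) else 0.

Lemma split_base q n : split_pt (base q n) = fun p => q (if p.1 == u then v else p.1, p.2).
Proof.
apply/funext => -[x i]; rewrite /split_pt /=; case: (x == u) => //=.
by rewrite (negPf nvu) mul0r addr0.
Qed.

(** The values of the rescaled equations at scale 0. On edges of e they involve q only through
    lengths of edges of e', and not the normal, so they agree for all members of the family and for
    both normals. *)
Definition base_value q s t : R :=
  if (s == u) || (t == u) then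
    let x := if s == u then t else s in
    if x == v then 1 else if (x == a) || (x == b) then 0 else dist2 q v x
  else dist2 q s t.

Lemma base_valueC q s t : base_value q s t = base_value q t s.
Proof.
rewrite /base_value orbC; have [->|nsu] := eqVneq s u; have [->|ntu] := eqVneq t u => //=.
by rewrite dist2C.
Qed.

Lemma eqn_base q n s t : dot3 n n = 1 -> dot3 n (diff q v a) = 0 -> dot3 n (diff q v b) = 0 ->
  s != t -> eqn s t (base q n) = base_value q s t.
Proof.
move=> n1 na nb nst.
have sd : sq_dir (base q n) = 1 by rewrite /sq_dir /= eqxx -n1 /dot3; ring.
have ap x : x != u -> dot3 n (diff q v x) = 0 -> apex (base q n) x = 0.
  move=> /negPf nx nd; rewrite /apex /= eqxx (negPf nvu) nx mul0r addr0.
  by rewrite -[X in 2 * X]/(dot3 n (diff q v x)) nd mulr0.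
rewrite /eqn /base_value.
case est: ((s == u) || (t == u)); last first.
  by move/norP: est => [/negPf n2 /negPf n3]; rewrite /dist2 split_base /= n2 n3.
have xu : (if s == u then t else s) != u.
  by have [esu|//] := eqVneq s u; rewrite -esu eq_sym.
move: (if s == u then t else s) xu => x xu /=.
case: (x == v) => //; have [->|nxa] := eqVneq x a; first by rewrite /= ap.
have [->|nxb] := eqVneq x b; first by rewrite /= ap.
by rewrite /= /dist2 split_base /= eqxx (negPf xu).
Qed.

(** The system is triangular: the motion [hq] of the contraction is found by independence of e', and
    then the motion [hu] of the direction from the equations of u v, u a, u b, whose coefficient
    vectors are n, v-a and v-b. *)
Lemma base_surj q n : indep e' q -> dot3 n n = 1 -> det3 n (diff q v a) (diff q v b) != 0 ->
  forall (y0 : R) (y : T -> T -> R), (forall s t, y s t = y t s) ->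
  exists h, h None = y0 /\ forall s t, e s t -> deqn s t (base q n) h = y s t.
Proof.
move=> ind n1 D0 y0 y ysym.
have two : 2 != 0 :> R by rewrite pnatr_eq0.
(* An edge v x of the contraction comes from v x or from u x in e. In the second case a change y0 of
   the scale shifts u along n and is compensated. *)
pose tau x := if e v x then y v x / 2 else y u x / 2 - y0 * dot3 n (diff q v x).
pose tgt s t := if s == v then tau t else if t == v then tau s else y s t / 2.
have tgtC s t : tgt s t = tgt t s.
  by rewrite /tgt; have [esv|nsv] := eqVneq s v; have [etv|ntv] := eqVneq t v; rewrite ?esv ?etv // ysym.
have [hq Hhq] := ind tgt tgtC.
have [hu [hu1 hu2 hu3]] := solve3 (y u v / 2)
  ((y u a - y0) / 2 - dot3 n (diff hq v a)) ((y u b - y0) / 2 - dot3 n (diff hq v b)) D0.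
pose h : pt := fun p => if p is Some (x, i) then (if x == u then hu i else hq (x, i)) else y0.
have sd : sq_dir (base q n) = 1 by rewrite /sq_dir /= eqxx -n1 /dot3; ring.
have dap x : x != u -> dapex (base q n) h x = 2 * dot3 (diff q v x) hu + 2 * dot3 n (diff hq v x) + y0.
  move=> /negPf nx; rewrite /dapex sd /= eqxx (negPf nvu) nx mul0r addr0 mulr1 /dot3 /diff; ring.
have evx x : e v x -> x != u -> inner q hq v x = y v x / 2.
  by move=> evx nxu; rewrite Hhq ?e_e' // /tgt eqxx /tau evx.
exists h; split=> //; apply: edge_cases => [s t|s t est nsu ntu||||x eux nxv nxa nxb e'vx nevx].
- by rewrite deqnC ysym.
- rewrite deqn_st //; have -> : inner (split_pt (base q n)) (dsplit_pt (base q n) h) s t = inner q hq s t.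
    by rewrite split_base /inner /dsplit_pt /= (negPf nsu) (negPf ntu).
  have [esv|nsv] := eqVneq s v; first by subst s; rewrite evx //; field.
  have [etv|ntv] := eqVneq t v.
    by subst t; rewrite innerC evx 1?esym // ysym; field.
  by rewrite Hhq ?e_e' // /tgt (negPf nsv) (negPf ntv); field.
- by rewrite deqn_uv /dsq_dir /= !eqxx -[X in 2 * X]/(dot3 n hu) hu1; field.
- by rewrite deqn_ua dap // hu2; field.
- by rewrite deqn_ub dap // hu3; field.
- have nxu : x != u by rewrite eq_sym; apply: eirr.
  rewrite deqn_ux // (_ : inner _ _ u x = inner q hq v x + y0 * dot3 n (diff q v x)).
    by rewrite Hhq // /tgt eqxx /tau (negPf nevx); field.
  rewrite split_base /inner /dsplit_pt /= !eqxx (negPf nvu) (negPf nxu) /dot3 /diff; ring.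
Qed.

Definition coords z : T * 'I_3 -> R := fun p => z (Some p).

(** [orient] divided by the scale. At scale 0, with the points in general position, it is nonzero
    and takes opposite values for the two normals. *)
Definition orient_rate z := det3 (fun i => z (Some (u, i))) (diff (coords z) v a) (diff (coords z) v b) *
  det3 (diff (coords z) v a) (diff (coords z) v b) (diff (coords z) v w).

Lemma split_orient z : orient (split_pt z) u v a b w = z None * orient_rate z.
Proof.
rewrite /orient /orient_rate /det3 /diff /split_pt /coords /= eqxx.
by rewrite (negPf nvu) (negPf nau) (negPf nbu) (negPf nwu); ring.
Qed.

Lemma poly_fun_orient_rate : poly_fun orient_rate.
Proof.
rewrite /orient_rate /det3 /diff /coords.
by repeat first [exact: poly_fun_coord | apply: poly_fun_mul | apply: poly_fun_sub | apply: poly_fun_add].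
Qed.

Lemma orient_rate_base q n : orient_rate (base q n) =
  det3 n (diff q v a) (diff q v b) * det3 (diff q v a) (diff q v b) (diff q v w).
Proof.
rewrite /orient_rate /coords /diff /= eqxx.
by rewrite (negPf nvu) (negPf nau) (negPf nbu) (negPf nwu).
Qed.

(** For k != l a distance within W' already differs. For k = l, equal distances would give equal
    [orient], and after cancelling the common scale equal rates, although the rates are opposite at
    the base points. *)
Lemma split_separate (K : finType) (q : K -> T * 'I_3 -> R) (n : K -> 'I_3 -> R) :
  (forall k l, k != l -> exists s t, [/\ s \in W', t \in W' & dist2 (q k) s t != dist2 (q l) s t]) ->
  (forall k, det3 (n k) (diff (q k) v a) (diff (q k) v b) * det3 (diff (q k) v a) (diff (q k) v b) (diff (q k) v w) != 0) ->
  forall ks lt : K * bool, ks != lt -> exists2 d, 0 < d & forall z z',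
    near_pt (base (q ks.1) (fun i => (-1) ^+ ks.2 * n ks.1 i)) d z ->
    near_pt (base (q lt.1) (fun i => (-1) ^+ lt.2 * n lt.1 i)) d z' ->
    z None = z' None -> z None != 0 ->
    exists s t, [/\ s \in W, t \in W & dist2 (split_pt z) s t != dist2 (split_pt z') s t].
Proof.
move=> dis D0 [k s1] [l s2] nkl.
have [ekl|nekl] := eqVneq k l; last first.
  have [s [t [sW tW Hst]]] := dis _ _ nekl.
  have pd : poly_fun (fun z => dist2 (split_pt z) s t) by eexists; apply: polyd_split_dist2.
  have nsu : s != u by apply: contraNneq uW' => <-.
  have ntu : t != u by apply: contraNneq uW' => <-.
  have [|d d0 Hd] := @poly_fun_separate _ _ _ _ (base (q k) (fun i => (-1) ^+ s1 * n k i))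
      (base (q l) (fun i => (-1) ^+ s2 * n l i)) pd pd.
    by rewrite !split_base /dist2 /= (negPf nsu) (negPf ntu).
  by exists d => // z z' zn zn' _ _; exists s, t; rewrite !inW //; split=> //; apply: Hd.
subst l; have ns : s1 != s2 by apply: contraNneq nkl => ->.
have det3N (c : R) p1 p2 p3 : det3 (fun i => c * p1 i) p2 p3 = c * det3 p1 p2 p3 by rewrite /det3; ring.
have [|d d0 Hd] := @poly_fun_separate _ _ _ _ (base (q k) (fun i => (-1) ^+ s1 * n k i))
    (base (q k) (fun i => (-1) ^+ s2 * n k i)) poly_fun_orient_rate poly_fun_orient_rate.
  rewrite !orient_rate_base !det3N -!mulrA (inj_eq (mulIf (D0 k))).
  by case: s1 s2 ns {nkl} => [] [] //= _; rewrite ?expr0 ?expr1; apply/eqP; lra.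
exists d => //= z z' zn zn' eN z0; apply: contrapT => H.
have := Hd z z' zn zn'; rewrite -(inj_eq (mulfI z0)) -split_orient eN -split_orient => /eqP; apply.
apply: (orient_dist2 (W := W)).
  by rewrite uW !inW.
move=> s t sW tW; apply/eqP/negbNE/negP => nst; apply: H; exists s, t; split=> //.
Qed.

Lemma vertex_split (K : finType) (q : K -> T * 'I_3 -> R) : good e' W' q ->
  exists q2 : K * bool -> T * 'I_3 -> R, good e W q2.
Proof.
move=> gq0.
have pD : poly_fun (fun z : T * 'I_3 -> R => det3 (diff z v a) (diff z v b) (diff z v w)).
  rewrite /det3 /diff.
  by repeat first [exact: poly_fun_coord | apply: poly_fun_mul | apply: poly_fun_sub | apply: poly_fun_add].
(* With v at the origin and a, b, w at minus the basis vectors the determinant is 1, so the general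
   position polynomial is not identically zero. *)
pose z1 (p : T * 'I_3) : R := - ([|| (p.1 == a) && (p.2 == o0), (p.1 == b) && (p.2 == o1) | (p.1 == w) && (p.2 == o2)])%:R.
have Dz1 : det3 (diff z1 v a) (diff z1 v b) (diff z1 v w) != 0.
  have zv i : z1 (v, i) = 0 by rewrite /z1 /= (negPf nva) (negPf nvb) [v == w]eq_sym (negPf nwv) oppr0.
  have za i : z1 (a, i) = - (i == o0)%:R by rewrite /z1 /= eqxx (negPf nab) [a == w]eq_sym (negPf nwa) !orbF.
  have zb i : z1 (b, i) = - (i == o1)%:R.
    by rewrite /z1 /= eqxx [b == a]eq_sym (negPf nab) [b == w]eq_sym (negPf nwb) !orbF.
  have zw i : z1 (w, i) = - (i == o2)%:R by rewrite /z1 /= eqxx (negPf nwa) (negPf nwb).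
  rewrite /det3 /diff !(zv, za, zb, zw) (_ : _ + _ = 1) ?oner_neq0 //.
  by rewrite /=; ring.
have [q1 [[len dis ind] Dq]] := good_nondegenerate e'sym e'irr gq0 pD Dz1.
have /choice[n Hn] : forall k, exists n, [/\ dot3 n (diff (q1 k) v a) = 0, dot3 n (diff (q1 k) v b) = 0,
    dot3 n n = 1 & det3 n (diff (q1 k) v a) (diff (q1 k) v b) != 0].
  by move=> k; apply: unit_normal (Dq k).
pose N (ks : K * bool) i := (-1) ^+ ks.2 * n ks.1 i.
pose B (ks : K * bool) := base (q1 ks.1) (N ks).
have HN ks : [/\ dot3 (N ks) (diff (q1 ks.1) v a) = 0, dot3 (N ks) (diff (q1 ks.1) v b) = 0,
    dot3 (N ks) (N ks) = 1 & det3 (N ks) (diff (q1 ks.1) v a) (diff (q1 ks.1) v b) != 0].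
  have [na nb n1 nD] := Hn ks.1.
  have dotN p : dot3 (N ks) p = (-1) ^+ ks.2 * dot3 (n ks.1) p by rewrite /dot3 /N; ring.
  split; rewrite ?dotN ?na ?nb ?mulr0 //.
    rewrite (_ : dot3 _ _ = (-1) ^+ ks.2 * dot3 (n ks.1) (n ks.1)); last by rewrite /dot3 /N; ring.
    by rewrite n1 mulr1 -expr2 sqrr_sign.
  have -> : det3 (N ks) (diff (q1 ks.1) v a) (diff (q1 ks.1) v b) =
    (-1) ^+ ks.2 * det3 (n ks.1) (diff (q1 ks.1) v a) (diff (q1 ks.1) v b) by rewrite /det3 /N; ring.
  by rewrite mulf_neq0 // signr_eq0.
(* The index [None] adds the equation that prescribes the scale. *)
pose f (j : option (oedge e)) : pt -> R := if j is Some j then eqn (val j).1 (val j).2 else fun z => z None.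
pose df (j : option (oedge e)) : pt -> pt -> R :=
  if j is Some j then deqn (val j).1 (val j).2 else fun _ h => h None.
have pf j : polyd (f j) (df j) by case: j => [j|]; [apply: polyd_eqn|apply: polyd_coord].
have surj ks : forall c : option (oedge e) -> R, exists h, forall j, df j (B ks) h = c j.
  move=> c; have [_ _ n1 nD] := HN ks.
  have ysurj : forall y' : T -> T -> R, (forall s t, y' s t = y' t s) ->
     exists h : {h : pt | h None = c None}, forall s t, e s t -> deqn s t (B ks) (sval h) = y' s t.
    by move=> y' y's; have [h [h0 Hh]] := base_surj (ind ks.1) n1 nD (c None) y's; exists (exist _ h h0).
  have [[h h0] Hh] := sym_surj_oedge ysurj (fun j => c (Some j)).
  by exists h => -[j|]; [apply: Hh|].
have [r1 r10 Hr1] : exists2 d, 0 < d & forall ks z, near_pt (B ks) d z ->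
    forall c : option (oedge e) -> R, exists h, forall j, df j z h = c j.
  apply: finite_min => [ks d d' le H z zn|ks]; first exact: H (near_pt_le le zn).
  exact: surjective_differential_open pf (surj ks).
have [r2 r20 Hr2] : exists2 d, 0 < d & forall kl : (K * bool) * (K * bool), kl.1 != kl.2 -> forall z z',
    near_pt (B kl.1) d z -> near_pt (B kl.2) d z' -> z None = z' None -> z None != 0 ->
    exists s t, [/\ s \in W, t \in W & dist2 (split_pt z) s t != dist2 (split_pt z') s t].
  apply: finite_min => [kl d d' le H nkl z z' zn zn'|[k l]].
    by apply: H => //; [apply: near_pt_le zn|apply: near_pt_le zn'].
  have [->|nkl] := eqVneq k l; first by exists 1 => //=; rewrite eqxx.
  have D0 k' : det3 (n k') (diff (q1 k') v a) (diff (q1 k') v b) *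
      det3 (diff (q1 k') v a) (diff (q1 k') v b) (diff (q1 k') v w) != 0.
    by rewrite mulf_neq0 //; have [] := Hn k'.
  by have [d d0 Hd] := split_separate dis D0 nkl; exists d.
pose r := Num.min r1 r2; have r0 : 0 < r by rewrite lt_min r10.
have [d d0 Hd] : exists2 d, 0 < d & forall ks (c : option (oedge e) -> R), (forall j, `|c j - f j (B ks)| < d) ->
    exists z, near_pt (B ks) r z /\ forall j, f j z = c j.
  apply: finite_min => [ks d d' le H c Hc|ks].
    by apply: H => j; apply: lt_le_trans (Hc j) le.
  by apply: (polynomial_open_map pf) => // j; apply: (surj ks (fun k => (k == j)%:R)).
have /choice[z Hz] : forall ks, exists z, [/\ near_pt (B ks) r z, z None = d / 2 &
    forall s t, e s t -> eqn s t z = base_value (q1 ks.1) s t].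
  move=> ks; have [na nb n1 nD] := HN ks.
  have fb (j : oedge e) : f (Some j) (B ks) = base_value (q1 ks.1) (val j).1 (val j).2.
    by apply: eqn_base => //; apply: eirr; case/andP: (valP j).
  (* Only the scale leaves its base value: it is raised from 0 to d / 2, positive and within the
     solvable range. *)
  have [|z [zn Hz]] := Hd ks (fun j => if j is Some j then base_value (q1 ks.1) (val j).1 (val j).2 else d / 2).
    case=> [j|]; first by rewrite fb subrr normr0.
    by rewrite /= subr0 gtr0_norm ?divr_gt0 //; lra.
  exists z; split=> //; first exact: (Hz None).
  move=> s t /(oedge_of esym eirr)[j [ej|ej]]; have := Hz (Some j); rewrite /= ej //=.
  by rewrite eqnC => ->; apply: base_valueC.
have zN ks : z ks None != 0 by have [_ -> _] := Hz ks; rewrite gt_eqF // divr_gt0.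
exists (fun ks => split_pt (z ks)); split.
- move=> ks lt; apply: split_len; first by have [_ -> _] := Hz ks; have [_ -> _] := Hz lt.
  move=> s t est; have [_ _ ->] := Hz ks => //; have [_ _ ->] := Hz lt => //.
  have lq x y : e' x y -> dist2 (q1 ks.1) x y = dist2 (q1 lt.1) x y by apply: len.
  move: s t est; apply: edge_cases => [s t|s t est nsu ntu||||x eux nxv nxa nxb e'vx _].
  + by rewrite ![base_value _ t s]base_valueC.
  + by rewrite /base_value (negPf nsu) (negPf ntu) /= lq // e_e'.
  + by rewrite /base_value !eqxx.
  + by rewrite /base_value !eqxx /= [a == v]eq_sym (negPf nva).
  + by rewrite /base_value !eqxx /= [b == v]eq_sym (negPf nvb) orbT.
  + by rewrite /base_value eqxx /= (negPf nxv) (negPf nxa) (negPf nxb) /= lq.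
- move=> ks lt nkl; have [zk eNk _] := Hz ks; have [zl eNl _] := Hz lt.
  apply: (Hr2 (ks, lt) nkl) => //; rewrite ?eNk ?eNl //.
  + exact: near_pt_le (minr_le _ _) zk.
  + exact: near_pt_le (minr_le _ _) zl.
- move=> ks; have [zk _ _] := Hz ks; apply: split_indep => // y ysym.
  have [h Hh] := Hr1 ks _ (near_pt_le (minl_le _ _) zk)
    (fun j => if j is Some j then y (val j).1 (val j).2 else 0).
  exists h; split; first exact: (Hh None).
  move=> s t /(oedge_of esym eirr)[j [ej|ej]]; have := Hh (Some j); rewrite /= ej //=.
  by rewrite deqnC ysym.
Qed.

End Split.

(** * Families of realisations of spheres *)

Section Sphere_good.
Local Open Scope ring_scope.
Variables (R : realType) (T : finType).
Implicit Types (F : {set {set T}}) (x y s t : T).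

Lemma tetrahedron_indep (e : rel T) u v a b : symmetric e -> (forall x y, e x y -> x != y) ->
  u != v -> a != b -> a != u -> a != v -> b != u -> b != v ->
  (forall s t, e s t -> s \in [set u; v; a; b]) ->
  exists z : T * 'I_3 -> R, indep e z.
Proof.
move=> esym eirr nuv nab nau nav nbu nbv eW.
pose vs (i : 'I_3) := if val i is 0%N then v else if val i is 1%N then a else b.
have vsE : (vs o0 = v) * (vs o1 = a) * (vs o2 = b) by [].
(* u is at the origin and v, a, b are at the basis vectors. *)
exists (fun p => (p.1 == vs p.2)%:R) => y ysym.
pose y' s t : R := if s == t then 0 else y s t.
have y'C s t : y' s t = y' t s by rewrite /y' eq_sym ysym.
have y'0 s : y' s s = 0 by rewrite /y' eqxx.
(* Polarisation of the prescribed values with u as origin: the velocity of u is 0, and those of v,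
   a, b form a symmetric matrix. *)
exists (fun p => (y' u p.1 + y' u (vs p.2) - y' p.1 (vs p.2)) / 2) => s t est.
have nst := eirr _ _ est; have sW := eW _ _ est; have tW := eW t s (etrans (esym _ _) est).
have <- : y' s t = y s t by rewrite /y' (negPf nst).
have ne := (negPf nuv, negPf nab, negPf nau, negPf nav, negPf nbu, negPf nbv).
have {}ne := (ne, eq_sym v u, eq_sym b a, eq_sym u a, eq_sym v a, eq_sym u b, eq_sym v b).
move: sW tW nst; rewrite /inner /= !vsE !inE -!orbA.
by case/or4P => /eqP ->; case/or4P => /eqP ->; rewrite ?eqxx ?ne //= => _;
  rewrite ?y'0 ?(y'C v u) ?(y'C a u) ?(y'C b u) ?(y'C a v) ?(y'C b v) ?(y'C b a); field.
Qed.

Lemma sphere_good n F : sphere F -> (#|cover F| = n + 4)%N ->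
  exists (K : finType) (q : K -> T * 'I_3 -> R), #|K| = (2 ^ n)%N /\ good (sc_adj F) (cover F) q.
Proof.
elim: n F => [|n IH] F sF cF; have [u [v [a [b C]]]] := contractible_exists sF;
  have [nuv nab nau nav nbu nbv aF bF only] := C.
- have cW : [set u; v; a; b] = cover F.
    have [sub c4] := contractible_card4 C.
    by apply/eqP; rewrite eqEcard sub cF c4.
  have [|||z Hz] := @tetrahedron_indep (sc_adj F) u v a b _ _ nuv nab nau nav nbu nbv.
  + by move=> x y; apply: sc_adjC.
  + by move=> x y /andP[].
  + by move=> s t /adj_in_cover; rewrite cW.
  exists unit, (fun=> z); rewrite card_unit; split=> //; split=> // -[] [] //.
have big : (4 < #|cover F|)%N by rewrite cF addSn ltnS leq_addl.
have sF' := contract_sphere sF C big.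
have cF' : #|cover (contract F u v)| = (n + 4)%N.
  by have := card_cover_contract sF C; rewrite cF addSn => -[].
have [K [q [cK gq]]] := IH _ sF' cF'.
have cov := cover_contract sF C.
have adjm := adj_contract_merge sF C.
have inc x : x \in cover F -> x != u -> x \in cover (contract F u v) by rewrite cov !inE => -> ->.
have [vF aF' bF'] : [/\ v \in cover F, a \in cover F & b \in cover F].
  by split; [apply: mem_cover aF _|apply: mem_cover aF _|apply: mem_cover bF _]; rewrite set3_mem.
have nvu : v != u by rewrite eq_sym.
(* The contraction still has at least four vertices. *)
have [w] : exists w, w \in cover (contract F u v) :\: [set v; a; b].
  apply/set0Pn; rewrite -card_gt0 cardsD subn_gt0.
  apply: leq_ltn_trans (subset_leq_card (subsetIr _ _)) _.
  rewrite cF' -setUA cardsU1 cards2; apply: (@leq_ltn_trans 3); last by rewrite ltn_addl.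
  by case: (_ \notin _); case: (_ != _).
rewrite !inE !negb_or -!andbA => /and4P[nwv nwa nwb wF'].
pose e := sc_adj F; pose e' := sc_adj (contract F u v).
have esym : symmetric e by move=> x y; apply: sc_adjC.
have eirr x y : e x y -> x != y by case/andP.
have e'sym : symmetric e' by move=> x y; apply: sc_adjC.
have e'irr x y : e' x y -> x != y by case/andP.
have e_e' x y : e x y -> x != u -> y != u -> e' x y.
  by move=> xy nx ny; have := adjm x y xy; rewrite !mergeE //; apply; apply: eirr.
have e_u x : e u x -> [\/ x = v, x = a, x = b | [/\ x != v, x != a, x != b, e' v x & ~~ e v x]].
  move=> ux; have [->|nxv] := eqVneq x v; first by constructor 1.
  have [->|nxa] := eqVneq x a; first by constructor 2.
  have [->|nxb] := eqVneq x b; first by constructor 3.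
  have nxu : x != u by rewrite eq_sym; apply: eirr.
  constructor 4; split=> //.
    by have := adjm u x ux; rewrite merge_u mergeE //; apply; rewrite eq_sym.
  by apply/negP => vx; case: (only x ux vx) => ex; rewrite ex eqxx in nxa nxb.
have e_va : e v a by apply: (face_adj aF); rewrite ?set3_mem // eq_sym.
have e_vb : e v b by apply: (face_adj bF); rewrite ?set3_mem // eq_sym.
have uF : u \in cover F by apply: mem_cover aF _; rewrite set3_mem.
have uF' : u \notin cover (contract F u v) by rewrite cov !inE eqxx.
have sub : cover (contract F u v) \subset cover F by rewrite cov subsetDl.
have [q2 gq2] := vertex_split esym eirr e'sym e'irr e_e' e_u e_va e_vb uF uF' sub
  (inc v vF nvu) (inc a aF' nau) (inc b bF' nbu) wF' nab nwv nwa nwb gq.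
by exists (K * bool)%type, q2; rewrite card_prod card_bool cK mulnC -expnS.
Qed.

End Sphere_good.

(** * Generic points *)

Section Avoid.
Local Open Scope ring_scope.
Variable R : realType.

(** A nonempty open interval has positive Lebesgue measure. *)
Lemma avoid_countable (A : set R) (a b : R) : countable A -> a < b -> exists t, [/\ a < t, t < b & ~ A t].
Proof.
move=> cA ab; apply: contrapT => H.
have sub : (`]a, b[%classic `<=` A)%classic.
  move=> t /=; rewrite in_itv /= => /andP[at_ tb]; apply: contrapT => nA; apply: H; exists t; split=> //.
have := countable_lebesgue_measure0 (sub_countable (subset_card_le sub) cA).
rewrite lebesgue_measure_itv /= lte_fin ab -EFinB => /eqP; rewrite eqe subr_eq0 => /eqP e.
by rewrite e ltxx in ab.
Qed.

(** Complex polynomials at real arguments serve twice: for generic real coordinates and for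
    transcendental values in the specialisation. The values to avoid are among the real parts of the
    roots. *)
Lemma avoid_roots (J : countType) (g : J -> {poly R[i]}) (a b : R) : (forall j, g j != 0) -> a < b ->
  exists t, [/\ a < t, t < b & forall j, ~~ root (g j) (t%:C)%C].
Proof.
move=> g0 ab; pose A : set R := (\bigcup_j [set t | root (g j) (t%:C)%C])%classic.
have cA : countable A.
  apply: bigcup_countable => // j _; apply: finite_set_countable.
  have [s ds] := closed_field_poly_normal (g j).
  apply: (sub_finite_set (B := [set` [seq complex.Re z | z <- s]])); last exact: finite_seq.
  move=> t /=; rewrite ds rootZ ?lead_coef_eq0 // root_prod_XsubC => ts.
  by apply/mapP; exists (t%:C)%C.
have [t [at_ tb nA]] := avoid_countable cA ab; exists t; split=> // j.
by apply/negP => rt; apply: nA; exists j.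
Qed.

End Avoid.

Section Generic.
Local Open Scope ring_scope.
Variable R : realType.

Lemma widen_restrict_inj n (m1 m2 : mpoly.multinom n.+1) :
  mpoly.Multinom [tuple m1 (widen_ord (leqnSn n) i) | i < n] = mpoly.Multinom [tuple m2 (widen_ord (leqnSn n) i) | i < n] ->
  m1 ord_max = m2 ord_max -> m1 = m2.
Proof.
move=> e emax; apply/mpoly.mnmP => i.
have [lt|ge] := ltnP i n.
  have := congr1 (fun m : mpoly.multinom n => m (Ordinal lt)) e; rewrite !mpoly.mnmE.
  by have -> : widen_ord (leqnSn n) (Ordinal lt) = i by apply: val_inj.
by have -> : i = ord_max by apply: val_inj; apply/eqP; rewrite /= eqn_leq ge -ltnS ltn_ord.
Qed.

Lemma muni_eq0 n (P : mpoly.mpoly n.+1 rat) : P != 0 -> mpoly.muni P != 0.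
Proof.
move=> P0; have [m mP] : exists m, m \in mpoly.msupp P.
  case: (mpoly.msupp P) (mpoly.msupp_eq0 P) => [|m s _]; first by rewrite eqxx (negPf P0).
  by exists m; rewrite inE eqxx.
pose r (m : mpoly.multinom n.+1) := mpoly.Multinom [tuple m (widen_ord (leqnSn n) i) | i < n].
apply: contraTneq mP => u0; rewrite mpoly.mcoeff_msupp negbK.
have : mpoly.mcoeff (r m) ((mpoly.muni P)`_(m ord_max)) = 0 by rewrite u0 coef0 mpoly.mcoeff0.
rewrite mpoly.muniE coef_sum raddf_sum /=.
have [mP|mP] := boolP (m \in mpoly.msupp P); last by move=> _; apply/eqP; exact: mpoly.memN_msupp_eq0.
rewrite (bigD1_seq m) ?mpoly.msupp_uniq //= big1 ?addr0.
  by rewrite coefZ coefXn eqxx mulr1 mpoly.mcoeffZ mpoly.mcoeffX eqxx mulr1 => ->.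
move=> m' nm; rewrite coefZ coefXn.
have [em|_] := eqVneq (m ord_max) (m' ord_max); last by rewrite mulr0 mpoly.mcoeff0.
rewrite mulr1 mpoly.mcoeffZ mpoly.mcoeffX -/(r m'); have [er|_] := eqVneq (r m') (r m); last by rewrite mulr0.
by rewrite (widen_restrict_inj er (esym em)) eqxx in nm.
Qed.

Definition evalQ (K : numFieldType) n (x : 'I_n -> K) (P : mpoly.mpoly n rat) : K :=
  mpoly.meval x (mpoly.map_mpoly ratr P).

HB.instance Definition _ (K : numFieldType) n (x : 'I_n -> K) :=
  GRing.RMorphism.copy (evalQ x) (mpoly.meval x \o mpoly.map_mpoly (ratr : rat -> K)).

Lemma evalQ_X (K : numFieldType) n (x : 'I_n -> K) (m : mpoly.multinom n) : evalQ x (mpoly.mpolyX _ m) = \prod_i x i ^+ m i.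
Proof. by rewrite /evalQ mpoly.map_mpolyX mpoly.mevalX. Qed.

Lemma evalQ_Z (K : numFieldType) n (x : 'I_n -> K) c P : evalQ x (c *: P) = ratr c * evalQ x P.
Proof. by rewrite /evalQ mpoly.map_mpolyZ mpoly.mevalZ. Qed.

Lemma evalQ_muni (K : numFieldType) n (x : 'I_n.+1 -> K) P :
  evalQ x P = (map_poly (evalQ (fun i => x (widen_ord (leqnSn n) i))) (mpoly.muni P)).[x ord_max].
Proof.
rewrite {1}[P]mpoly.mpolyE mpoly.muniE !rmorph_sum /= horner_sum; apply: eq_bigr => m _.
rewrite evalQ_Z evalQ_X map_polyZ /= map_polyXn hornerZ hornerXn evalQ_Z evalQ_X big_ord_recr /= mulrA.
by congr (_ * _ * _); apply: eq_bigr => i _; rewrite mpoly.mnmE.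
Qed.

Definition alg_indep (K : numFieldType) n (x : 'I_n -> K) := forall P : mpoly.mpoly n rat, P != 0 -> evalQ x P != 0.

(* [mpoly n rat] has no countType structure: it is enumerated by lists of terms. *)
Definition mpoly_of_terms n (s : seq (rat * mpoly.multinom n)) : mpoly.mpoly n rat :=
  \sum_(t <- s) t.1 *: mpoly.mpolyX _ t.2.

Lemma mpoly_of_termsK n (P : mpoly.mpoly n rat) :
  mpoly_of_terms [seq (mpoly.mcoeff m P, m) | m <- mpoly.msupp P] = P.
Proof. by rewrite /mpoly_of_terms big_map /= -mpoly.mpolyE. Qed.

(** One coordinate is chosen at a time. When x is algebraically independent, a nonzero polynomial
    over Q stays nonzero in its last variable after x is substituted; there are countably many, each
    with finitely many roots. *)
Lemma alg_indep_dense n (x0 : 'I_n -> R) d : 0 < d ->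
  exists x : 'I_n -> R, (forall i, `|x i - x0 i| < d) /\ alg_indep x.
Proof.
move=> d0; elim: n x0 => [|n IH] x0.
  exists x0; split=> [[]//|P P0].
  rewrite (mpoly.nvar0_mpolyC P) /evalQ mpoly.map_mpolyC mpoly.mevalC fmorph_eq0.
  by apply: contraNneq P0 => c0; rewrite (mpoly.nvar0_mpolyC P) c0 mpoly.mpolyC0.
have [x [xn xi]] := IH (fun i => x0 (widen_ord (leqnSn n) i)).
pose emb : R -> R[i] := fun t => (t%:C)%C.
(* The value 1 at P = 0 keeps the whole enumerated family nonzero. *)
pose g (s : seq (rat * mpoly.multinom n.+1)) : {poly R[i]} :=
  let P := mpoly_of_terms s in
  if P == 0 then 1 else map_poly emb (map_poly (evalQ x) (mpoly.muni P)).
have map0 (Q : {poly mpoly.mpoly n rat}) : Q != 0 -> map_poly (evalQ x) Q != 0.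
  by move=> Q0; rewrite -lead_coef_eq0 lead_coef_map_eq ?xi // lead_coef_eq0.
have g0 s : g s != 0.
  rewrite /g; case: ifP => [_|/negbT P0]; first exact: oner_neq0.
  by rewrite map_poly_eq0 map0 // muni_eq0.
have ab : x0 ord_max - d < x0 ord_max + d by lra.
have [t [t1 t2 Ht]] := avoid_roots g0 ab.
pose y (i : 'I_n.+1) := oapp x t (insub (val i)).
have yw i : y (widen_ord (leqnSn n) i) = x i by rewrite /y /= valK.
have ymax : y ord_max = t by rewrite /y /= insubN // ltnn.
exists y; split=> [i|P P0].
  have [lt|ge] := ltnP i n.
    have -> : i = widen_ord (leqnSn n) (Ordinal lt) by apply: val_inj.
    by rewrite yw.
  have -> : i = ord_max by apply: val_inj; apply/eqP; rewrite /= eqn_leq ge -ltnS ltn_ord.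
  by rewrite ymax ltr_norml; apply/andP; split; lra.
rewrite evalQ_muni ymax (_ : (fun i => y _) = x); last by apply/funext.
have := Ht [seq (mpoly.mcoeff m P, m) | m <- mpoly.msupp P].
rewrite /g mpoly_of_termsK (negPf P0) /root -[(t%:C)%C]/(emb t) horner_map fmorph_eq0 //.
Qed.

End Generic.

(** * Congruence and specialisation *)

Section Congruence.
Local Open Scope ring_scope.
Variables (K : fieldType).
Implicit Types (x y : 'cV[K]_3).

(** Bilinear also over the complex numbers, to match [sqnorm]. *)
Definition dotc x y : K := (x^T *m y) 0 0.

Lemma sqnorm_dotc x : sqnorm x = dotc x x.
Proof. by rewrite /sqnorm /dotc mxE; apply: eq_bigr => i _; rewrite mxE expr2. Qed.

Lemma dotcC x y : dotc x y = dotc y x.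
Proof. by rewrite /dotc -[x^T *m y]trmxK trmx_mul trmxK mxE. Qed.

Lemma dotcDl x y z : dotc (x + y) z = dotc x z + dotc y z.
Proof. by rewrite /dotc linearD /= mulmxDl mxE. Qed.

Lemma dotcNl x z : dotc (- x) z = - dotc x z.
Proof. by rewrite /dotc linearN /= mulNmx mxE. Qed.

Lemma dotcDr x y z : dotc z (x + y) = dotc z x + dotc z y.
Proof. by rewrite dotcC dotcDl !(dotcC z). Qed.

Lemma dotcNr x z : dotc z (- x) = - dotc z x.
Proof. by rewrite dotcC dotcNl dotcC. Qed.

Lemma sqnorm_orthogonal (A : 'M[K]_3) x : A^T *m A = 1%:M -> sqnorm (A *m x) = sqnorm x.
Proof. by move=> AA; rewrite !sqnorm_dotc /dotc trmx_mul mulmxA -[_ *m A]mulmxA AA mulmx1. Qed.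

Lemma congruent_sqnorm (T : finType) (p q : T -> 'cV[K]_3) u v : congruent p q ->
  sqnorm (q u - q v) = sqnorm (p u - p v).
Proof.
move=> [A [b [AA _ H]]]; rewrite !H opprD addrACA subrr addr0 -mulmxBr.
exact: sqnorm_orthogonal.
Qed.

End Congruence.

(** * Real configurations with equal distances *)

Section Real_congruence.
Local Open Scope ring_scope.
Variables (R : realFieldType) (T : finType).
Implicit Types (x y : 'cV[R]_3).

Lemma sqnorm_eq0 x : sqnorm x = 0 -> x = 0.
Proof.
move=> /eqP; rewrite psumr_eq0 => [/allP H|i _]; last exact: sqr_ge0.
apply/colP => i; rewrite mxE; apply/eqP; rewrite -sqrf_eq0.
by apply: (implyP (H i _)) => //; rewrite mem_index_enum.
Qed.

Definition reflection (u : 'cV[R]_3) : 'M[R]_3 := 1%:M - (2 / sqnorm u) *: (u *m u^T).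

Lemma reflectionE u x : reflection u *m x = x - (2 * dotc u x / sqnorm u) *: u.
Proof.
rewrite /reflection mulmxBl mul1mx -scalemxAl -mulmxA [u^T *m x]mx11_scalar -/(dotc u x).
by rewrite mul_mx_scalar scalerA; congr (_ - _ *: _); ring.
Qed.

Lemma reflection_orthogonal u : u != 0 -> (reflection u)^T *m reflection u = 1%:M.
Proof.
move=> u0; have n0 : sqnorm u != 0 by apply: contraNneq u0 => /sqnorm_eq0 ->.
have -> : (reflection u)^T = reflection u.
  by rewrite /reflection linearB /= trmx1 linearZ /= trmx_mul trmxK.
apply/matrixP => i j; have := congr1 (fun c : 'cV[R]_3 => c i 0) (reflectionE u (reflection u *m delta_mx j 0)).
rewrite mulmxA -colE mxE => ->; rewrite !reflectionE.
rewrite dotcDr dotcNr (_ : dotc u (_ *: u) = (2 * dotc u (delta_mx j 0) / sqnorm u) * sqnorm u); last first.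
  by rewrite sqnorm_dotc /dotc -scalemxAr mxE.
rewrite divfK // !mxE eqxx andbT; field.
exact: n0.
Qed.

(** As in the theorem of Cartan and Dieudonné, points are matched one by one. The reflection in u =
    A X(t0) - Y(t0) takes A X(t0) to Y(t0), their norms being equal, and fixes each Y(t) already
    matched, which is orthogonal to u. *)
Lemma isometry_extends (X Y : T -> 'cV[R]_3) : (forall s t, dotc (X s) (X t) = dotc (Y s) (Y t)) ->
  exists A : 'M[R]_3, A^T *m A = 1%:M /\ forall t, A *m X t = Y t.
Proof.
move=> H; suff [A [AA HA]] : exists A : 'M[R]_3, A^T *m A = 1%:M /\ forall t, t \in enum T -> A *m X t = Y t.
  by exists A; split=> // t; apply: HA; rewrite mem_enum.
elim: (enum T) => [|t0 s [A [AA HA]]]; first by exists 1%:M; rewrite trmx1 mulmx1; split.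
have [e|ne] := eqVneq (A *m X t0) (Y t0).
  by exists A; split=> // t; rewrite inE => /orP[/eqP ->|/HA].
pose u := A *m X t0 - Y t0; have u0 : u != 0 by rewrite subr_eq0.
have n0 : sqnorm u != 0 by apply: contraNneq u0 => /sqnorm_eq0 ->.
have dA x y : dotc (A *m x) (A *m y) = dotc x y.
  by rewrite /dotc trmx_mul mulmxA -[_ *m A]mulmxA AA mulmx1.
exists (reflection u *m A); split.
  by rewrite trmx_mul mulmxA -[_ *m reflection u]mulmxA reflection_orthogonal // mulmx1.
move=> t; rewrite inE -mulmxA reflectionE => /orP[/eqP ->|ts].
  have -> : 2 * dotc u (A *m X t0) = sqnorm u.
    rewrite sqnorm_dotc /u !(dotcDl, dotcDr, dotcNl, dotcNr) !dA H.
    by rewrite (dotcC (Y t0) (A *m _)); ring.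
  by rewrite divff // scale1r /u opprB addrC subrK.
rewrite HA // (_ : dotc u (Y t) = 0) ?mulr0 ?mul0r ?scale0r ?subr0 //.
by rewrite /u dotcDl dotcNl -{1}(HA t ts) dA H subrr.
Qed.

(** A real statement: over the complex numbers isotropic vectors are counterexamples. The passage to
    complex realisations uses it only for the real ones. *)
Lemma sqnorm_congruent (p q : T -> 'cV[R]_3) :
  (forall u v, sqnorm (p u - p v) = sqnorm (q u - q v)) -> congruent p q.
Proof.
move=> H; have [x0|e] := pickP (fun _ : T => true); last first.
  by exists 1%:M, 0; rewrite trmx1 mulmx1; split=> // v; have := e v.
move=> _; have polar x y : 2 * dotc x y = sqnorm x + sqnorm y - sqnorm (x - y).
  by rewrite !sqnorm_dotc !(dotcDl, dotcDr, dotcNl, dotcNr) (dotcC y x); ring.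
have [|A [AA HA]] := @isometry_extends (fun t => p t - p x0) (fun t => q t - q x0).
  move=> s t; apply: (mulfI (_ : 2 != 0 :> R)); first by rewrite pnatr_eq0.
  rewrite !polar !H (_ : p s - p x0 - (p t - p x0) = p s - p t); last by rewrite opprB addrA subrK.
  by rewrite (_ : q s - q x0 - (q t - q x0) = q s - q t) ?H // opprB addrA subrK.
exists A, (q x0 - A *m p x0); split=> //; first exact: mulmx1C.
by move=> v; rewrite addrCA -mulmxBr HA addrC subrK.
Qed.

End Real_congruence.

(** * Extending specialisations by further numbers *)

Section Transfer.
Local Open Scope ring_scope.
Variable R : realType.
Local Notation K := R[i].

(** The same polynomial relations hold at both specialisations; this replaces an isomorphism between
    their images. *)
Definition same_kernel (A : comNzRingType) (phi psi : {rmorphism A -> K}) := forall x, (phi x == 0) = (psi x == 0).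
Definition enumerable (A : Type) := exists (J : countType) (g : J -> A), forall x, exists j, g j = x.

Section Step.
Local Open Scope ring_scope.
Variables (A : comNzRingType) (phi psi : {rmorphism A -> K}).
Implicit Types (P Q S : {poly A}).

Lemma same_kernel_map_eq0 P : same_kernel phi psi -> (map_poly phi P == 0) = (map_poly psi P == 0).
Proof.
move=> ker; apply/eqP/eqP => H; apply/polyP => i; rewrite coef_map coef0; apply/eqP.
  by rewrite /= -ker -coef_map H coef0.
by rewrite /= ker -coef_map H coef0.
Qed.
End Step.

(** For n the size of a relation satisfied by w, this expresses that it has the degree of the
    minimal polynomial over the fraction field of the image, without forming that field. *)
Definition minimal_at (A : comNzRingType) (phi : {rmorphism A -> K}) w n :=
  forall Q : {poly A}, (size Q < n)%N -> (map_poly phi Q).[w] = 0 -> map_poly phi Q = 0.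

Lemma minimal_relation (A : comNzRingType) (phi : {rmorphism A -> K}) w (P0 : {poly A}) :
  map_poly phi P0 != 0 -> (map_poly phi P0).[w] = 0 ->
  exists P, [/\ map_poly phi P != 0, (map_poly phi P).[w] = 0, phi (lead_coef P) != 0,
    (size P <= size P0)%N & minimal_at phi w (size P)].
Proof.
have [n] := ubnP (size P0); elim: n P0 => // n IH P0 lt nz r0.
have [H|H] := pselect (minimal_at phi w (size P0)).
  have [l0|l0] := eqVneq (phi (lead_coef P0)) 0; last by exists P0.
  have P00 : P0 != 0 by apply: contraNneq nz => ->; rewrite map_poly0.
  (* phi kills the leading coefficient, so dropping the leading term leaves the image unchanged. *)
  pose Q := P0 - lead_coef P0 *: 'X^((size P0).-1).
  have mQ : map_poly phi Q = map_poly phi P0.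
    by rewrite /Q rmorphB /= map_polyZ /= l0 scale0r subr0.
  have sQ : (size Q < size P0)%N.
    have s0 : (0 < size P0)%N by rewrite size_poly_gt0.
    rewrite -(prednK s0) ltnS; apply/leq_sizeP => j; rewrite leq_eqVlt => /orP[/eqP <-|lj].
      by rewrite coefB coefZ coefXn eqxx mulr1 subrr.
    rewrite coefB coefZ coefXn gtn_eqF // mulr0 subr0 nth_default //.
    by rewrite -(prednK s0).
  by have := H Q sQ; rewrite mQ => /(_ r0) /eqP; rewrite (negPf nz).
have [Q [sQ rQ nQ]] : exists Q : {poly A}, [/\ (size Q < size P0)%N, (map_poly phi Q).[w] = 0 & map_poly phi Q != 0].
  apply: contrapT => H'; apply: H => Q sQ rQ; apply: contrapT => nQ; apply: H'; exists Q; split=> //.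
  exact/eqP.
have [P [nP rP lP sP mP]] := IH Q (leq_trans sQ lt) nQ rQ.
by exists P; split=> //; apply: leq_trans sP (ltnW sQ).
Qed.

Lemma pseudo_division (A : comNzRingType) (P Q : {poly A}) : P != 0 ->
  exists k S N, [/\ lead_coef P ^+ k *: Q = S * P + N & (size N < size P)%N].
Proof.
move=> P0; exists (Pdiv.Ring.rscalp Q P), (Pdiv.Ring.rdivp Q P), (Pdiv.Ring.rmodp Q P).
by rewrite Pdiv.ComRing.rdivp_eq Pdiv.Ring.ltn_rmodp.
Qed.

(** If w is algebraic over the image of phi, w' is a root of the image under psi of a minimal
    relation P, and vanishing at w or w' is decided by the pseudo-remainder modulo P. If w is
    transcendental, w' must be so too. *)
Lemma extend_root (A : comNzRingType) (phi psi : {rmorphism A -> K}) w :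
  same_kernel phi psi -> enumerable A ->
  exists w', forall Q : {poly A}, ((map_poly phi Q).[w] == 0) = ((map_poly psi Q).[w'] == 0).
Proof.
move=> ker [J [g gsurj]].
have mker Q : map_poly phi Q = 0 <-> map_poly psi Q = 0.
  by split=> /eqP H; apply/eqP; move: H; rewrite (same_kernel_map_eq0 _ ker).
have [[P0 [n0 r0]]|alg] := pselect (exists P, map_poly phi P != 0 /\ (map_poly phi P).[w] = 0).
- have [P [nP rP lP _ mP]] := minimal_relation n0 r0.
  have P0' : P != 0 by apply: contraNneq nP => ->; rewrite map_poly0.
  have sphi : size (map_poly phi P) = size P by rewrite size_map_poly_id0.
  have lPpsi : psi (lead_coef P) != 0 by rewrite -ker.
  have spsi : size (map_poly psi P) = size P by rewrite size_map_poly_id0.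
  have s1 : size P != 1%N.
    rewrite -sphi; apply/negP => /size_poly1P[c c0 ec].
    by move: rP; rewrite ec hornerC => /eqP; rewrite (negPf c0).
  have /closed_rootP[w' rw'] : size (map_poly psi P) != 1%N by rewrite spsi.
  (* A shorter relation N at w' would pseudo-divide P: the remainder vanishes under psi, hence under
     phi, and then w is a root of N or of the quotient S, both too short. *)
  have npsi : minimal_at psi w' (size P).
    move=> N0 sN0 rN0; apply/eqP/negbNE/negP => nN0.
    have [N [nN rN lN sN mN]] := minimal_relation nN0 rN0.
    have N0' : N != 0 by apply: contraNneq nN => ->; rewrite map_poly0.
    have sNP : (size N < size P)%N by apply: leq_ltn_trans sN sN0.
    have [k [S [M [eM sM]]]] := pseudo_division P N0'.
    have Mpsi : map_poly psi M = 0.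
      apply: (mN M sM); have := congr1 (fun p => (map_poly psi p).[w']) eM.
      rewrite map_polyZ rmorphD rmorphM /= hornerZ hornerD hornerM rN mulr0 add0r => <-.
      by rewrite (eqP rw') mulr0.
    have Mphi : map_poly phi M = 0 by apply/mker.
    have := congr1 (map_poly phi) eM; rewrite map_polyZ rmorphD rmorphM /= Mphi addr0 rmorphXn /= => eS.
    have lNphi : phi (lead_coef N) != 0 by rewrite ker.
    have sNphi : size (map_poly phi N) = size N by rewrite size_map_poly_id0.
    have nNphi : map_poly phi N != 0 by rewrite -size_poly_eq0 sNphi size_poly_eq0.
    have rNphi : (map_poly phi N).[w] != 0 by apply: contraNneq nNphi => /(mP N sNP) ->.
    have nS : map_poly phi S != 0.
      apply: contraNneq nP => S0; move: eS; rewrite S0 mul0r => /eqP.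
      by rewrite scaler_eq0 expf_eq0 (negPf lNphi) andbF.
    have rS : (map_poly phi S).[w] = 0.
      have := congr1 (fun p : {poly K} => p.[w]) eS; rewrite hornerZ rP mulr0 hornerM => /esym/eqP.
      by rewrite mulf_eq0 (negPf rNphi) orbF => /eqP.
    have sS : (size (map_poly phi S) < size P)%N.
      have := congr1 (fun p : {poly K} => size p) eS.
      rewrite size_scale ?expf_neq0 // sphi size_mul // sNphi => ->.
      have sN1 : (1 < size N)%N.
        rewrite ltn_neqAle eq_sym size_poly_gt0 N0' andbT.
        have sNpsi : size (map_poly psi N) = size N by rewrite size_map_poly_id0.
        rewrite -sNpsi; apply/negP => /size_poly1P[c c0 ec].
        by move: rN; rewrite ec hornerC => /eqP; rewrite (negPf c0).
      have : (0 < size (map_poly phi S))%N by rewrite size_poly_gt0.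
      by move: sN1; case: (size N) => [|[|m]] //; case: (size _) => [|l] // _ _; rewrite addSn /= !addnS !ltnS leq_addr.
    (* S may have high coefficients killed by phi; truncation makes the polynomial itself short
       without changing its image. *)
    pose S' := take_poly (size (map_poly phi S)) S.
    have eS' : map_poly phi S' = map_poly phi S.
      apply/polyP => i; rewrite !coef_map coef_take_poly; case: ltnP => // le.
      have := nth_default 0 le; rewrite coef_map /= rmorph0 => ->; exact: rmorph0.
    have := mP S' (leq_ltn_trans (size_take_poly _ _) sS); rewrite eS' => /(_ rS) /eqP.
    by rewrite (negPf nS).
  exists w' => Q; have [k [S [N [eN sN]]]] := pseudo_division Q P0'.
  have eval (th : {rmorphism A -> K}) y : th (lead_coef P) != 0 -> (map_poly th P).[y] = 0 ->
      ((map_poly th Q).[y] == 0) = ((map_poly th N).[y] == 0).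
    move=> l0 rP'; have := congr1 (fun p => (map_poly th p).[y]) eN.
    rewrite map_polyZ rmorphD rmorphM /= hornerZ hornerD hornerM rP' mulr0 add0r rmorphXn /= => <-.
    by rewrite mulf_eq0 expf_eq0 (negPf l0) andbF.
  rewrite (eval phi) // (eval psi) //; last exact/eqP.
  apply/eqP/eqP => [/(mP N sN)|/(npsi N sN)] /mker ->; exact: horner0.
(* The transcendental case: w' avoids the roots of all nonzero images under psi, of which there are
   countably many. *)
- have nroot Q : map_poly phi Q != 0 -> (map_poly phi Q).[w] != 0.
    by move=> nQ; apply: contra_notN alg => /eqP rQ; exists Q.
  pose G (s : seq J) : {poly K} := let P := map_poly psi (Poly [seq g j | j <- s]) in if P == 0 then 1 else P.
  have G0 s : G s != 0 by rewrite /G; case: ifP => [_|/negbT //]; exact: oner_neq0.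
  have [t [_ _ Ht]] := avoid_roots G0 (ltr01 : 0 < 1 :> R).
  exists (t%:C)%C => Q.
  have [s ds] : exists s, Poly [seq g j | j <- s] = Q.
    have /choice[h Hh] := gsurj; exists [seq h c | c <- polyseq Q].
    by rewrite -map_comp (eq_map (g := id)) ?map_id ?polyseqK // => c /=; apply: Hh.
  have := Ht s; rewrite /G ds.
  have [Q0|Q0] := eqVneq (map_poly psi Q) 0.
    by rewrite Q0; have /mker -> := Q0; rewrite !horner0 eqxx.
  move=> /negPf nr; rewrite -[RHS]/(root _ _) nr; apply/negbTE/nroot.
  by apply: contraNneq Q0 => /mker ->.
Qed.

(* The numbers are adjoined one at a time, replacing A by {poly A}. *)
Lemma extend_family (I : finType) (w : I -> K) (A : comNzRingType) (phi psi : {rmorphism A -> K}) :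
  same_kernel phi psi -> enumerable A ->
  exists (B : comNzRingType) (phi' psi' : {rmorphism B -> K}) (iota : A -> B) (b : I -> B),
    [/\ same_kernel phi' psi', forall x, phi' (iota x) = phi x, forall x, psi' (iota x) = psi x &
        forall i, phi' (b i) = w i].
Proof.
move=> ker enu.
suff [B [phi' [psi' [iota [b [H1 H2 H3 H4]]]]]] : exists (B : comNzRingType) (phi' psi' : {rmorphism B -> K}) (iota : A -> B) (b : I -> B),
    [/\ same_kernel phi' psi', forall x, phi' (iota x) = phi x, forall x, psi' (iota x) = psi x &
        forall i, i \in enum I -> phi' (b i) = w i].
  by exists B, phi', psi', iota, b; split=> // i; apply: H4; rewrite mem_enum.
elim: (enum I) A phi psi ker enu => [|i0 s IH] A phi psi ker enu.
  by exists A, phi, psi, id, (fun=> 0).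
have [w' Hw'] := extend_root (w i0) ker enu.
pose phi1 : {rmorphism {poly A} -> K} := horner_eval (w i0) \o map_poly phi.
pose psi1 : {rmorphism {poly A} -> K} := horner_eval w' \o map_poly psi.
have [|B [phi' [psi' [iota [b [H1 H2 H3 H4]]]]]] := IH {poly A} phi1 psi1 Hw'.
  have [J [g gsurj]] := enu; exists (seq J), (fun s => Poly [seq g j | j <- s]) => Q.
  have /choice[h Hh] := gsurj; exists [seq h c | c <- polyseq Q].
  by rewrite -map_comp (eq_map (g := id)) ?map_id ?polyseqK // => c /=; apply: Hh.
exists B, phi', psi', (fun x => iota x%:P), (fun i => if i == i0 then iota 'X else b i); split=> //.
- by move=> x; rewrite H2 /= /horner_eval map_polyC hornerC.
- by move=> x; rewrite H3 /= /horner_eval map_polyC hornerC.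
- move=> i; rewrite inE; have [->|_] /= := eqVneq i i0; last exact: H4.
  by rewrite H2 /= /horner_eval map_polyX hornerX.
Qed.

End Transfer.

(** * The two inequalities *)

Section Realisation_numbers.
Local Open Scope ring_scope.

Lemma evalQ_rmorph (K L : numFieldType) (f : {rmorphism K -> L}) n (x : 'I_n -> K) P :
  evalQ (fun j => f (x j)) P = f (evalQ x P).
Proof.
rewrite [P]mpolyE [LHS]rmorph_sum [evalQ x _]rmorph_sum [RHS]rmorph_sum.
apply: eq_bigr => m _ /=.
rewrite !evalQ_Z !evalQ_X rmorphM rmorph_prod fmorph_rat; congr (_ * _).
by apply: eq_bigr => i _; rewrite rmorphXn.
Qed.

Lemma enumerable_mpoly n : enumerable (mpoly n rat).
Proof.
exists (seq (rat * multinom n)), (@mpoly_of_terms n) => P.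
by eexists; apply: mpoly_of_termsK.
Qed.

(** Equality and inequality of squared distances both say whether an element lies in a kernel, so
    equivalence and non-congruence pass together to the complex realisations. *)
Lemma r3_ge_c3_ge (T : finType) (F : {set {set T}}) k : r3_ge F k -> c3_ge F k.
Proof.
move=> [p gp [qs [eqs nqs]]] q gq.
pose emb : {rmorphism RR -> CC} := real_complex RR.
pose xp (j : 'I_#|{: T * 'I_3}|) := p (enum_val j).1 (enum_val j).2 0.
pose xq (j : 'I_#|{: T * 'I_3}|) := q (enum_val j).1 (enum_val j).2 0.
pose phi : {rmorphism mpoly _ rat -> CC} := evalQ (fun j => emb (xp j)).
pose psi : {rmorphism mpoly _ rat -> CC} := evalQ xq.
(* By genericity of p and q both kernels are zero. *)
have ker : same_kernel phi psi.
  move=> P; have [->|P0] := eqVneq P 0; first by rewrite !rmorph0.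
  rewrite [psi P == 0](negPf (gq P P0)) /phi /= (evalQ_rmorph emb) fmorph_eq0.
  exact/negbTE/(gp P P0).
pose w (i : 'I_k * (T * 'I_3)) := emb (qs i.1 i.2.1 i.2.2 0).
have [B [phi' [psi' [iota [b [ker' Hphi Hpsi Hb]]]]]] := extend_family w ker (enumerable_mpoly _).
pose X (t : T) c : B := iota (mpolyX _ (mnm1 (enum_rank (t, c)))).
pose sq (f : T -> 'I_3 -> B) s t := \sum_(c < 3) (f s c - f t c) ^+ 2.
have Xphi s c : phi' (X s c) = emb (p s c 0).
  by rewrite /X Hphi /phi /= /evalQ map_mpolyX mevalXU /xp enum_rankK.
have Xpsi s c : psi' (X s c) = q s c 0.
  by rewrite /X Hpsi /psi /= /evalQ map_mpolyX mevalXU /xq enum_rankK.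
pose q' i (s : T) : 'cV[CC]_3 := \col_c psi' (b (i, (s, c))).
have sqphi f (r : T -> 'cV[RR]_3) s t : (forall s c, phi' (f s c) = emb (r s c 0)) ->
    phi' (sq f s t) = emb (sqnorm (r s - r t)).
  move=> H; rewrite /sq /sqnorm [LHS]rmorph_sum [RHS]rmorph_sum; apply: eq_bigr => c _.
  by rewrite !rmorphXn rmorphB !H !mxE rmorphB.
have sqpsi f (r : T -> 'cV[CC]_3) s t : (forall s c, psi' (f s c) = r s c 0) ->
    psi' (sq f s t) = sqnorm (r s - r t).
  move=> H; rewrite /sq /sqnorm rmorph_sum; apply: eq_bigr => c _.
  by rewrite rmorphXn rmorphB !H !mxE.
pose Y i (s : T) c := b (i, (s, c)).
have Yphi i s c : phi' (Y i s c) = emb (qs i s c 0) by rewrite /Y Hb.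
have Ypsi i s c : psi' (Y i s c) = q' i s c 0 by rewrite mxE.
have transfer f g s t s' t' : (phi' (sq f s t) == phi' (sq g s' t')) = (psi' (sq f s t) == psi' (sq g s' t')).
  by rewrite -subr_eq0 -rmorphB ker' rmorphB subr_eq0.
exists q'; split.
- move=> i s t adj; apply/eqP.
  rewrite -(sqpsi _ _ s t Xpsi) -(sqpsi _ _ s t (Ypsi i)) -transfer.
  by rewrite (sqphi _ _ _ _ Xphi) (sqphi _ _ _ _ (Yphi i)) (eqs i s t adj).
- move=> i j nij /congruent_sqnorm cong; apply: (nqs i j nij); apply: sqnorm_congruent => s t.
  have := cong s t => /eqP; rewrite -(sqpsi _ _ s t (Ypsi i)) -(sqpsi _ _ s t (Ypsi j)) -transfer.
  rewrite (sqphi _ _ _ _ (Yphi i)) (sqphi _ _ _ _ (Yphi j)) => /eqP /(fmorph_inj emb) ->.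
  by [].
Qed.

Lemma triangulated_sphere_r3_ge (T : finType) (F : {set {set T}}) :
  triangulated_sphere F -> r3_ge F (2 ^ (#|T| - 4)).
Proof.
move=> tF; have sF := triangulated_sphere_sphere tF; have covF := triangulated_sphere_cover tF.
have T4 : (4 <= #|T|)%N by rewrite -cardsT -covF sphere_card_ge4.
have cF : #|cover F| = (#|T| - 4 + 4)%N by rewrite subnK // covF cardsT.
have [K [q [cK gq]]] := sphere_good RR sF cF.
have esym : symmetric (sc_adj F) by move=> x y; apply: sc_adjC.
have eirr x y : sc_adj F x y -> x != y by case/andP.
have [k0 _] : exists k0 : K, true.
  by have : (0 < #|K|)%N by [rewrite cK expn_gt0]; case/card_gt0P => k0; exists k0.
have [d d0 Hd] := good_move esym eirr gq k0 ltr01.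
have [x [xn xi]] := alg_indep_dense (fun j : 'I_#|{: T * 'I_3}| => q k0 (enum_val j)) d0.
have [|q' [[len dis _] q'0 _]] := Hd (fun i => x (enum_rank i)).
  by move=> i; have := xn (enum_rank i); rewrite enum_rankK.
pose real (z : T * 'I_3 -> RR) (t : T) : 'cV[RR]_3 := \col_c z (t, c).
have realE z s t : sqnorm (real z s - real z t) = dist2 z s t.
  by rewrite /sqnorm !big_ord_recl big_ord0 !mxE addr0 addrA.
exists (real (q' k0)).
  move=> P P0; have := xi P P0; rewrite /evalQ.
  rewrite (_ : (fun j => _) = x) //; apply/funext => j.
  by rewrite mxE q'0 -surjective_pairing enum_valK.
rewrite -cK; exists (fun i => real (q' (enum_val i))); split.
- by move=> i s t adj; rewrite !realE; apply: len.
- move=> i j nij /congruent_sqnorm cong.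
  have [|s [t [_ _ /eqP ne]]] := dis (enum_val i) (enum_val j).
    by rewrite (inj_eq enum_val_inj).
  by apply: ne; rewrite -!realE cong.
Qed.

End Realisation_numbers.

(* c_3(G) >= r_3(G) >= 2^(|V|-4) for every triangulated sphere G *)
Theorem theorem1p3 (T : finType) (F : {set {set T}}) :
  triangulated_sphere F ->
  (forall k : nat, r3_ge F k -> c3_ge F k) /\ r3_ge F (2 ^ (#|T| - 4)).
Proof.
move=> tF; split; first by move=> k; apply: r3_ge_c3_ge.
exact: triangulated_sphere_r3_ge.
Qed.
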